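(* Assume: (1a) for all $i,j,t$: $\mathbb{E}[\epsilon_{it}\mid\boldsymbol{\mu}_j]=\mathbb{E}[\epsilon_{it}]=0$; (1b) for all $s\neq t$: $\mathbb{E}[\eta_{it}\mid\mu_{js}]=0$; (1c) for all $s\neq t$: $(\overline{\epsilon}_{jt},\overline{\eta}_{jt})$ is independent of $(\overline{\epsilon}_{js},\overline{\eta}_{js})$; (2a) $\mathbb{E}(\ddot{\boldsymbol X}_j'\ddot{\boldsymbol X}_j)$ is finite and invertible; (2b) $0<\mathrm{Var}(\mu^*_{jt})<\infty$; (2c) $\mathbb{E}(\ddot{\boldsymbol X}_j'\ddot{\boldsymbol\mu}_j)=0$, $\mathbb{E}(\ddot{\boldsymbol X}_j'\ddot{\boldsymbol\epsilon}_j)=0$ and $\mathbb{E}(\ddot{\boldsymbol X}_j'\ddot{\boldsymbol\eta}_j)=0$; (3a) $(\boldsymbol\beta_0,\boldsymbol\beta_0^Y,\kappa_0)$ is in the interior of $\boldsymbol\Theta_1$, a compact subset of $\mathbb{R}^{2K+1}$; (3b) each of $m_1,m_3,g_1$ satisfies $\mathbb{E}\big(\sup_{\boldsymbol\Theta_1}\|m(\boldsymbol Z_j,\cdot)\|^2\big)<\infty$; (3c) $(\boldsymbol X_j,\boldsymbol\mu_j,\boldsymbol\epsilon_j,\boldsymbol Y_j^{obs},\boldsymbol\eta_j)$ are i.i.d. across $j$; (3d) for every parameter value in $\mathbb{R}^{2K+1}$, $\mathbb{E}(m_1m_1')$, $\mathbb{E}(m_3m_3')$, $\mathbb{E}(g_1g_1')$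 are finite; (3e) $\mathbb{E}\sup_{\boldsymbol\Theta_1}\big\|\widetilde{\boldsymbol R}_j^{(-t)\prime}\widetilde{\boldsymbol R}_j^{(-t)}\big\|<\infty$. Let $\widehat\kappa^*$ be the $\kappa$-component of the GMM estimator based on the moment function $\widetilde g_1=(m_1',m_3',g_1')'$ with weighting matrix $\widehat W^*$. Then, as $J\to\infty$ with $T$ and $n_j$ fixed, $\sqrt J(\widehat\kappa^*-\kappa_0)$ converges in distribution to $\mathcal N(0,\sigma_*^2)$, and $\sigma_*^2\le\sigma^2$.
   Context: Teachers are indexed by $j=1,\dots,J$, years by $t=1,\dots,T$ ($T$ fixed). In each year teacher $j$ teaches a class of $n_j$ students ($n_j$ constant over time). For student $i$ matched to teacher $j$ in year $t$, the observed test score and observed adult earnings are $$R^{obs}_{it}=X_{it}'\boldsymbol\beta_0+\mu_{jt}+\epsilon_{it},\qquad Y^{obs}_i=X_{it}'\boldsymbol\beta_0^Y+\kappa_0\mu_{jt}+\eta_{it},$$ with $X_{it}\in\mathbb{R}^K$ observed covariates, $\mu_{jt}$ the unobserved value added of teacher $j$ in year $t$, $\epsilon_{it},\eta_{it}$ unobserved scalars, and fixed parameters $\boldsymbol\beta_0,\boldsymbol\beta_0^Y\in\mathbb{R}^K$, $\kappa_0\in\mathbb{R}$. Value added has mean $0$ and is stationary: its mean does not vary with $t$ and the correlation of $\mu_{jt}$ and $\mu_{js}$ depends only on $|s-t|$. For a student-level variable $H$, $\overline H_{jt}=\frac1{n_j}\sum_i H_{it}$ is the class average (for $\mu$, $\overline\mu_{jt}=\mu_{jt}$)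 and $\ddot H_{jt}=\overline H_{jt}-\frac1T\sum_t\overline H_{jt}$. $\boldsymbol H_j$ stacks $\overline H_{jt}$ over $t$ and $\ddot{\boldsymbol H}_j$ stacks $\ddot H_{jt}$ over $t$; thus $\boldsymbol X_j,\ddot{\boldsymbol X}_j$ are $T\times K$ and $\boldsymbol R_j^{obs},\boldsymbol Y_j^{obs},\boldsymbol\mu_j,\boldsymbol\epsilon_j,\boldsymbol\eta_j$ (and double-dot versions) are in $\mathbb{R}^T$. For $\boldsymbol\beta,\boldsymbol\beta^Y\in\mathbb{R}^K$: $\widetilde R_{jt}=\overline R^{obs}_{jt}-\overline X_{jt}'\boldsymbol\beta$, $\widetilde Y_{jt}=\overline Y^{obs}_{jt}-\overline X_{jt}'\boldsymbol\beta^Y$, stacked over $t$ into $\widetilde{\boldsymbol R}_j,\widetilde{\boldsymbol Y}_j$; $\widetilde{\boldsymbol R}_j^{(-t)}$ is the matrix stacking $T$ row vectors of dimension $1\times(T-1)$, the row indexed by $t$ containing the $T-1$ different $\widetilde R_{js}$ for $s\neq t$. At the true $\boldsymbol\beta_0,\boldsymbol\beta^Y_0$ these are denoted $\overline R_{jt}=\mu_{jt}+\overline\epsilon_{jt}$, $\overline Y_{jt}=\kappa_0\mu_{jt}+\overline\eta_{jt}$, $\boldsymbol R_j,\boldsymbol Y_j,\boldsymbol R_j^{(-t)}$. $\boldsymbol\phi_0\in\mathbb{R}^{T-1}$ is the coefficient vector of the best linear predictor of the current-year residual from the residuals of the other years, $$\boldsymbol\phi_0=\arg\min_{\phi_{|s-t|}}\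 \mathbb{E}\Big[\Big(\overline R_{jt}-\sum_{|s-t|\neq 0}\phi_{|s-t|}\overline R_{js}\Big)^2\Big],\qquad \mu^*_{jt}=\sum_{|s-t|\neq 0}\phi_{0|s-t|}\overline R_{js},$$ and the vector stacking $\mu^*_{jt}$ over $t$ is written $\boldsymbol R_j^{(-t)}\boldsymbol\phi_0$. Let $\boldsymbol Z_j=(\boldsymbol X_j,\boldsymbol R_j^{obs},\boldsymbol Y_j^{obs})$ and $m_1(\boldsymbol Z_j,\boldsymbol\beta)=\ddot{\boldsymbol X}_j'(\ddot{\boldsymbol R}^{obs}_j-\ddot{\boldsymbol X}_j\boldsymbol\beta)$, $m_3(\boldsymbol Z_j,\boldsymbol\beta^Y)=\ddot{\boldsymbol X}_j'(\ddot{\boldsymbol Y}^{obs}_j-\ddot{\boldsymbol X}_j\boldsymbol\beta^Y)$, $g_1(\boldsymbol Z_j,\boldsymbol\beta,\boldsymbol\beta^Y,\kappa)=\widetilde{\boldsymbol R}_j^{(-t)\prime}(\widetilde{\boldsymbol Y}_j-\kappa\widetilde{\boldsymbol R}_j)$. For a weighting matrix $W$, the GMM estimator based on $\widetilde g_1$ is a minimizer over $\boldsymbol\Theta_1$ of $\widehat g'W\widehat g$ with $\widehat g=\frac1J\sum_{j}\widetilde g_1(\boldsymbol Z_j,\boldsymbol\beta,\boldsymbol\beta^Y,\kappa)$. $W^*=\mathbb{E}[\widetilde g_1\widetilde g_1']^{-1}$ at the true parameters, and $\widehat W^*$ is its estimate obtained by replacing the expectation by the sample average over $j$ and the parameters by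 their estimators (the GMM estimators with identity weighting matrix). $\sigma_*^2$ is the diagonal entry corresponding to $\kappa$ of $(\widetilde G_1'W^*\widetilde G_1)^{-1}$, where $\widetilde G_1=\mathbb{E}[\nabla_{(\beta,\beta^Y,\kappa)}\widetilde g_1]$ at the true parameters. $\sigma^2$ is the asymptotic variance of the exactly identified (multi-step OLS) estimator of $\kappa_0$. With $m_2(\boldsymbol Z_j,\boldsymbol\beta,\boldsymbol\phi)=\widetilde{\boldsymbol R}_j^{(-t)\prime}(\widetilde{\boldsymbol R}_j-\widetilde{\boldsymbol R}_j^{(-t)}\boldsymbol\phi)$ and $g(\boldsymbol Z_j,\boldsymbol\beta,\boldsymbol\phi,\boldsymbol\beta^Y,\kappa)=\boldsymbol\phi'\widetilde{\boldsymbol R}_j^{(-t)\prime}(\widetilde{\boldsymbol Y}_j-\kappa\widetilde{\boldsymbol R}_j^{(-t)}\boldsymbol\phi)$, everything evaluated at the true parameters, $$\sigma^2=(G_\kappa^{-1})^2\,\mathbb{E}\Big[\big(g+G_{\beta^Y}\psi_3+G_\phi\psi_2+G_\beta\psi_1-G_\phi M_{2\phi}^{-1}M_{2\beta}\psi_1\big)^2\Big],$$ where $G_\bullet=\mathbb{E}[\nabla_\bullet g]$, $M_1=M_3=-\mathbb{E}[\ddot{\boldsymbol X}_j'\ddot{\boldsymbol X}_j]$, $M_{2\phi}=-\mathbb{E}[\boldsymbol R_j^{(-t)\prime}\boldsymbol R_j^{(-t)}]$, $M_{2\beta}=\mathbb{E}[\nabla_\beta m_2]$, $\psi_1=-M_1^{-1}m_1$,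 $\psi_2=-M_{2\phi}^{-1}m_2$, $\psi_3=-M_3^{-1}m_3$. Finiteness of matrices is entrywise. *)

(* Defs.v *)
From HB Require Import structures.
From mathcomp Require Import all_boot all_order all_algebra.
From mathcomp Require Import all_classical all_reals all_analysis.

Set Implicit Arguments.
Unset Strict Implicit.
Unset Printing Implicit Defensive.

Import Order.TTheory GRing.Theory Num.Theory.
Import numFieldNormedType.Exports.

Local Open Scope classical_set_scope.
Local Open Scope ring_scope.

Section probability.
Context d (Omega : measurableType d) (R : realType) (P : probability Omega R).

Definition mx_integrable m n (A : Omega -> 'M[R]_(m, n)) : Prop :=
  forall i j, P.-integrable setT (fun w => (A w i j)%:E).

Definition mx_mean m n (A : Omega -> 'M[R]_(m, n)) : 'M[R]_(m, n) :=
  \matrix_(i, j) fine 'E_P[fun w => A w i j].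

Definition mx_coord m n (V : Omega -> 'M[R]_(m, n)) (k : 'I_(m * n))
  (w : Omega) : R := mxvec (V w) 0 k.

Definition mx_sigma m n (V : Omega -> 'M[R]_(m, n)) : set (set Omega) :=
  g_sigma_preimage (mx_coord V).

Definition mx_law m n (V : Omega -> 'M[R]_(m, n)) :
    set ((m * n).-tuple R) -> \bar R :=
  pushforward P (fun w => [tuple mx_coord V k w | k < m * n]).

Definition independent (F G : set (set Omega)) : Prop :=
  forall A B, F A -> G B -> P (A `&` B) = (P A * P B)%E.

Definition mutually_independent (F : nat -> set (set Omega)) : Prop :=
  forall (S : seq nat) (A : nat -> set Omega), uniq S ->
    (forall j, j \in S -> F j (A j)) ->
    P (\big[setI/setT]_(j <- S) A j) = (\prod_(j <- S) P (A j))%E.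

Definition iid m n (V : nat -> Omega -> 'M[R]_(m, n)) : Prop :=
  mutually_independent (fun j => mx_sigma (V j)) /\
  forall j k (B : set ((m * n).-tuple R)), measurable B ->
    mx_law (V j) B = mx_law (V k) B.

(* [W] is a version of the conditional expectation of [Z] given the
   sub-sigma-algebra [F]. *)
Definition is_condexp (F : set (set Omega)) (Z W : Omega -> R) : Prop :=
  [/\ P.-integrable setT (EFin \o Z), P.-integrable setT (EFin \o W),
      (forall B, measurable B -> F (W @^-1` B)) &
      forall A, F A ->
        (\int[P]_(w in A) (W w)%:E = \int[P]_(w in A) (Z w)%:E)%E].

Definition corr (X Y : Omega -> R) : R :=
  fine (covariance P X Y) /
  (Num.sqrt (fine 'V_P[X]) * Num.sqrt (fine 'V_P[Y])).

Definition cvg_in_distribution (X : nat -> Omega -> R)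
    (mu : set R -> \bar R) : Prop :=
  forall f : R -> R, continuous f -> (exists M, forall x, `|f x| <= M) ->
    (fun J => (\int[P]_w (f (X J w))%:E)%E) @ \oo -->
    (\int[mu]_x (f x)%:E)%E.

End probability.

(* Parametrised by the variance; [normal_prob] takes a standard deviation, and
   its value at standard deviation 0 is not a point mass. *)
Definition gaussian (R : realType) (m v : R) : set R -> \bar R :=
  if v == 0 then \d_m else normal_prob m (Num.sqrt v).

Definition fnorm (R : realType) m n (A : 'M[R]_(m, n)) : R :=
  Num.sqrt (\sum_i \sum_j A i j ^+ 2).

Definition jacobian_mx (R : realType) p q (f : 'cV[R]_p -> 'cV[R]_q)
    (a : 'cV[R]_p) : 'M[R]_(q, p) :=
  \matrix_(r, c) derive1 (fun h : R => f (a + h *: delta_mx c 0) r 0) 0.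

(* Student [i : 'I_(class_size j)] is the i-th student of teacher [j] in year
   [t]; [covar j t i k] is the k-th entry of X_it. *)
Record va_model d (Omega : measurableType d) (R : realType)
    (P : probability Omega R) (K T : nat) := VAModel {
  class_size : nat -> nat;
  class_size_gt0 : forall j, (0 < class_size j)%N;
  covar : forall j, 'I_T -> 'I_(class_size j) -> 'I_K -> {RV P >-> R};
  value_added : nat -> 'I_T -> {RV P >-> R};
  score_noise : forall j, 'I_T -> 'I_(class_size j) -> {RV P >-> R};
  earnings_noise : forall j, 'I_T -> 'I_(class_size j) -> {RV P >-> R};
  beta0 : 'cV[R]_K;
  betaY0 : 'cV[R]_K;
  kappa0 : R }.

Record obs (R : realType) (K T : nat) := Obs {
  obsX : 'M[R]_(T, K);
  obsR : 'cV[R]_T;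
  obsY : 'cV[R]_T }.

Section model.
Context d (Omega : measurableType d) (R : realType) (P : probability Omega R).
Context (K T : nat) (M : va_model P K T).

Definition test_score j (t : 'I_T) (i : 'I_(class_size M j)) (w : Omega) : R :=
  (\sum_k covar t i k w * beta0 M k 0) + value_added M j t w
  + score_noise t i w.

Definition earnings j (t : 'I_T) (i : 'I_(class_size M j)) (w : Omega) : R :=
  (\sum_k covar t i k w * betaY0 M k 0) + kappa0 M * value_added M j t w
  + earnings_noise t i w.

Definition class_avg j (H : 'I_T -> 'I_(class_size M j) -> Omega -> R)
    (w : Omega) : 'cV[R]_T :=
  \col_t ((class_size M j)%:R^-1 * \sum_i H t i w).

Definition Xbar j (w : Omega) : 'M[R]_(T, K) :=
  \matrix_(t, k)
    class_avg (fun t (i : 'I_(class_size M j)) => covar t i k) w t 0.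
Definition mubar j (w : Omega) : 'cV[R]_T := \col_t value_added M j t w.
Definition epsbar j : Omega -> 'cV[R]_T :=
  class_avg (fun t (i : 'I_(class_size M j)) => score_noise t i).
Definition etabar j : Omega -> 'cV[R]_T :=
  class_avg (fun t (i : 'I_(class_size M j)) => earnings_noise t i).
Definition Rbar_obs j : Omega -> 'cV[R]_T := class_avg (@test_score j).
Definition Ybar_obs j : Omega -> 'cV[R]_T := class_avg (@earnings j).

Definition Zobs j (w : Omega) : obs R K T :=
  Obs (Xbar j w) (Rbar_obs j w) (Ybar_obs j w).

Definition teacher_data j (w : Omega) : 'M[R]_(T, K + (1 + (1 + (1 + 1)))) :=
  row_mx (Xbar j w) (row_mx (mubar j w) (row_mx (epsbar j w)
    (row_mx (Ybar_obs j w) (etabar j w)))).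

Definition noise_pair j (t : 'I_T) (w : Omega) : 'M[R]_(1, 1 + 1) :=
  row_mx (row t (epsbar j w)) (row t (etabar j w)).

Definition stationary_value_added : Prop :=
  [/\ forall j t, (value_added M j t : Omega -> R) \in Lfun P 2%:E,
      forall j t, ('E_P[value_added M j t] = 0)%E &
      forall j (s t s' t' : 'I_T),
        `|(s : nat) - (t : nat)|%N = `|(s' : nat) - (t' : nat)|%N ->
        corr P (value_added M j s) (value_added M j t) =
        corr P (value_added M j s') (value_added M j t')].

End model.

Section leave_year_out.
Context (R : realType) (T : nat).

(* [pool t k] is the set of years whose residuals make up the k-th entry of the
   row of R_j^(-t) indexed by t. For T = 2 the two predicates below agree. For
   T > 2 they are the two ways of making "the T-1 residuals other than year t"
   and "phi is indexed by |s - t|" into a T x (T-1) matrix, which cannot both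
   hold literally because an interior year has two neighbours at lag 1. *)
Definition leave_out_listing (pool : 'I_T -> 'I_T.-1 -> {set 'I_T}) : Prop :=
  exists c : 'I_T -> 'I_T.-1 -> 'I_T, forall t,
    injective (c t) /\
    forall k, c t k != t /\ pool t k = [set c t k]%SET.

Definition leave_out_lags (pool : 'I_T -> 'I_T.-1 -> {set 'I_T}) : Prop :=
  forall t k,
    pool t k = [set s : 'I_T | `|(s : nat) - (t : nat)|%N == k.+1]%SET.

Definition leave_out (pool : 'I_T -> 'I_T.-1 -> {set 'I_T}) (v : 'cV[R]_T) :
    'M[R]_(T, T.-1) :=
  \matrix_(t, k) \sum_(s in pool t k) v s 0.

End leave_year_out.

Section moments.
Context (R : realType) (K T : nat) (pool : 'I_T -> 'I_T.-1 -> {set 'I_T}).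
Implicit Types (z : obs R K T) (b bY : 'cV[R]_K) (phi : 'cV[R]_T.-1) (k : R).

Definition ddot n (A : 'M[R]_(T, n)) : 'M[R]_(T, n) :=
  \matrix_(t, c) (A t c - T%:R^-1 * \sum_s A s c).

Definition Rtilde z b : 'cV[R]_T := obsR z - obsX z *m b.
Definition Ytilde z bY : 'cV[R]_T := obsY z - obsX z *m bY.
Definition Rlo z b : 'M[R]_(T, T.-1) := leave_out pool (Rtilde z b).

Definition m1 z b : 'cV[R]_K :=
  (ddot (obsX z))^T *m (ddot (obsR z) - ddot (obsX z) *m b).
Definition m2 z b phi : 'cV[R]_T.-1 :=
  (Rlo z b)^T *m (Rtilde z b - Rlo z b *m phi).
Definition m3 z bY : 'cV[R]_K :=
  (ddot (obsX z))^T *m (ddot (obsY z) - ddot (obsX z) *m bY).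
Definition g1 z b bY k : 'cV[R]_T.-1 :=
  (Rlo z b)^T *m (Ytilde z bY - k *: Rtilde z b).
Definition g z b phi bY k : 'cV[R]_1 :=
  phi^T *m (Rlo z b)^T *m (Ytilde z bY - k *: (Rlo z b *m phi)).

Definition param := 'cV[R]_(K + (K + 1)).
Definition stack b bY k : param := col_mx b (col_mx bY k%:M).
Definition pbeta (th : param) : 'cV[R]_K := usubmx th.
Definition pbetaY (th : param) : 'cV[R]_K := usubmx (dsubmx th).
Definition pkappa (th : param) : R := dsubmx (dsubmx th) 0 0.
Definition kappa_index : 'I_(K + (K + 1)) := rshift K (rshift K ord0).

Definition g1_at z (th : param) : 'cV[R]_T.-1 :=
  g1 z (pbeta th) (pbetaY th) (pkappa th).
Definition gtilde z (th : param) : 'cV[R]_(K + (K + T.-1)) :=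
  col_mx (m1 z (pbeta th)) (col_mx (m3 z (pbetaY th)) (g1_at z th)).

End moments.

Section inference.
Context d (Omega : measurableType d) (R : realType) (P : probability Omega R).
Context (K T : nat) (M : va_model P K T).
Context (pool : 'I_T -> 'I_T.-1 -> {set 'I_T}).

Definition theta0 : param R K := stack (beta0 M) (betaY0 M) (kappa0 M).

(* R_j^(-t) at the true parameter, and R_j^(-t) phi, whose t-th entry is
   mu*_jt when phi = phi_0 *)
Definition Rlo0 j (w : Omega) : 'M[R]_(T, T.-1) :=
  Rlo pool (Zobs M j w) (beta0 M).
Definition predicted j (phi : 'cV[R]_T.-1) (w : Omega) : 'cV[R]_T :=
  Rlo0 j w *m phi.

(* One coefficient vector serves every year, so the prediction error is summed
   over t; its first-order condition is E m2 = 0. *)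
Definition prediction_risk j (phi : 'cV[R]_T.-1) : \bar R :=
  (\sum_(t < T) 'E_P[fun w =>
     ((Rtilde (Zobs M j w) (beta0 M) t 0 - predicted j phi w t 0) ^+ 2)%R])%E.

Definition best_linear_predictor j (phi : 'cV[R]_T.-1) : Prop :=
  forall phi', (prediction_risk j phi <= prediction_risk j phi')%E.

Definition gtilde_var j : 'M[R]_(K + (K + T.-1)) :=
  mx_mean P (fun w => gtilde pool (Zobs M j w) theta0 *m
                      (gtilde pool (Zobs M j w) theta0)^T).
Definition Wstar j : 'M[R]_(K + (K + T.-1)) := invmx (gtilde_var j).
Definition Gtilde j : 'M[R]_(K + (K + T.-1), K + (K + 1)) :=
  mx_mean P (fun w => jacobian_mx (gtilde pool (Zobs M j w)) theta0).
Definition sigma2_star j : R :=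
  invmx ((Gtilde j)^T *m Wstar j *m Gtilde j) (kappa_index K) (kappa_index K).

Definition gmean (J : nat) (w : Omega) (th : param R K) :
    'cV[R]_(K + (K + T.-1)) :=
  J%:R^-1 *: \sum_(j < J) gtilde pool (Zobs M j w) th.
Definition gmm_minimizer (Theta : set (param R K)) (J : nat) (w : Omega)
    (W : 'M[R]_(K + (K + T.-1))) (th : param R K) : Prop :=
  Theta th /\ forall th', Theta th' ->
    ((gmean J w th)^T *m W *m gmean J w th) 0 0 <=
    ((gmean J w th')^T *m W *m gmean J w th') 0 0.
Definition gtilde_var_hat (J : nat) (w : Omega) (th : param R K) :
    'M[R]_(K + (K + T.-1)) :=
  J%:R^-1 *: \sum_(j < J) (gtilde pool (Zobs M j w) th *m
                           (gtilde pool (Zobs M j w) th)^T).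

(* [first] is the GMM estimator with identity weighting, [second] the one whose
   weighting matrix is the inverse sample second moment at [first]. [second] is
   left unconstrained at the sample points where that inverse does not exist. *)
Definition two_step_gmm (Theta : set (param R K))
    (first second : nat -> Omega -> param R K) : Prop :=
  [/\ forall J c, measurable_fun setT (fun w => first J w c 0),
      forall J c, measurable_fun setT (fun w => second J w c 0),
      forall J w, gmm_minimizer Theta J w 1%:M (first J w) &
      forall J w, gtilde_var_hat J w (first J w) \in unitmx ->
        gmm_minimizer Theta J w
          (invmx (gtilde_var_hat J w (first J w))) (second J w)].

Definition ddotX_gram j : 'M[R]_K :=
  mx_mean P (fun w => (ddot (Xbar M j w))^T *m ddot (Xbar M j w)).

(* Asymptotic variance of the exactly identified, multi-step OLS estimator of
   kappa: the second moment of its influence function, where psi1, psi2, psi3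
   are the influence functions of the first-step estimators of beta, phi and
   beta^Y. *)
Definition sigma2 j (phi0 : 'cV[R]_T.-1) : R :=
  let z := Zobs M j in
  let b := beta0 M in let bY := betaY0 M in let k := kappa0 M in
  let g0 w := g pool (z w) b phi0 bY k in
  let Gb := mx_mean P (fun w =>
    jacobian_mx (fun b' => g pool (z w) b' phi0 bY k) b) in
  let Gphi := mx_mean P (fun w =>
    jacobian_mx (fun phi' => g pool (z w) b phi' bY k) phi0) in
  let GbY := mx_mean P (fun w =>
    jacobian_mx (fun bY' => g pool (z w) b phi0 bY' k) bY) in
  let Gk := fine 'E_P[fun w =>
    derive1 (fun k' : R => g pool (z w) b phi0 bY k' 0 0) k] in
  let M1 := - ddotX_gram j in
  let M3 := - ddotX_gram j in
  let M2phi := - mx_mean P (fun w => (Rlo0 j w)^T *m Rlo0 j w) in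
  let M2b := mx_mean P (fun w =>
    jacobian_mx (fun b' => m2 pool (z w) b' phi0) b) in
  let psi1 w := - invmx M1 *m m1 (z w) b in
  let psi2 w := - invmx M2phi *m m2 pool (z w) b phi0 in
  let psi3 w := - invmx M3 *m m3 (z w) bY in
  Gk^-1 ^+ 2 * fine 'E_P[fun w =>
    (g0 w + GbY *m psi3 w + Gphi *m psi2 w + Gb *m psi1 w
     - Gphi *m invmx M2phi *m M2b *m psi1 w) 0 0 ^+ 2].

End inference.

(* Main.v *)
Require Import Defs.
From HB Require Import structures.
From mathcomp Require Import all_boot all_order all_algebra.
From mathcomp Require Import all_classical all_reals all_analysis.
From mathcomp Require Import measurable_realfun ring lra.

Import Order.TTheory GRing.Theory Num.Theory.
Import numFieldNormedType.Exports.

Set Implicit Arguments.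
Unset Strict Implicit.
Unset Printing Implicit Defensive.

Local Open Scope classical_set_scope.
Local Open Scope ring_scope.

(** The moment function [gtilde z (theta0 + h)] is cubic in [h], hence equal to
    [S z *m lam h], where the columns of [S z] are its values at finitely many
    interpolation nodes, square integrable by hypothesis (3d), and [lam] is a
    fixed vector of cubic polynomials. The uniform laws of large numbers for the
    criterion and for its weighting matrix thus reduce to the weak law for the
    entries of [S] and their products. Compactness and identification give
    consistency; comparing the second-step minimiser with the minimiser of the
    limiting quadratic form shows that it is
    [theta0 - (G'W*G)^-1 G'W* gbar(theta0)] up to a negligible relative error.
    The central limit theorem follows from Stein's equation and a Taylor
    expansion.

    Mean zero of [g1] at the truth is delicate because only the sum over [t] of
    the terms [a t], the product of the leave-out sum of [mu] with [eta_t], is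
    known to be integrable. Independence of the noise across years makes
    [sqrt |a s * a t|] integrable for [s <> t], and this bounds each [a t].

    For the variances, the influence function of the multi-step estimator is
    [c' gtilde / Gkappa] with [c' G = Gkappa e_kappa']: the terms in [psi2]
    cancel because of the normal equation [E m2 = 0]. The inequality is then the
    Gauss-Markov theorem. *)

(** * Real-valued expectations *)

(** Interpolation is available because [h3d] holds at every parameter value, not only on [Theta]:
    the nodes may be arbitrary, and derivatives, being fixed combinations of node values, are
    integrable without any envelope. The minimisation argument can then be purely deterministic: all
    randomness is confined to the event that finitely many averages are close to their means, and
    the required closeness depends on population quantities alone.

    Square integrability of the residuals comes from [h3e], whose supremum need not be measurable:
    each year forms by itself the pool of some entry of the leave-out matrix.

    Both readings of the leave-out matrix produce pools of at most two years. This bound matters: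
    clipping two summands at the same level never increases the absolute value of their sum, while
    three summands can defeat it.

    Positivity of the variance of the prediction serves twice: it rules out [T = 1], and through the
    normal equation it makes the cross moment of leave-out and current residuals non-zero, so that
    [kappa] is identified and the limit variance is positive. *)

Section expectation_calculus.
Context d (Omega : measurableType d) (R : realType) (P : probability Omega R).
Implicit Types (X Y : Omega -> R) (A B : set Omega) (c : R).

Definition Ex X : R := fine 'E_P[X].
Definition intg X : Prop := P.-integrable setT (fun w => (X w)%:E).

Lemma Ex_expectation X : Ex X = fine 'E_P[X].
Proof. by []. Qed.

Lemma ExE X : Ex X = \int[P]_w X w.
Proof. by rewrite /Ex unlock. Qed.

Lemma integral_Ex X : intg X -> (\int[P]_w (X w)%:E)%E = (Ex X)%:E.
Proof. by move=> iX; rewrite /Ex unlock fineK//; exact: integrable_fin_num. Qed.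

Lemma intg_measurable X : intg X -> measurable_fun setT X.
Proof. by move=> /measurable_int /measurable_EFinP. Qed.

Lemma intg_le X Y : measurable_fun setT X -> intg Y ->
  (forall w, `|X w| <= `|Y w|) -> intg X.
Proof.
move=> mX iY XY; apply: le_integrable iY => //; first exact/measurable_EFinP.
by move=> w _; rewrite /= lee_fin.
Qed.

Lemma intgD X Y : intg X -> intg Y -> intg (fun w => X w + Y w).
Proof. by move=> iX iY; exact: (integrableD _ iX iY). Qed.

Lemma intgB X Y : intg X -> intg Y -> intg (fun w => X w - Y w).
Proof. by move=> iX iY; exact: (integrableB _ iX iY). Qed.

Lemma intgZ c X : intg X -> intg (fun w => c * X w).
Proof. by move=> iX; exact: (integrableZl _ c iX). Qed.

Lemma intg_cst c : intg (cst c).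
Proof.
by apply/(@finite_measure_integrable_cst _ _ _ P).
Qed.

Lemma intg_bounded X c : measurable_fun setT X -> (forall w, `|X w| <= c) ->
  intg X.
Proof.
move=> mX Xc; apply: (@intg_le _ (cst c)) => //; first exact: intg_cst.
by move=> w /=; exact: le_trans (Xc w) (ler_norm _).
Qed.

Lemma intg_sum I (r : seq I) (Q : pred I) (X : I -> Omega -> R) :
  (forall i, Q i -> intg (X i)) -> intg (fun w => \sum_(i <- r | Q i) X i w).
Proof.
move=> iX.
have : P.-integrable setT (fun w => (\sum_(i <- r | Q i) (X i w)%:E)%E).
  exact: integrable_sum.
by apply: eq_integrable => // w _; rewrite sumEFin.
Qed.

Lemma intg_norm X : intg X -> intg (fun w => `|X w|).
Proof.
move=> iX; apply: (@intg_le _ X) => // [|w]; last by rewrite normr_id.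
exact: measurableT_comp (@normr_measurable _ _) (intg_measurable iX).
Qed.

Lemma intg_indic A : measurable A -> intg \1_A.
Proof.
move=> mA; apply: (@intg_bounded _ 1); first exact: measurable_indic.
by move=> w; rewrite indicE; case: (_ \in _); rewrite ?normr1 ?normr0.
Qed.

Lemma intg_mul_bounded X Y c : intg X -> measurable_fun setT Y ->
  (forall w, `|Y w| <= c) -> intg (fun w => X w * Y w).
Proof.
move=> iX mY Yc; apply: (@intg_le _ (fun w => c * X w)).
- by apply: measurable_funM => //; exact: intg_measurable.
- exact: intgZ.
- move=> w; rewrite !normrM mulrC ler_wpM2r//.
  exact: le_trans (Yc w) (ler_norm _).
Qed.

Lemma eq_intg X Y : X =1 Y -> intg X -> intg Y.
Proof. by move=> /funext ->. Qed.

Lemma eq_Ex X Y : X =1 Y -> Ex X = Ex Y.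
Proof. by move=> /funext ->. Qed.

Lemma ExD X Y : intg X -> intg Y -> Ex (fun w => X w + Y w) = Ex X + Ex Y.
Proof. by move=> iX iY; rewrite !ExE RintegralD. Qed.

Lemma ExB X Y : intg X -> intg Y -> Ex (fun w => X w - Y w) = Ex X - Ex Y.
Proof. by move=> iX iY; rewrite !ExE RintegralB. Qed.

Lemma ExZ c X : intg X -> Ex (fun w => c * X w) = c * Ex X.
Proof. by move=> iX; rewrite !ExE RintegralZl. Qed.

Lemma ExN X : intg X -> Ex (fun w => - X w) = - Ex X.
Proof.
by move=> iX; rewrite -mulN1r -ExZ//; apply: eq_Ex => w; rewrite mulN1r.
Qed.

Lemma Ex_cst c : Ex (cst c) = c.
Proof. by rewrite /Ex expectation_cst. Qed.

Lemma Ex_sum I (r : seq I) (Q : pred I) (X : I -> Omega -> R) :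
  (forall i, Q i -> intg (X i)) ->
  Ex (fun w => \sum_(i <- r | Q i) X i w) = \sum_(i <- r | Q i) Ex (X i).
Proof.
move=> iX; elim: r => [|i r IH].
  by rewrite big_nil -[RHS](Ex_cst 0); apply: eq_Ex => w; rewrite big_nil.
rewrite big_cons; under eq_fun do rewrite big_cons.
case: ifP => Qi //; rewrite ExD ?IH//; [exact: iX|exact: intg_sum].
Qed.

Lemma ler_Ex X Y : intg X -> intg Y -> (forall w, X w <= Y w) -> Ex X <= Ex Y.
Proof. by move=> iX iY XY; rewrite !ExE le_Rintegral. Qed.

Lemma Ex_ge0 X : (forall w, 0 <= X w) -> 0 <= Ex X.
Proof. by move=> X0; rewrite ExE Rintegral_ge0. Qed.

Lemma ler_norm_Ex X : intg X -> `|Ex X| <= Ex (fun w => `|X w|).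
Proof. by move=> iX; rewrite !ExE le_normr_Rintegral. Qed.

Lemma Ex_indic A : measurable A -> Ex \1_A = fine (P A).
Proof. by move=> mA; rewrite /Ex expectation_indic. Qed.

Lemma ge0_intgP X : measurable_fun setT X -> (forall w, 0 <= X w) ->
  (\int[P]_w (X w)%:E < +oo)%E -> intg X.
Proof.
move=> mX X0 Xoo; apply/integrableP; split; first exact/measurable_EFinP.
by under eq_integral do rewrite /= ger0_norm//.
Qed.

(** [Y] will be a supremum over the parameter set, whose measurability is not known. The integral of
    a non-negative function is a supremum over the simple functions below it, so monotonicity needs
    no measurability of [Y]. *)
Lemma intg_dominated_outer X (Y : Omega -> \bar R) : measurable_fun setT X ->
  (forall w, 0 <= X w) -> (forall w, ((X w)%:E <= Y w)%E) ->
  (\int[P]_w Y w < +oo)%E -> intg X.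
Proof.
move=> mX X0 XY Yoo; apply: ge0_intgP => //; apply: le_lt_trans Yoo.
have Y0 w : (0 <= Y w)%E by apply: le_trans (XY w); rewrite lee_fin.
rewrite !ge0_integralTE//.
apply: ge_ereal_sup => _ /= [f fX <-]; apply: ereal_sup_ubound.
by exists f => // w; exact: le_trans (fX w) (XY w).
Qed.

Lemma cvg_Ex_dominated (X : nat -> Omega -> R) (X0 Y : Omega -> R) :
  (forall n, measurable_fun setT (X n)) -> intg Y ->
  (forall w, X n w @[n --> \oo] --> X0 w) ->
  (forall n w, `|X n w| <= Y w) ->
  intg X0 /\ Ex (X n) @[n --> \oo] --> Ex X0.
Proof.
move=> mX iY XX0 XY.
have mX0 : measurable_fun setT X0.
  by apply: (@measurable_fun_cvg _ _ _ setT X) => // w _; exact: XX0.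
have iX0 : intg X0.
  apply: (@intg_le _ Y) => // w; apply: (@le_trans _ _ (Y w)) (ler_norm _).
  have XX0w : `|X n w| @[n --> \oo] --> `|X0 w| by apply: cvg_norm; exact: XX0.
  rewrite -(cvg_lim (@Rhausdorff R) XX0w).
  by apply: limr_le; [exact: cvgP XX0w|exact: nearW].
have [|||||_ _] := @dominated_convergence _ _ _ P setT measurableT
    (fun n w => (X n w)%:E) (fun w => (X0 w)%:E) (fun w => (Y w)%:E).
- by move=> n; exact/measurable_EFinP.
- exact/measurable_EFinP.
- by apply: aeW => w _; apply/cvg_EFin; [exact: nearW|exact: XX0].
- exact: iY.
- by apply: aeW => w n _; rewrite lee_fin.
move=> h; split=> //; move: h; rewrite integral_Ex// => /fine_cvg.
by rewrite /Ex unlock.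
Qed.

End expectation_calculus.

(** * Independence and identically distributed sequences *)

Section independence.
Import HBNNSimple.
Context d (Omega : measurableType d) (R : realType) (P : probability Omega R).
Local Notation Ex := (Ex P).
Local Notation intg := (intg P).

(** Extension from indicators to bounded functions. The shift by [c] makes [h] non-negative, hence a
    limit of simple functions bounded by [2 * c]; the case [B = setT] gives [Ex Z = 0], which
    removes the shift at the end. *)
Lemma Ex_mul_indic_preimage (V Z : Omega -> R) :
  measurable_fun setT V -> intg Z ->
  (forall B : set R, measurable B -> Ex (fun w => Z w * \1_(V @^-1` B) w) = 0) ->
  forall (h : R -> R) (c : R), measurable_fun setT h ->
    (forall x, `|h x| <= c) -> Ex (fun w => Z w * h (V w)) = 0.
Proof.
move=> mV iZ ZB h c mh hc.
have mf : measurable_fun [set: R] (fun x => (h x + c)%:E).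
  by apply/measurable_EFinP; apply: measurable_funD.
pose s n : {nnsfun R >-> R} := nnsfun_approx measurableT mf n.
have f0 x : [set: R] x -> (0 <= (h x + c)%:E)%E.
  by move=> _; rewrite lee_fin; have := hc x; rewrite ler_norml => /andP[]; lra.
have sle n x : s n x <= h x + c.
  by rewrite -lee_fin /s nnsfun_approxE; exact: le_approx.
have scvg x : s n x @[n --> \oo] --> h x + c.
  exact: (fine_cvg (cvg_nnsfun_approx measurableT mf f0 (I : [set: R] x))).
have mVB B : measurable B -> measurable (V @^-1` B).
  by move=> mB; rewrite -[X in measurable X]setTI; exact: mV.
have Es n : Ex (fun w => Z w * s n (V w)) = 0.
  rewrite (_ : (fun w => _) = fun w => \sum_(y <- finmap.enum_fset (fset_set (range (s n))))
     y * (Z w * \1_(V @^-1` (s n @^-1` [set y])) w)).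
    rewrite Ex_sum => [|y _]; last first.
      apply: intgZ; apply: (@intg_mul_bounded _ _ _ _ _ _ 1) => //.
        by apply: measurable_indic; apply: mVB; exact: measurable_funPTI.
      by move=> w; rewrite indicE; case: (_ \in _); rewrite ?normr1 ?normr0.
    rewrite big1// => y _; rewrite ExZ.
      by rewrite ZB ?mulr0//; exact: measurable_funPTI.
    apply: (@intg_mul_bounded _ _ _ _ _ _ 1) => //.
      by apply: measurable_indic; apply: mVB; exact: measurable_funPTI.
    by move=> w; rewrite indicE; case: (_ \in _); rewrite ?normr1 ?normr0.
  apply/funext => w; rewrite fimfunE fsbig_finite//= mulr_sumr.
  by apply: eq_bigr => y _; rewrite mulrCA.
have ihV : intg (fun w => Z w * h (V w)).
  apply: (@intg_mul_bounded _ _ _ _ _ _ c) => //.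
  exact: measurableT_comp.
have EZ : Ex Z = 0.
  rewrite -(ZB setT measurableT); apply: eq_Ex => w.
  by rewrite preimage_setT indicT mulr1.
have [||||i_ lim_] := @cvg_Ex_dominated _ _ _ P (fun n w => Z w * s n (V w))
  (fun w => Z w * (h (V w) + c)) (fun w => (2 * c) * `|Z w|).
- move=> n; apply: measurable_funM; first exact: intg_measurable iZ.
  exact: measurableT_comp.
- exact/intgZ/intg_norm.
- by move=> w; apply: cvgMr; exact: scvg.
- move=> n w; rewrite normrM mulrC ler_wpM2r// ger0_norm//.
  by apply: le_trans (sle _ _) _; have := hc (V w); rewrite ler_norml => /andP[_]; lra.
have : Ex (fun w => Z w * (h (V w) + c)) = 0.
  rewrite -(cvg_lim (@Rhausdorff R) lim_) (_ : (fun n => _) = cst 0) ?lim_cst//.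
  by apply/funext.
rewrite (_ : (fun w => _) = fun w => Z w * h (V w) + c * Z w); last first.
  by apply/funext => w; ring.
by rewrite ExD// ?ExZ ?EZ ?mulr0 ?addr0//; exact: intgZ.
Qed.

Definition indep_rv (X Y : Omega -> R) : Prop :=
  forall A B : set R, measurable A -> measurable B ->
  P (X @^-1` A `&` Y @^-1` B) = (P (X @^-1` A) * P (Y @^-1` B))%E.

(** Two applications of the preceding lemma to centred variables: to [g(Y) - E g(Y)] with test
    functions of [X], then, for a fixed set [B], to the centred indicator of [X] in [B] with test
    functions of [Y]. Only the independence of two preimages remains. *)
Lemma Ex_mul_indep_bounded (X Y : Omega -> R) (f g : R -> R) (a b : R) :
  measurable_fun setT X -> measurable_fun setT Y -> indep_rv X Y ->
  measurable_fun setT f -> (forall x, `|f x| <= a) ->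
  measurable_fun setT g -> (forall x, `|g x| <= b) ->
  Ex (fun w => f (X w) * g (Y w)) = Ex (fun w => f (X w)) * Ex (fun w => g (Y w)).
Proof.
move=> mX mY XY mf fa mg gb.
have mpre (V : Omega -> R) B : measurable_fun setT V -> measurable B ->
    measurable (V @^-1` B).
  by move=> mV mB; rewrite -[X in measurable X]setTI; exact: mV.
have ifX : intg (fun w => f (X w)).
  by apply: (@intg_bounded _ _ _ _ _ a) => //; exact: measurableT_comp.
have igY : intg (fun w => g (Y w)).
  by apply: (@intg_bounded _ _ _ _ _ b) => //; exact: measurableT_comp.
have m1 (A : set Omega) : measurable A -> forall w, `|\1_A w : R| <= 1.
  by move=> mA w; rewrite indicE; case: (_ \in _); rewrite ?normr1 ?normr0.
have ifg : intg (fun w => f (X w) * g (Y w)).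
  by apply: (@intg_mul_bounded _ _ _ _ _ _ b) => //; exact: measurableT_comp.
suff : Ex (fun w => (g (Y w) - Ex (fun w => g (Y w))) * f (X w)) = 0.
  rewrite (_ : (fun w => _) = fun w => f (X w) * g (Y w) - Ex (fun w => g (Y w)) * f (X w)).
    by rewrite ExB// ?ExZ//; [move/eqP; rewrite subr_eq0 mulrC => /eqP|exact: intgZ].
  by apply/funext => w; ring.
apply: (Ex_mul_indic_preimage mX _ _ mf fa).
  by apply: intgB => //; exact: intg_cst.
move=> B mB; have mXB := mpre _ _ mX mB.
suff : Ex (fun w => (\1_(X @^-1` B) w - fine (P (X @^-1` B))) * g (Y w)) = 0.
  rewrite (_ : (fun w => _) = fun w => g (Y w) * \1_(X @^-1` B) w - fine (P (X @^-1` B)) * g (Y w)); last first.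
    by apply/funext => w; ring.
  have igB : intg (fun w => g (Y w) * \1_(X @^-1` B) w).
    by apply: (@intg_mul_bounded _ _ _ _ _ _ 1) => //; exact: m1.
  rewrite ExB//; last exact: intgZ.
  rewrite ExZ// => /eqP; rewrite subr_eq0 => /eqP E.
  rewrite (_ : (fun w => _) = fun w => g (Y w) * \1_(X @^-1` B) w - Ex (fun w => g (Y w)) * \1_(X @^-1` B) w); last first.
    by apply/funext => w; ring.
  rewrite ExB//; last by apply: intgZ; exact: intg_indic.
  by rewrite ExZ ?E ?Ex_indic//; [ring|exact: intg_indic].
apply: (Ex_mul_indic_preimage mY _ _ mg gb).
  by apply: intgB; [exact: intg_indic|exact: intg_cst].
move=> C mC; have mYC := mpre _ _ mY mC.
rewrite (_ : (fun w => _) = fun w => \1_(X @^-1` B `&` Y @^-1` C) w - fine (P (X @^-1` B)) * \1_(Y @^-1` C) w); last first.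
  by apply/funext => w; rewrite indicI /=; ring.
rewrite ExB ?ExZ ?Ex_indic//; first last.
- exact/intgZ/intg_indic.
- by apply: intg_indic; exact: measurableI.
- exact: intg_indic.
- exact: measurableI.
by rewrite XY// fineM ?subrr//; exact: fin_num_measure.
Qed.

(** Projection onto [[-n, n]]. Unlike the truncation that sets large values to 0, it is odd and
    1-Lipschitz, which is what [clip_lipschitz_odd] needs. *)
Definition clip (n : nat) (x : R) : R := Num.max (- n%:R) (Num.min x n%:R).

Lemma norm_clip n x : `|clip n x| = Num.min `|x| n%:R.
Proof.
have n0 : 0 <= n%:R :> R by [].
rewrite /clip; have [xn|xn] := leP x n%:R; have [nx|nx] := leP (- n%:R) _;
  rewrite ?normrN ?(ger0_norm n0); try lra.
- by rewrite min_l// ler_norml; apply/andP.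
- by rewrite min_r// ler_normr; apply/orP; right; lra.
- by rewrite min_r// ler_normr; apply/orP; left; lra.
Qed.

Lemma clip_bounded n x : `|clip n x| <= n%:R.
Proof.
have n0 : 0 <= n%:R :> R by [].
rewrite /clip ler_norml le_max lexx /= ge_max ge_min lexx orbT andbT.
by lra.
Qed.

Lemma clip_le n x : `|clip n x| <= `|x|.
Proof.
by rewrite norm_clip ge_min lexx.
Qed.

(** The left side is the distance from [clip n x] to [clip n (- y)], the right side that from [x] to
    [- y]. With three summands the inequality fails: at level 1, the values 1, 1, -2 have sum 0 and
    clipped sum 1. *)
Lemma clip_lipschitz_odd n x y : `|clip n x + clip n y| <= `|x + y|.
Proof.
have n0 : 0 <= n%:R :> R by [].
rewrite /clip; have [xn|xn] := leP x n%:R; have [nx|nx] := leP (- n%:R) _;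
have [yn|yn] := leP y n%:R; have [ny|ny] := leP (- n%:R) _ => //;
rewrite ler_norml; have [s|s] := ger0P (x + y); lra.
Qed.

Lemma clip_cvg x : clip n x @[n --> \oo] --> x.
Proof.
apply: cvg_near_cst; near=> n.
have xn : `|x| <= n%:R by near: n; exact: nbhs_infty_ger.
move: xn; rewrite ler_norml => /andP[nx xn].
by rewrite /clip; apply/eqP; rewrite eq_sym; apply/eqP; rewrite min_l// max_r.
Unshelve. all: by end_near. Qed.

Lemma measurable_clip n : measurable_fun setT (clip n).
Proof.
apply: measurable_maxr; first exact: measurable_cst.
by apply: measurable_minr; [exact: measurable_id|exact: measurable_cst].
Qed.

(** Integrability of the product is part of the conclusion: the clipped absolute values increase to
    [|X|] and [|Y|] and their product has mean at most [E|X| E|Y|], so monotone convergence applies.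
    Dominated convergence then carries the product formula from the clipped variables to the
    limit. *)
Lemma Ex_mul_indep (X Y : Omega -> R) : intg X -> intg Y -> indep_rv X Y ->
  intg (fun w => X w * Y w) /\ Ex (fun w => X w * Y w) = Ex X * Ex Y.
Proof.
move=> iX iY XY; have mX := intg_measurable iX; have mY := intg_measurable iY.
have mnc n : measurable_fun setT (fun x => `|clip n x|).
  by apply: measurableT_comp; [exact: normr_measurable|exact: measurable_clip].
have nn n x : `| `|clip n x| | <= n%:R by rewrite normr_id clip_bounded.
have clipE n : Ex (fun w => `|clip n (X w)| * `|clip n (Y w)|) <=
    Ex (fun w => `|X w|) * Ex (fun w => `|Y w|).
  rewrite (Ex_mul_indep_bounded mX mY XY (mnc n) (nn n) (mnc n) (nn n)).
  have icn Z : intg Z -> intg (fun w => `|clip n (Z w)|).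
    move=> iZ; apply: (@intg_bounded _ _ _ _ _ n%:R) => //.
    exact: measurableT_comp (mnc n) (intg_measurable iZ).
  apply: ler_pM; do ?exact: Ex_ge0.
    by apply: ler_Ex; [exact: icn|exact: intg_norm|move=> w; exact: clip_le].
  by apply: ler_Ex; [exact: icn|exact: intg_norm|move=> w; exact: clip_le].
have mXY : measurable_fun setT (fun w => X w * Y w) by exact: measurable_funM.
have iXY : intg (fun w => X w * Y w).
  have : intg (fun w => `|X w| * `|Y w|).
    apply: ge0_intgP => //; first by apply: measurable_funM; exact: measurableT_comp.
    pose c := Ex (fun w => `|X w|) * Ex (fun w => `|Y w|).
    suff : (\int[P]_w (`|X w| * `|Y w|)%:E <= c%:E)%E by move/le_lt_trans; apply; exact: ltry.
    pose F n w := (`|clip n (X w)| * `|clip n (Y w)|)%:E.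
    have cvgF w : (F n w @[n --> \oo] --> (`|X w| * `|Y w|)%:E)%E.
      apply: cvg_EFin; first exact: nearW.
      by apply: cvgM; apply: cvg_norm; exact: clip_cvg.
    rewrite (_ : (\int[P]_w _)%E = (\int[P]_w (limn (F^~ w)))%E); last first.
      by apply: eq_integral => w _; rewrite (cvg_lim _ (cvgF w)).
    have clip_mono n m x : (n <= m)%N -> `|clip n x| <= `|clip m x|.
      by move=> nm; rewrite !norm_clip le_min !ge_min lexx/= ler_nat nm orbT.
    have : (\int[P]_w F n w @[n --> \oo] --> \int[P]_w (limn (F^~ w)))%E.
      apply: cvg_monotone_convergence => //.
      - move=> n; apply/measurable_EFinP; apply: measurable_funM.
          exact: measurableT_comp (mnc n) mX.
        exact: measurableT_comp (mnc n) mY.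
      - by move=> n w _; rewrite lee_fin mulr_ge0.
      - move=> w _ n m nm; rewrite lee_fin.
        by apply: ler_pM => //; exact: clip_mono.
    move=> h; rewrite -(cvg_lim _ h)//; apply: lime_le; first by apply: cvgP h.
    apply: nearW => n; rewrite integral_Ex ?lee_fin//.
    apply: (@intg_bounded _ _ _ _ _ (n%:R * n%:R)).
      apply: measurable_funM.
        exact: measurableT_comp (mnc n) mX.
      exact: measurableT_comp (mnc n) mY.
    by move=> w; rewrite normrM ler_pM.
  by move=> i; apply: intg_le i _ => // w; rewrite !normrM !normr_id.
split=> //.
have [_ l1] := @cvg_Ex_dominated _ _ _ P (fun n w => clip n (X w) * clip n (Y w))
  (fun w => X w * Y w) (fun w => `|X w * Y w|)
  (fun n => measurable_funM (measurableT_comp (measurable_clip n) mX) (measurableT_comp (measurable_clip n) mY))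
  (intg_norm iXY) (fun w => cvgM (@clip_cvg (X w)) (@clip_cvg (Y w)))
  (fun n w => ltac:(rewrite !normrM; apply: ler_pM => //; exact: clip_le)).
have l2 Z : intg Z -> Ex (fun w => clip n (Z w)) @[n --> \oo] --> Ex Z.
  move=> iZ; have mZ := intg_measurable iZ.
  by have [] := @cvg_Ex_dominated _ _ _ P (fun n w => clip n (Z w))
    Z (fun w => `|Z w|) (fun n => measurableT_comp (measurable_clip n) mZ) (intg_norm iZ)
    (fun w => @clip_cvg (Z w)) (fun n w => clip_le n (Z w)).
have l3 : Ex (fun w => clip n (X w)) * Ex (fun w => clip n (Y w)) @[n --> \oo] -->
  Ex X * Ex Y by apply: cvgM; exact: l2.
rewrite (_ : (fun n => Ex _) =
    fun n => Ex (fun w => clip n (X w)) * Ex (fun w => clip n (Y w))) in l1.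
  exact: (cvg_unique (@Rhausdorff R) l1 l3).
apply/funext => n; exact: (Ex_mul_indep_bounded mX mY XY (measurable_clip n)
  (@clip_bounded n) (measurable_clip n) (@clip_bounded n)).
Qed.

End independence.

Section identically_distributed.
Context d (Omega : measurableType d) (R : realType) (P : probability Omega R).
Context d' (T' : measurableType d').

Lemma intg_same_law (V W : Omega -> T') (f : T' -> R) :
  measurable_fun setT V -> measurable_fun setT W ->
  (forall B, measurable B -> P (V @^-1` B) = P (W @^-1` B)) ->
  measurable_fun setT f -> intg P (f \o V) ->
  intg P (f \o W) /\ Ex P (f \o W) = Ex P (f \o V).
Proof.
move=> mV mW VW mf iV.
have E (g : T' -> \bar R) : measurable_fun setT g -> (forall y, 0 <= g y)%E ->
    (\int[P]_w g (V w) = \int[P]_w g (W w))%E.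
  move=> mg g0.
  have <- := @ge0_integral_pushforward _ _ _ _ R V mV P setT g measurableT mg (fun y _ => g0 y).
  have <- := @ge0_integral_pushforward _ _ _ _ R W mW P setT g measurableT mg (fun y _ => g0 y).
  by apply: eq_measure_integral => A mA _; exact: VW.
have mfE : measurable_fun setT (EFin \o f) by exact/measurable_EFinP.
have iW : intg P (f \o W).
  apply/integrableP; split; first by apply/measurable_EFinP; exact: measurableT_comp.
  have /integrableP[_] := iV.
  rewrite -(E (fun y => `|(f y)%:E|)%E)//; exact: measurableT_comp.
split=> //; rewrite /Ex unlock.
have -> : (\int[P]_w ((f \o W) w)%:E = \int[pushforward P W]_y (f y)%:E)%E.
  by rewrite (integral_pushforward mW).
have -> : (\int[P]_w ((f \o V) w)%:E = \int[pushforward P V]_y (f y)%:E)%E.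
  by rewrite (integral_pushforward mV).
by congr fine; apply: eq_measure_integral => A mA _; exact/esym/VW.
Qed.

End identically_distributed.

Section iid_sequences.
Context d (Omega : measurableType d) (R : realType) (P : probability Omega R).
Local Notation Ex := (Ex P).
Local Notation intg := (intg P).

Definition iid_rv (Z : nat -> Omega -> R) : Prop :=
  [/\ forall j, measurable_fun setT (Z j),
      mutually_independent P (fun j => preimage_set_system setT (Z j) measurable) &
      forall j B, measurable B -> P (Z j @^-1` B) = P (Z 0 @^-1` B)].

Lemma iid_rv_Ex (Z : nat -> Omega -> R) (f : R -> R) j : iid_rv Z ->
  measurable_fun setT f -> intg (fun w => f (Z 0 w)) ->
  intg (fun w => f (Z j w)) /\ Ex (fun w => f (Z j w)) = Ex (fun w => f (Z 0 w)).
Proof.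
move=> [mZ _ lawZ] mf i0.
by apply: (@intg_same_law _ _ _ P _ _ (Z 0) (Z j) f) => // B mB; exact/esym/lawZ.
Qed.

Lemma iid_rv_comp (Z : nat -> Omega -> R) (f : R -> R) : iid_rv Z ->
  measurable_fun setT f -> iid_rv (fun j w => f (Z j w)).
Proof.
move=> [mZ indZ lawZ] mf; split.
- by move=> j; exact: measurableT_comp.
- move=> S A uS SA; apply: indZ => // j jS.
  have [B mB <-] := SA j jS; exists (f @^-1` B) => //.
  by rewrite -[X in measurable X]setTI; exact: mf.
- move=> j B mB; have := lawZ j (f @^-1` B); apply.
  by rewrite -[X in measurable X]setTI; exact: mf.
Qed.

(** The sigma-algebra generated by the entries is the preimage of the product sigma-algebra under
    the tuple of entries, so a measurable function [F] of the tuple inherits both independence and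
    equality of laws. *)
Lemma iid_rv_of_iid m n (V : nat -> Omega -> 'M[R]_(m, n))
    (F : (m * n).-tuple R -> R) :
  iid P V -> (forall j k, measurable_fun setT (mx_coord (V j) k)) ->
  measurable_fun setT F ->
  iid_rv (fun j w => F [tuple mx_coord (V j) k w | k < m * n]).
Proof.
move=> [indV lawV] mV mF.
have mt j : measurable_fun setT (fun w => [tuple mx_coord (V j) k w | k < m * n]).
  apply/measurable_fun_tnthP => k.
  rewrite (_ : _ \o _ = mx_coord (V j) k); first exact: mV.
  by apply/funext => w /=; rewrite tnth_mktuple.
split.
- by move=> j; exact: measurableT_comp.
- move=> S A uS SA; apply: indV => // j jS.
  have [B mB <-] := SA j jS.
  have -> : mx_sigma (V j) = preimage_set_system setT
      (fun w => [tuple mx_coord (V j) k w | k < m * n]) measurable.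
    rewrite /mx_sigma -g_sigma_preimage_comp; congr g_sigma_preimage.
    by apply/funext => k; apply/funext => w /=; rewrite tnth_mktuple.
  exists (F @^-1` B); last by rewrite setTI.
  by rewrite -[X in _ X]setTI; exact: mF.
- move=> j B mB; have := lawV j 0 (F @^-1` B); rewrite /mx_law /pushforward; apply.
  by rewrite -[X in measurable X]setTI; exact: mF.
Qed.

(** The last hypothesis says that [Y] is measurable with respect to the [Z i] with [i] in [s],
    without naming a sigma-algebra: it covers every space mapped into [Omega], in particular [Omega]
    with a coarser structure. The proof is the pi-lambda theorem. *)
Lemma iid_rv_indep_others (Z : nat -> Omega -> R) (j : nat) (s : seq nat)
    (Y : Omega -> R) :
  iid_rv Z -> uniq s -> j \notin s ->
  (forall (d' : measure_display) (Om : measurableType d') (e : Om -> Omega),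
    (forall i, i \in s -> measurable_fun setT (Z i \o e)) -> measurable_fun setT (Y \o e)) ->
  indep_rv P (Z j) Y.
Proof.
move=> [mZ indZ _] us js mY A0 B0 mA0 mB0.
pose F i := preimage_set_system setT (Z i) measurable.
have mF i A : F i A -> measurable A by move=> [B mB <-]; exact: mZ.
(* The pi-system of cylinders over the indices in [s]. *)
pose G : set (set Omega) := fun B => exists2 A : nat -> set Omega,
  (forall i, i \in s -> F i (A i)) & B = \big[setI/setT]_(i <- s) A i.
have FI i A B : F i A -> F i B -> F i (A `&` B).
  move=> [a ma <-] [b mb <-]; exists (a `&` b); first exact: measurableI.
  by rewrite !setTI.
have GI : setI_closed G.
  move=> _ _ [A FA ->] [B FB ->]; exists (fun i => A i `&` B i).
    by move=> i si; apply: FI; [exact: FA|exact: FB].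
  by rewrite big_split.
have mG B : G B -> measurable B.
  move=> [A FA ->]; rewrite big_seq; apply: bigsetI_measurable => i si.
  by apply: mF; exact: FA.
pose A := Z j @^-1` A0.
have mA : measurable A by rewrite /A -[X in measurable X]setTI; exact: mZ.
have FA : F j A by exists A0 => //; rewrite setTI.
pose D : set (set Omega) := fun B => measurable B /\ P (A `&` B) = (P A * P B)%E.
have GD : G `<=` D.
  move=> B GB; split; first exact: mG.
  have [C FC ->] := GB; pose C' i := if i == j then A else C i.
  have := indZ (j :: s) C'; rewrite /= js us => /(_ isT).
  have Cj : C' j = A by rewrite /C' eqxx.
  rewrite !big_cons Cj.
  have CE T' (idx : T') (op : T' -> T' -> T') (f : set Omega -> T') :
      \big[op/idx]_(i <- s) f (C' i) = \big[op/idx]_(i <- s) f (C i).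
    apply: eq_big_seq => i si; rewrite /C'; case: eqP => // ij.
    by move: js; rewrite -ij si.
  rewrite (CE _ _ _ id) (CE _ _ _ P) => ->; last first.
    move=> i; rewrite inE /C' => /predU1P[->|si]; first by rewrite eqxx.
    by case: eqP => [->//|_]; exact: FC.
  by congr (_ * _)%E; rewrite (indZ s C us FC).
have dD : dynkin D.
  split.
  - by split; [exact: measurableT|rewrite setIT probability_setT mule1].
  - move=> B [mB AB]; split; first exact: measurableC.
    rewrite -setDE measureD//; last by rewrite ltey_eq fin_num_measure.
    rewrite [X in (_ - X)%E]AB probability_setC// muleBr ?mule1//.
    + exact: fin_num_measure.
  - move=> B tB DB; split; first by apply: bigcup_measurable => k _; have [] := DB k.
    rewrite setI_bigcupr !measure_bigcup//.
    + have PAE : P A = (fine (P A))%:E by rewrite fineK// fin_num_measure.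
      rewrite PAE -nneseriesZl//; apply: eq_eseriesr => k _.
      by rewrite -PAE; have [] := DB k.
    + by move=> k _; have [] := DB k.
    + by move=> k _; apply: measurableI => //; have [] := DB k.
    + exact: trivIset_setIl.
have sGD : <<s G >> `<=` D.
  rewrite -setI_closed_g_dynkin_g_sigma_algebra//.
  by move=> B; apply.
have : <<s G >> (Y @^-1` B0); last by move/sGD => [].
(* [Omega] is given the sigma-algebra generated by [G], and [e] is the identity: the hypothesis on
   [Y] then places its preimages in [<<s G >>]. *)
have := mY _ (g_sigma_algebraType G : measurableType _) id _ measurableT B0 mB0.
rewrite setTI; apply => i si _ B mB; rewrite setTI.
apply: sub_sigma_algebra; exists (fun k => if k == i then Z i @^-1` B else setT).
  move=> k _; case: eqP => [->|_]; first by exists B => //; rewrite setTI.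
  by exists setT => //; rewrite setTI.
rewrite (bigD1_seq i)//= eqxx big1 ?setIT// => k /negbTE -> //.
Qed.

End iid_sequences.

(** * Stein's equation *)

Section normal_density.
Import HBNNSimple.
Context (R : realType) (v : R) (v0 : 0 < v).
Local Notation s := (Num.sqrt v).
Local Notation mu := (@lebesgue_measure R).
Local Notation N := (normal_prob 0 s).
Local Notation p := (normal_pdf 0 s).

Let s0 : s != 0. Proof. by rewrite sqrtr_eq0 -ltNge. Qed.

Lemma normal_pdf_gt0 x : 0 < p x.
Proof. by rewrite normal_pdfE// mulr_gt0 ?expR_gt0// normal_peak_gt0. Qed.

Lemma is_derive_normal_pdf (x : R) : is_derive x 1 p (- (x / v) * p x).
Proof.
rewrite normal_pdfE//.
have -> : normal_peak s * normal_fun 0 s x = normal_fun 0 s x * normal_peak s by rewrite mulrC.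
rewrite /normal_fun sqr_sqrtr; last exact: ltW.
have h : is_derive x 1 (fun y : R => - (y - 0) ^+ 2 / (v *+ 2)) (- (x / v)).
  apply: is_derive_eq; rewrite /GRing.scale /=.
  by field; rewrite gt_eqF.
have := @is_derive1_comp _ expR _ x _ _ (is_derive_expR _) h.
move=> h2; have := @is_deriveZ _ _ _ _ (normal_peak s) x 1 _ h2.
move=> h3; apply: is_derive_eq; rewrite /GRing.scale/=; ring.
Qed.

(** The bit [b] selects the tail. The decay comes from [1 + y <= exp y] at [y = n^2 / (2 v)]
    together with [n <= n^2]. *)
Lemma normal_pdf_cvg_nat (b : bool) : p ((-1) ^+ b * n%:R) @[n --> \oo] --> 0.
Proof.
suff : forall n : nat, (1 <= n)%N -> p ((-1) ^+ b * n%:R) <= normal_peak s * (v *+ 2) * n%:R^-1.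
  move=> H; apply: (@squeeze_cvgr _ _ _ _ (cst 0) (fun n : nat => normal_peak s * (v *+ 2) * n%:R^-1)).
  - near=> n; rewrite normal_pdf_ge0/= H//.
    by near: n; exact: nbhs_infty_ge.
  - exact: cvg_cst.
  - rewrite -[X in _ --> X](mulr0 (normal_peak s * (v *+ 2))).
    apply: cvgM; first exact: cvg_cst.
    apply/gtr0_cvgV0; last exact: cvgr_idn.
    by near=> n; rewrite ltr0n; near: n; exact: nbhs_infty_gt.
move=> n n1; have n0 : 0 < n%:R :> R by rewrite ltr0n.
rewrite normal_pdfE// -mulrA ler_wpM2l ?normal_peak_ge0// /normal_fun subr0.
rewrite exprMn -exprM mulnC exprM sqrrN expr1n expr1n mul1r sqr_sqrtr; last exact: ltW.
rewrite mulNr expRN -lef_pV2 ?posrE ?invrK ?invr_gt0 ?expR_gt0//; last first.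
  by rewrite divr_gt0// mulrn_wgt0.
rewrite invfM invrK.
apply: le_trans (expR_ge1Dx _); rewrite mulrC.
apply: (@le_trans _ _ (n%:R ^+ 2 / (v *+ 2))); last by lra.
rewrite ler_wpM2r ?invr_ge0 ?mulrn_wge0 ?(ltW v0)//.
by rewrite expr2 ler_peMr ?ler1n// ltW.
Unshelve. all: by end_near. Qed.

Lemma integrable_bounded_normal_pdf (h : R -> R) (M : R) :
  measurable_fun setT h -> (forall x, `|h x| <= M) ->
  mu.-integrable setT (EFin \o (fun x => h x * p x)).
Proof.
move=> mh hM.
have i1 : mu.-integrable setT (fun x => (M%:E * (p x)%:E)%E).
  exact/integrableZl/integrable_normal_pdf.
apply: le_integrable i1 => //.
  by apply/measurable_EFinP/measurable_funM => //; exact: measurable_normal_pdf.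
move=> x _ /=; rewrite lee_fin normrM (ger0_norm (normal_pdf_ge0 _ _ _)).
rewrite normrM (ger0_norm (normal_pdf_ge0 _ _ _)) ler_wpM2r ?normal_pdf_ge0//.
exact: le_trans (hM x) (ler_norm _).
Qed.

(** [normal_prob] is defined through its values on sets. The passage from indicators to simple
    functions and then to [h + M] uses dominated convergence twice, once under the law and once
    under Lebesgue measure against the density. *)
Lemma Ex_normal_prob (h : R -> R) (M : R) : measurable_fun setT h ->
  (forall x, `|h x| <= M) ->
  Ex N h = \int[mu]_x (h x * p x).
Proof.
move=> mh hM.
have mp : measurable_fun setT p by exact: measurable_normal_pdf.
have mf : measurable_fun [set: R] (fun x => (h x + M)%:E).
  by apply/measurable_EFinP; apply: measurable_funD.
pose t n : {nnsfun R >-> R} := nnsfun_approx measurableT mf n.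
have f0 x : [set: R] x -> (0 <= (h x + M)%:E)%E.
  by move=> _; rewrite lee_fin; have := hM x; rewrite ler_norml => /andP[]; lra.
have tle n x : t n x <= h x + M.
  by rewrite -lee_fin /t nnsfun_approxE; exact: le_approx.
have tcvg x : t n x @[n --> \oo] --> h x + M.
  exact: (fine_cvg (cvg_nnsfun_approx measurableT mf f0 (I : [set: R] x))).
have hM2 x : h x + M <= 2 * M.
  by have := hM x; rewrite ler_norml => /andP[_]; lra.
have tb n x : `|t n x| <= 2 * M.
  by rewrite ger0_norm//; exact: le_trans (hM2 x).
have Et n : Ex N (t n) = \int[mu]_x (t n x * p x).
  pose S := finmap.enum_fset (fset_set (range (t n))).
  have tE x : t n x = \sum_(y <- S) y * \1_(t n @^-1` [set y]) x.
    by rewrite fimfunE fsbig_finite.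
  have mt y : measurable (t n @^-1` [set y]) by exact: measurable_funPTI.
  rewrite (_ : (t n : R -> R) = fun x => \sum_(y <- S) y * \1_(t n @^-1` [set y]) x); last first.
    by apply/funext.
  have iy y : intg N (fun x => \1_(t n @^-1` [set y]) x) := intg_indic N (mt y).
  rewrite Ex_sum => [|y _]; last exact: (intgZ y (iy y)).
  have iI y : mu.-integrable setT (EFin \o (fun x => \1_(t n @^-1` [set y]) x * p x)).
    apply: (@integrable_bounded_normal_pdf _ 1); first exact: measurable_indic.
    by move=> w; rewrite indicE; case: (_ \in _); rewrite ?normr1 ?normr0.
  transitivity (\sum_(y <- S) \int[mu]_x (y * (\1_(t n @^-1` [set y]) x * p x))).
    apply: eq_bigr => y _; rewrite ExZ; last exact: iy.
    rewrite (RintegralZl y measurableT (iI y)) (Ex_indic N (mt y)); congr (_ * _).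
    rewrite /normal_prob /Rintegral; congr fine.
    transitivity (\int[mu]_(x in t n @^-1` [set y]) (p x)%:E)%E => //.
    rewrite [LHS]integral_mkcond; apply: eq_integral => x _.
    by rewrite patchE indicE; case: ifP; rewrite ?mul1r ?mul0r.
  elim: S {tE} => [|y S IH].
    rewrite big_nil /Rintegral; under eq_integral do rewrite big_nil mul0r.
    by rewrite integral0.
  rewrite big_cons IH -RintegralD//.
  - apply: eq_Rintegral => x _; rewrite big_cons mulrDl; ring.
  - by apply: (integrableZl _ y (iI y)).
  - rewrite (_ : _ \o _ = fun x => (\sum_(z <- S) (z%:E * ((\1_(t n @^-1` [set z]) x * p x)%:E)))%E).
      by apply: integrable_sum => // z _; apply: (integrableZl _ z (iI z)).
    apply/funext => x /=; rewrite mulr_suml sumEFin; congr EFin.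
    by apply: eq_bigr => z _; rewrite -mulrA.
have mhM : measurable_fun [set: R] (fun x => h x + M) by apply: measurable_funD.
have ihN : intg N h := @intg_bounded _ _ _ N h M mh hM.
have [|||| iN cN] := @cvg_Ex_dominated _ _ _ N (fun n => t n : R -> R) (fun x => h x + M) (cst (2 * M)).
- by move=> n; exact: (@measurable_funPT _ _ _ _ (t n)).
- exact: intg_cst.
- exact: tcvg.
- by move=> n x; exact: tb.
have [|||||_ _] := @dominated_convergence _ _ _ mu setT measurableT
   (fun n x => (t n x * p x)%:E) (fun x => ((h x + M) * p x)%:E) (fun x => (2 * M * p x)%:E).
- move=> n; apply/measurable_EFinP/measurable_funM => //.
  exact: (@measurable_funPT _ _ _ _ (t n)).
- by apply/measurable_EFinP/measurable_funM.
- apply: aeW => x _; apply/cvg_EFin; first exact: nearW.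
  by apply: cvgMl; exact: tcvg.
- apply: (@integrable_bounded_normal_pdf (cst (2 * M)) `|2 * M|) => // x; exact: lexx.
- apply: aeW => x n _; rewrite lee_fin normrM (ger0_norm (normal_pdf_ge0 _ _ _)).
  by rewrite ler_wpM2r// normal_pdf_ge0.
have ihMp : mu.-integrable setT (EFin \o (fun x => (h x + M) * p x)).
  apply: (@integrable_bounded_normal_pdf _ (2 * M)) => // x.
  by rewrite ger0_norm//; have := hM x; rewrite ler_norml => /andP[]; lra.
move=> c2; have : Ex N (fun x => h x + M) = \int[mu]_x ((h x + M) * p x).
  apply: (cvg_unique (@Rhausdorff R) cN).
  rewrite (_ : (fun n => Ex N (t n)) = fun n => \int[mu]_x (t n x * p x)); last exact/funext.
  apply: fine_cvg; rewrite fineK//; exact: integrable_fin_num.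
have ihp := integrable_bounded_normal_pdf mh hM.
have ip : mu.-integrable setT (EFin \o (fun x => M * p x)).
  apply: (@integrable_bounded_normal_pdf (cst M) `|M|) => // x; exact: lexx.
have <- : \int[mu]_x (h x * p x + M * p x) = \int[mu]_x ((h x + M) * p x).
  by apply: eq_Rintegral => x _; rewrite mulrDl.
rewrite RintegralD// ExD//; last exact: intg_cst.
rewrite Ex_cst.
have -> : \int[mu]_x (M * p x) = M.
  rewrite RintegralZl//; last exact: integrable_normal_pdf.
  by rewrite /Rintegral integral_normal_pdf /= mulr1.
exact: addIr.
Qed.

End normal_density.

Section normal_tail.
Context (R : realType) (v : R) (v0 : 0 < v).
Local Notation s := (Num.sqrt v).
Local Notation p := (normal_pdf 0 s).
Context (k F : R -> R) (M : R) (M0 : 0 <= M).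
Hypothesis k_le : forall x, `|k x| <= 2 * M * p x.
Hypothesis F_derive : forall x : R, is_derive x 1 F (k x).
Hypothesis F_cvg : forall b : bool, F ((-1) ^+ b * n%:R) @[n --> \oo] --> 0.

(** The factor of [F] is frozen to a constant [c], so that no term in [F] survives in the derivative
    of [G = 2 M v p - c F]. Since [|c| <= |x|], this derivative has the sign of [- y] at every [y]
    beyond [x]; as [G] vanishes at infinity, [G x] is non-negative. *)
Lemma stein_tail_signed x c : x != 0 -> `|c| <= `|x| -> c * F x <= 2 * M * v * p x.
Proof.
move=> x0 cx; pose G y := 2 * M * v * p y - c * F y.
have dG (y : R) : is_derive y 1 G (- (2 * M * y * p y + c * k y)).
  have dp := is_derive_normal_pdf v0 y; have dF := F_derive y.
  have := is_deriveB (is_deriveZ (2 * M * v) dp) (is_deriveZ c dF).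
  move=> dd; apply: is_derive_eq; rewrite /GRing.scale/=; field.
  by rewrite gt_eqF.
have cG : continuous G.
  move=> y; apply: differentiable_continuous; apply/derivable1_diffP.
  by have := dG y; case.
have Glim (b : bool) : G ((-1) ^+ b * n%:R) @[n --> \oo] --> 0.
  have h1 : 2 * M * v * p ((-1) ^+ b * n%:R) @[n --> \oo] --> 2 * M * v * 0.
    exact: (cvgMr (@normal_pdf_cvg_nat _ _ v0 b)).
  have h2 : c * F ((-1) ^+ b * n%:R) @[n --> \oo] --> c * 0.
    exact: (cvgMr (F_cvg b)).
  rewrite -[X in _ --> X](subrr 0) -[X in _ --> X - _](mulr0 (2 * M * v)).
  by rewrite -[X in _ --> _ - X](mulr0 c); exact: cvgB h1 h2.
have ckp y : `|c * k y| <= `|x| * (2 * M * p y) by rewrite normrM ler_pM.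
suff : 0 <= G x by rewrite subr_ge0.
have p0 y := @normal_pdf_ge0 R 0 s y.
have [xn|xp] := ltP x 0.
  rewrite -(cvg_lim (@Rhausdorff R) (Glim true)); apply: limr_le.
    exact: cvgP (Glim true).
  near=> n.
  have nx : - x < n%:R by near: n; exact: nbhs_infty_gtr.
  have ax : (-1) ^+ true * n%:R < x by rewrite expr1 mulN1r; lra.
  have [y yin] := MVT ax (fun y _ => dG y) (continuous_subspaceT cG).
  move=> E; rewrite -subr_ge0 E mulr_ge0// ?subr_ge0 ?(ltW ax)// oppr_ge0.
  have := ckp y; rewrite ler_norml => /andP[_]; move: yin; rewrite in_itv/= => /andP[_ yx].
  rewrite (ltr0_norm xn) => h1.
  have := mulr_ge0 M0 (p0 y); set q := M * p y => q0.
  have := mulr_ge0 q0 (_ : 0 <= x - y); rewrite subr_ge0 ltW// => /(_ isT).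
  move: h1; rewrite (_ : 2 * M * y * p y = 2 * (q * y)); last by rewrite /q; ring.
  rewrite (_ : - x * (2 * M * p y) = - 2 * (q * x)); last by rewrite /q; ring.
  by rewrite mulrBr; lra.
have {}xp : 0 < x by rewrite lt_neqAle eq_sym x0.
rewrite -(cvg_lim (@Rhausdorff R) (Glim false)); apply: limr_le.
  exact: cvgP (Glim false).
near=> n.
have nx : x < n%:R by near: n; exact: nbhs_infty_gtr.
have xb : x < (-1) ^+ false * n%:R by rewrite expr0 mul1r.
have [y yin] := MVT xb (fun y _ => dG y) (continuous_subspaceT cG).
move=> E; rewrite -subr_le0 E mulr_le0_ge0// ?subr_ge0 ?(ltW xb)// oppr_le0.
have := ckp y; rewrite ler_norml => /andP[+ _]; move: yin; rewrite in_itv/= => /andP[xy _].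
rewrite (gtr0_norm xp) => h1.
have := mulr_ge0 M0 (p0 y); set q := M * p y => q0.
have := mulr_ge0 q0 (_ : 0 <= y - x); rewrite subr_ge0 ltW// => /(_ isT).
move: h1; rewrite (_ : 2 * M * y * p y = 2 * (q * y)); last by rewrite /q; ring.
rewrite (_ : x * (2 * M * p y) = 2 * (q * x)); last by rewrite /q; ring.
by rewrite mulrBr; lra.
Unshelve. all: by end_near. Qed.

Lemma stein_tail x : `|x * F x| <= 2 * M * v * p x.
Proof.
have [->|x0] := eqVneq x 0.
  by rewrite mul0r normr0 !mulr_ge0// ?normal_pdf_ge0// ltW.
rewrite ler_norml lerNl -mulNr; apply/andP; split; apply: stein_tail_signed => //.
by rewrite normrN.
Qed.

End normal_tail.

Section stein_equation.
Context (R : realType) (v : R) (v0 : 0 < v).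
Local Notation s := (Num.sqrt v).
Local Notation mu := (@lebesgue_measure R).
Local Notation N := (normal_prob 0 s).
Local Notation p := (normal_pdf 0 s).
Context (h : R -> R) (M : R) (ch : continuous h) (hM : forall x, `|h x| <= M).

Let m := Ex N h.
Let k x := (h x - m) * p x.
Let F x := \int[mu]_(t in `]-oo, x]) k t.

Let s0 : s != 0. Proof. by rewrite sqrtr_eq0 -ltNge. Qed.

Let mh : measurable_fun setT h. Proof. exact: continuous_measurable_fun. Qed.

Let M0 : 0 <= M. Proof. exact: le_trans (normr_ge0 _) (hM 0). Qed.

Let m_le : `|m| <= M.
Proof.
have ih : intg N h := @intg_bounded _ _ _ N h M mh hM.
apply: le_trans (ler_norm_Ex ih) _; rewrite -[leRHS](Ex_cst N).
by apply: ler_Ex => //; [exact: intg_norm|exact: intg_cst].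
Qed.

Let hm_le x : `|h x - m| <= 2 * M.
Proof. by apply: le_trans (ler_normB _ _) _; have := hM x; have := m_le; lra. Qed.

Let ck : continuous k.
Proof.
move=> x; apply: cvgM; last exact: continuous_normal_pdf.
by apply: cvgB; [exact: ch|exact: cvg_cst].
Qed.

Let ik : mu.-integrable setT (EFin \o k).
Proof.
apply: (@integrable_bounded_normal_pdf _ v (fun x => h x - m) (2 * M)) => //.
by apply: measurable_funB.
Qed.

Let k_le x : `|k x| <= 2 * M * p x.
Proof.
by rewrite normrM (ger0_norm (normal_pdf_ge0 _ _ _)) ler_wpM2r// normal_pdf_ge0.
Qed.

Let int_k : \int[mu]_x k x = 0.
Proof.
have ih := integrable_bounded_normal_pdf v mh hM.
have ip : mu.-integrable setT (EFin \o (fun x => m * p x)).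
  by apply: (@integrable_bounded_normal_pdf _ _ (cst m) `|m|).
rewrite (_ : k = fun x => h x * p x - m * p x); last first.
  by apply/funext => x; rewrite /k mulrBl.
rewrite RintegralB// -(Ex_normal_prob v mh hM) RintegralZl//; last exact: integrable_normal_pdf.
by rewrite /Rintegral integral_normal_pdf /= mulr1 subrr.
Qed.

Let FE x : F x = \int[mu]_t (k \_ `]-oo, x]) t.
Proof. by rewrite /F Rintegral_mkcond. Qed.

Let F_derive (x : R) : is_derive x 1 F (k x).
Proof.
have [||||df Fk] := @continuous_FTC1 R k -oo%O x (x + 1) _ _ _ _.
- by rewrite ltrDl.
- by apply: integrableS ik.
- exact: ltNyr.
- exact: ck.
by apply: DeriveDef; [exact: df|rewrite -derive1E].
Qed.

(** One dominated convergence serves both tails: [F] tends to 0 on the left and to the full integral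
    of [k] on the right, which vanishes because [h] is centred by its normal mean. *)
Let F_cvg (b : bool) : F ((-1) ^+ b * n%:R) @[n --> \oo] --> 0.
Proof.
have mk : measurable_fun setT k := continuous_measurable_fun ck.
pose ll := if b then 0 else \int[mu]_t k t.
have -> : 0 = ll by rewrite /ll int_k; case: (b).
pose kl (t : R) := if b then 0 else k t.
have llE : ll = \int[mu]_t kl t.
  rewrite /ll /kl; case: (b) => //.
  by rewrite /Rintegral integral0.
have [|||||_ _] := @dominated_convergence _ _ _ mu setT measurableT
   (fun n t => ((k \_ `]-oo, (-1) ^+ b * n%:R]) t)%:E) (fun t => (kl t)%:E) (fun t => `|(k t)%:E|%E).
- move=> n; apply/measurable_EFinP; apply/(measurable_restrictT _ _).1 => //.
  exact: measurable_funTS mk.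
- by apply/measurable_EFinP; rewrite /kl; case: (b).
- apply: aeW => t _; apply/cvg_EFin; first exact: nearW.
  apply: cvg_near_cst; near=> n.
  have tn : `|t| < n%:R by near: n; exact: nbhs_infty_gtr.
  move: tn; rewrite ltr_norml => /andP[tn1 tn2].
  rewrite /= patchE /kl; case: (b) => /=.
    by rewrite expr1 mulN1r memNset//= in_itv/=; apply/negP; rewrite -ltNge.
  by rewrite expr0 mul1r mem_set//= in_itv/= ltW.
- exact: integrable_abse.
- apply: aeW => t n _; rewrite lee_fin patchE; case: ifP => // _.
  by rewrite normr0.
move=> c; rewrite (_ : (fun n => F _) = fun n => fine (\int[mu]_t ((k \_ `]-oo, (-1) ^+ b * n%:R]) t)%:E)); last first.
  by apply/funext => n; rewrite FE.
apply: fine_cvg; rewrite llE /Rintegral fineK//.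
rewrite /kl; case: (b); last exact: integrable_fin_num.
by rewrite integral0.
Unshelve. all: by end_near. Qed.

Let F_le x : `|F x| <= 2 * M.
Proof.
have iFx : mu.-integrable `]-oo, x] (EFin \o k) by apply: integrableS ik.
apply: le_trans (le_normr_Rintegral _ iFx) _ => //.
have ip2 : mu.-integrable setT (EFin \o (fun t => 2 * M * p t)).
  by apply: (integrableZl _ (2 * M) (@integrable_normal_pdf _ _ _)).
apply: (@le_trans _ _ (\int[mu]_t (2 * M * p t))).
  rewrite Rintegral_mkcond; apply: le_Rintegral => //.
    have iab : mu.-integrable `]-oo, x] (EFin \o (fun t => `|k t|)) := integrable_abse iFx.
    by rewrite -restrict_EFin; exact: ((integrable_mkcond _ _).1 iab).
  move=> t _; rewrite patchE; case: ifP => _; first exact: k_le.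
  by rewrite !mulr_ge0// normal_pdf_ge0.
rewrite RintegralZl//; last exact: integrable_normal_pdf.
by rewrite /Rintegral integral_normal_pdf /= mulr1.
Qed.

(** The solution is [F / (v p)]: since [p' = - x p / v], division by the density is the integrating
    factor. The tail estimate bounds [x g], hence [g'] through the equation; it also bounds [g]
    outside [[-1, 1]], while inside the lower bound [p 1 <= p x] does. *)
Lemma stein_solution : exists (g g' : R -> R) (C : R),
  [/\ forall x : R, is_derive x 1 g (g' x), continuous g', forall x, `|g x| <= C,
      forall x, `|g' x| <= C & forall x, v * g' x - x * g x = h x - Ex N h].
Proof.
have p0 y := normal_pdf_gt0 v0 y.
(* [g'] is defined by Stein's equation itself; that it is the derivative of [g] is checked next. *)
pose g x := F x / (v * p x); pose g' x := (h x - m + x * g x) / v.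
have vp x : 0 < v * p x by rewrite mulr_gt0.
have dg (x : R) : is_derive x 1 g (g' x).
  have dp := is_derive_normal_pdf v0 x; have dF := F_derive x.
  have vpx : v * p x != 0 by rewrite gt_eqF.
  have dV := @is_deriveV _ (v \*: p) x _ _ vpx (is_deriveZ v dp).
  have := is_deriveM dF dV => dd; apply: is_derive_eq; rewrite /GRing.scale/=.
  rewrite /g' /g /k (_ : v *: p x = v * p x)//.
  have px0 : p x != 0 by rewrite gt_eqF.
  have vn0 : v != 0 by rewrite gt_eqF.
  move: (F x) (p x) px0 => Fx px px0; field.
  by rewrite vn0 px0.
have cg : continuous g.
  move=> y; apply: differentiable_continuous; apply/derivable1_diffP.
  by have := dg y; case.
have xg x : `|x * g x| <= 2 * M.
  rewrite /g mulrA normrM normfV (gtr0_norm (vp x)) ler_pdivrMr//.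
  by rewrite mulrA; exact: (stein_tail v0 M0 k_le F_derive F_cvg).
have g'b x : `|g' x| <= 4 * M / v.
  rewrite /g' normrM normfV (gtr0_norm v0) ler_wpM2r ?invr_ge0 ?(ltW v0)//.
  by apply: le_trans (ler_normD _ _) _; have := hm_le x; have := xg x; lra.
have p1 x : `|x| <= 1 -> p 1 <= p x.
  move=> x1; rewrite normal_pdfE// ler_wpM2l ?normal_peak_ge0// /normal_fun ler_expR.
  rewrite ler_wpM2r ?invr_ge0 ?mulrn_wge0 ?sqr_ge0// !subr0 lerN2 expr1n.
  by rewrite -real_normK ?num_real// expr_le1.
have gb x : `|g x| <= 2 * M + 2 * M / (v * p 1).
  have [x1|x1] := leP `|x| 1; last first.
    apply: (@le_trans _ _ (2 * M)); last by rewrite lerDl divr_ge0 ?mulr_ge0// ltW.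
    by apply: le_trans (xg x); rewrite (normrM x (g x)) ler_peMl// ltW.
  apply: (@le_trans _ _ (2 * M / (v * p 1))); last by rewrite lerDr mulr_ge0.
  rewrite /g normrM normfV (gtr0_norm (vp x)); apply: ler_pM => //.
    by rewrite invr_ge0 ltW.
  by rewrite lef_pV2 ?posrE// ler_wpM2l ?p1// ltW.
exists g, g', (4 * M / v + (2 * M + 2 * M / (v * p 1))); split.
- exact: dg.
- move=> x; apply: cvgM; last exact: cvg_cst.
  apply: cvgD; first by apply: cvgB; [exact: ch|exact: cvg_cst].
  by apply: cvgM; [exact: cvg_id|exact: cg].
- by move=> x; apply: le_trans (gb x) _; rewrite lerDr divr_ge0 ?mulr_ge0// ltW.
- move=> x; apply: le_trans (g'b x) _; rewrite lerDl addr_ge0 ?mulr_ge0//.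
  by rewrite invr_ge0 ltW.
- by move=> x; rewrite /g' mulrC divfK ?gt_eqF// addrK.
Qed.

End stein_equation.

(** * Laws of large numbers and the central limit theorem *)

(** Heine's theorem with only [x] confined to the segment: [y] may leave it, so the covering
    argument uses full neighbourhoods of the points of the segment. *)
Lemma uniform_continuity_segment (R : realType) (g : R -> R) (b e : R) :
  continuous g -> 0 < e ->
  exists2 dl : R, 0 < dl & forall x y, `|x| <= b -> `|y - x| <= dl -> `|g y - g x| <= e.
Proof.
move=> cg e0.
have /compact_near_coveringP K := @segment_compact R (- b) b.
have : \forall dl \near 0^'+, `[- b, b] `<=` [set x | forall y, `|y - x| <= dl -> `|g y - g x| <= e].
  apply: K => x _.
  have e2 : 0 < e / 2 by rewrite divr_gt0.
  have /cvgrPdist_lt /(_ _ e2) := cg x; move=> /nbhs_ballP [r /= r0 rg].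
  have r2 : 0 < r / 2 by rewrite divr_gt0.
  exists ([set x' | `|x - x'| < r / 2], [set dl : R | dl < r / 2]) => /=.
    split; last exact: nbhs_right_lt.
    by apply/nbhs_ballP; exists (r / 2).
  move=> [x' dl] /= [xx' dlr] y yx'.
  have h1 : `|g x - g x'| < e / 2.
    by apply: rg; rewrite /ball/=; apply: lt_trans xx' _; lra.
  have h2 : `|g x - g y| < e / 2.
    apply: rg; rewrite /ball/= (_ : x - y = (x - x') - (y - x')); last by ring.
    by apply: le_lt_trans (ler_normB _ _) _; lra.
  rewrite (_ : g y - g x' = (g x - g x') - (g x - g y)); last by ring.
  by apply: le_trans (ler_normB _ _) _; lra.
move=> [dl /= dl0 H]; exists (dl / 2); first by rewrite divr_gt0.
move=> x y xb; apply: H => //=.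
- by rewrite sub0r normrN gtr0_norm ?divr_gt0//; lra.
- by rewrite divr_gt0.
- by rewrite in_itv/= -ler_norml.
Qed.

(* [normal_prob] lives on [measurableTypeR R] whereas the integrals of
   [cvg_in_distribution] are taken on [R]: same sigma-algebra, distinct structures. *)
Lemma integral_normal_prob (R : realType) (s M : R) (f : R -> R) (nu : set R -> \bar R) :
  continuous f -> (forall x, `|f x| <= M) -> nu = normal_prob 0 s ->
  (\int[nu]_x (f x)%:E)%E = (Ex (normal_prob 0 s) f)%:E.
Proof.
move=> cf fM nuE; have mf : measurable_fun setT f by exact: continuous_measurable_fun.
have ifN : intg (normal_prob 0 s) f := @intg_bounded _ _ _ (normal_prob 0 s) f M mf fM.
have mid : measurable_fun (setT : set (measurableTypeR R)) (id : measurableTypeR R -> R).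
  by move=> _ B mB; rewrite setTI.
rewrite -(integral_Ex ifN).
rewrite (_ : nu = pushforward (normal_prob 0 s) (id : measurableTypeR R -> R)); last first.
  by rewrite nuE; apply/funext.
have H := @integral_pushforward _ _ (measurableTypeR R) R R id mid (normal_prob 0 s) setT (EFin \o f).
by rewrite H//; exact/measurable_EFinP.
Qed.

Section limit_theorems.
Context d (Omega : measurableType d) (R : realType) (P : probability Omega R).
Local Notation Ex := (Ex P).
Local Notation intg := (intg P).

Lemma prob_le_Ex (A : set Omega) (X : Omega -> R) : measurable A -> intg X ->
  (forall w, 0 <= X w) -> (forall w, A w -> 1 <= X w) -> (P A <= (Ex X)%:E)%E.
Proof.
move=> mA iX X0 AX; rewrite -[leLHS]fineK ?fin_num_measure// lee_fin -Ex_indic//.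
apply: ler_Ex => //; first exact: intg_indic.
move=> w; rewrite indicE; case: (boolP (w \in A)) => //.
by rewrite inE => /AX.
Qed.

Definition vanishing (E : nat -> set Omega) : Prop :=
  (forall J, measurable (E J)) /\
  forall e : R, 0 < e -> exists N, forall J, (N <= J)%N -> (P (E J) <= e%:E)%E.

Lemma vanishingS (E F : nat -> set Omega) : (forall J, measurable (F J)) ->
  (exists N, forall J, (N <= J)%N -> F J `<=` E J) -> vanishing E -> vanishing F.
Proof.
move=> mF [N0 FE] [mE vE]; split=> // e e0; have [N NE] := vE _ e0.
exists (maxn N N0) => J; rewrite geq_max => /andP[J1 J2].
by apply: le_trans (NE _ J1); apply: le_measure; rewrite ?inE//; exact: FE.
Qed.

Lemma vanishingU (E F : nat -> set Omega) : vanishing E -> vanishing F ->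
  vanishing (fun J => E J `|` F J).
Proof.
move=> [mE vE] [mF vF]; split=> [J|e e0]; first exact: measurableU.
have e2 : 0 < e / 2 by rewrite divr_gt0.
have [N NE] := vE _ e2; have [N' NF] := vF _ e2.
exists (maxn N N') => J; rewrite geq_max => /andP[J1 J2].
apply: (@le_trans _ _ (P (E J) + P (F J))%E); first exact: measureU2.
rewrite (_ : e = e / 2 + e / 2); last by lra.
by rewrite EFinD; apply: leeD; [exact: NE|exact: NF].
Qed.

Lemma vanishing_set0 : vanishing (fun=> set0).
Proof. by split=> [//|e e0]; exists 0%N => J _; rewrite measure0 lee_fin ltW. Qed.

Lemma vanishing_bigU (I : Type) (r : seq I) (Q : pred I) (E : I -> nat -> set Omega) :
  (forall i, vanishing (E i)) ->
  vanishing (fun J => \big[setU/set0]_(i <- r | Q i) E i J).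
Proof.
move=> vE; elim: r => [|i r IH].
  by under eq_fun do rewrite big_nil; exact: vanishing_set0.
under eq_fun do rewrite big_cons.
by case: (Q i); [exact: vanishingU|exact: IH].
Qed.

Lemma measurable_gt_norm (X : Omega -> R) (e : R) : measurable_fun setT X ->
  measurable [set w | e < `|X w|].
Proof.
move=> mX; rewrite (_ : [set w | _] = (fun w => `|X w|) @^-1` `]e, +oo[); last first.
  by apply/seteqP; split=> w /=; rewrite in_itv/= andbT.
rewrite -[X in measurable X]setTI.
exact: (measurableT_comp (@normr_measurable R setT) mX).
Qed.

Section sums.
Context (Z : nat -> Omega -> R) (iZ : iid_rv P Z).

Lemma iid_rv_intg j : intg (Z 0) -> intg (Z j) /\ Ex (Z j) = Ex (Z 0).
Proof. by move=> i0; apply: (iid_rv_Ex j iZ (@measurable_id _ _ setT)). Qed.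

Lemma iid_rv_indep_sum (s : seq nat) j : uniq s -> j \notin s ->
  indep_rv P (Z j) (fun w => \sum_(i <- s) Z i w).
Proof.
move=> us js; apply: (iid_rv_indep_others iZ us js) => d' Om e me.
rewrite (_ : _ \o e = fun w => \sum_(i <- s) (if i \in s then Z i (e w) else 0)); last first.
  by apply/funext => w /=; apply: eq_big_seq => i ->.
by apply: measurable_sum => i; case: (boolP (i \in s)) => // si; exact: me.
Qed.

Lemma Ex_sqr_sum (s : seq nat) : uniq s -> intg (fun w => Z 0 w ^+ 2) ->
  intg (Z 0) -> Ex (Z 0) = 0 ->
  intg (fun w => (\sum_(i <- s) Z i w) ^+ 2) /\
  Ex (fun w => (\sum_(i <- s) Z i w) ^+ 2) = (size s)%:R * Ex (fun w => Z 0 w ^+ 2).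
Proof.
move=> + i2 i1 E0; elim: s => [_|j s IH /= /andP[js us]].
  rewrite (_ : (fun w => _) = cst 0); last first.
    by apply/funext => w; rewrite big_nil expr0n.
  by rewrite Ex_cst mul0r; split=> //; exact: intg_cst.
have [iS ES] := IH us.
have [ij2 Ej2] := iid_rv_Ex j iZ (@exprn_measurable R setT 2) i2.
have [ij Ej] := iid_rv_intg j i1.
have isum : intg (fun w => \sum_(i <- s) Z i w).
  by apply: intg_sum => i _; exact: (iid_rv_intg i i1).1.
have [ic Ec] := Ex_mul_indep ij isum (iid_rv_indep_sum us js).
rewrite (_ : (fun w => _) = fun w => (Z j w ^+ 2 + 2 * (Z j w * \sum_(i <- s) Z i w)) +
    (\sum_(i <- s) Z i w) ^+ 2); last first.
  by apply/funext => w; rewrite big_cons; ring.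
have ij2c : intg (fun w => Z j w ^+ 2 + 2 * (Z j w * \sum_(i <- s) Z i w)).
  by apply: intgD => //; exact: intgZ.
split; first exact: intgD.
rewrite ExD// ExD//; last exact: intgZ.
by rewrite ExZ// Ec Ej E0 ES Ej2 mul0r mulr0 addr0 -natr1; ring.
Qed.

End sums.

(** Only a first moment is assumed, because the products of entries to which the law is applied have
    no second moment in general. The clipping level [n] is fixed before [J]: the clipped part obeys
    Chebyshev's inequality, the remainder has a small first moment. *)
Lemma weak_law (Z : nat -> Omega -> R) (e : R) : iid_rv P Z -> intg (Z 0) ->
  Ex (Z 0) = 0 -> 0 < e ->
  vanishing (fun J => [set w | e < `|J%:R^-1 * \sum_(j < J) Z j w|]).
Proof.
move=> iZ i0 E0 e0; have mZ j : measurable_fun setT (Z j) by have [] := iZ.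
have mS J : measurable_fun setT (fun w => J%:R^-1 * \sum_(j < J) Z j w).
  by apply: measurable_funM => //; apply: measurable_sum => j; exact: mZ.
split=> [J|a a0]; first exact: measurable_gt_norm.
have clipc : Ex (fun w => `|Z 0 w - clip n (Z 0 w)|) @[n --> \oo] --> 0.
  have [||||_] := @cvg_Ex_dominated _ _ _ P (fun n w => `|Z 0 w - clip n (Z 0 w)|)
      (cst 0) (fun w => 2 * `|Z 0 w|).
  - move=> n; apply: measurableT_comp => //; apply: measurable_funB => //.
    exact: measurableT_comp (@measurable_clip R n) (mZ 0).
  - exact/intgZ/intg_norm.
  - move=> w; rewrite -(normr0 R) -[X in `|X|](subrr (Z 0 w)).
    by apply: cvg_norm; apply: cvgB; [exact: cvg_cst|exact: clip_cvg].
  - move=> n w; rewrite normr_id; apply: le_trans (ler_normB _ _) _.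
    by have := clip_le n (Z 0 w); lra.
  by rewrite Ex_cst.
(* The budget: centring at most doubles the first moment of the remainder, giving [a * e / 4], and
   Markov's inequality at level [e / 2] turns this into [a / 2]. *)
have a8 : 0 < a * e / 8 by rewrite divr_gt0// mulr_gt0.
have /cvgrPdist_lt /(_ _ a8) [n _ /(_ n (leqnn n))] := clipc.
rewrite /= sub0r normrN => hn.
have {hn} : Ex (fun w => `|Z 0 w - clip n (Z 0 w)|) < a * e / 8.
  exact: le_lt_trans (ler_norm _) hn.
set D := fun w => Z 0 w - clip n (Z 0 w); move=> hn.
pose c := Ex (fun w => clip n (Z 0 w)).
pose f (x : R) := clip n x - c.
have mc := @measurable_clip R n.
have mf : measurable_fun setT f by apply: measurable_funB.
have iU := iid_rv_comp iZ mf.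
have icl : intg (fun w => clip n (Z 0 w)).
  by apply: (@intg_bounded _ _ _ _ _ n%:R) => [|w]; [exact: measurableT_comp|exact: clip_bounded].
have iU0 : intg (fun w => f (Z 0 w)) by apply: intgB => //; exact: intg_cst.
have EU0 : Ex (fun w => f (Z 0 w)) = 0.
  by rewrite ExB ?Ex_cst ?subrr//; exact: intg_cst.
have iU2 : intg (fun w => f (Z 0 w) ^+ 2).
  rewrite (_ : (fun w => _) = fun w => f (Z 0 w) * f (Z 0 w)); last exact/funext.
  apply: (@intg_mul_bounded _ _ _ _ _ _ (n%:R + `|c|)) => //; first exact: measurableT_comp.
  by move=> w; apply: le_trans (ler_normB _ _) _; rewrite lerD2r clip_bounded.
pose V (x : R) := `|x - f x|.
have mV : measurable_fun setT V.
  by apply: measurableT_comp => //; apply: measurable_funB.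
have iV0 : intg (fun w => V (Z 0 w)) by apply: intg_norm; exact: intgB.
have cE : c = - Ex D by rewrite /D ExB// E0 sub0r opprK.
have iD : intg D by exact: intgB.
have EV0 : Ex (fun w => V (Z 0 w)) <= a * e / 4.
  apply: (@le_trans _ _ (Ex (fun w => `|D w| + `|c|))).
    apply: ler_Ex => //; first by apply: intgD; [exact: intg_norm|exact: intg_cst].
    by move=> w; rewrite /V /f opprB addrA addrAC; apply: ler_normD.
  rewrite ExD; [|exact: intg_norm|exact: intg_cst].
  rewrite Ex_cst cE normrN.
  by have := ler_norm_Ex iD; lra.
pose tau := Ex (fun w => f (Z 0 w) ^+ 2).
have tau0 : 0 <= tau by apply: Ex_ge0 => w; exact: sqr_ge0.
have [N hN] : exists N : nat, tau * 8 / (e ^+ 2 * a) < N%:R.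
  exists (Num.trunc (tau * 8 / (e ^+ 2 * a))).+1.
  by rewrite truncnS_gt.
exists (maxn N 1) => J; rewrite geq_max => /andP[NJ J1].
have J0 : 0 < J%:R :> R by rewrite ltr0n.
(* [B] majorises the indicator of the event: if the average exceeds [e], either the clipped average
   is at least [e / 2] or the remainder average exceeds [e / 2]. The two summands are the Chebyshev
   and Markov majorants. *)
pose B w := 4 / e ^+ 2 * (J%:R^-1 ^+ 2 * (\sum_(j <- iota 0 J) f (Z j w)) ^+ 2) +
  2 / e * (J%:R^-1 * \sum_(j < J) V (Z j w)).
have [iS2 ES2] := Ex_sqr_sum iU (iota_uniq 0 J) iU2 iU0 EU0.
have iVj j : intg (fun w => V (Z j w)) by exact: (iid_rv_Ex j iZ mV iV0).1.
have iB1 : intg (fun w => 4 / e ^+ 2 * (J%:R^-1 ^+ 2 * (\sum_(j <- iota 0 J) f (Z j w)) ^+ 2)).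
  by do 2 apply: intgZ.
have iSV : intg (fun w => \sum_(j < J) V (Z j w)) by apply: intg_sum.
have iB : intg B by apply: intgD => //; do 2 apply: intgZ.
apply: (@le_trans _ _ (Ex B)%:E).
  apply: prob_le_Ex => //; first exact: measurable_gt_norm.
    move=> w; apply: addr_ge0.
      by rewrite mulr_ge0 ?divr_ge0 ?sqr_ge0// mulr_ge0 ?sqr_ge0.
    rewrite mulr_ge0 ?divr_ge0 ?(ltW e0)// mulr_ge0 ?invr_ge0// sumr_ge0// => i _.
    exact: normr_ge0.
  move=> w /= ew; rewrite /B -exprMn.
  set u := J%:R^-1 * \sum_(j <- iota 0 J) f (Z j w).
  set q := J%:R^-1 * _.
  have uq : `|J%:R^-1 * \sum_(j < J) Z j w| <= `|u| + q.
    rewrite /u (_ : iota 0 J = index_iota 0 J) ?big_mkord; last by rewrite /index_iota subn0.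
    rewrite (_ : _ * _ = J%:R^-1 * (\sum_(j < J) f (Z j w)) + J%:R^-1 * \sum_(j < J) (Z j w - f (Z j w))); last first.
      by rewrite -mulrDr -big_split/=; congr (_ * _); apply: eq_bigr => j _; ring.
    apply: le_trans (ler_normD _ _) _; rewrite lerD2l normrM ger0_norm ?invr_ge0//.
    by rewrite ler_wpM2l ?invr_ge0// ler_norm_sum.
  have q0 : 0 <= q.
    by rewrite mulr_ge0 ?invr_ge0// sumr_ge0// => i _; exact: normr_ge0.
  have [ue|ue] := leP (e / 2) `|u|.
    apply: (@le_trans _ _ (4 / e ^+ 2 * u ^+ 2)); last first.
      by rewrite lerDl mulr_ge0// divr_ge0// ltW.
    have -> : u ^+ 2 = `|u| ^+ 2 by rewrite real_normK ?num_real.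
    rewrite mulrAC ler_pdivlMr ?exprn_gt0// mul1r.
    rewrite (_ : 4 * `|u| ^+ 2 = (2 * `|u|) ^+ 2); last by ring.
    by rewrite lerXn2r ?nnegrE ?mulr_ge0 ?(ltW e0)//; lra.
  apply: (@le_trans _ _ (2 / e * q)); last first.
    by rewrite lerDr mulr_ge0 ?sqr_ge0// divr_ge0// sqr_ge0.
  by rewrite mulrAC ler_pdivlMr// mul1r; lra.
rewrite lee_fin ExD//; last by do 2 apply: intgZ.
rewrite !ExZ//; [|exact: intgZ|exact: intgZ].
rewrite Ex_sum// ES2 size_iota.
rewrite (eq_bigr (fun=> Ex (fun w => V (Z 0 w)))); last first.
  by move=> j _; exact: (iid_rv_Ex j iZ mV iV0).2.
rewrite sumr_const card_ord -/tau -[Ex _ *+ J]mulr_natl mulKf ?gt_eqF//.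
have h1 : 2 / e * Ex (fun w => V (Z 0 w)) <= a / 2.
  apply: (@le_trans _ _ (2 / e * (a * e / 4))); first by rewrite ler_wpM2l// divr_ge0// ltW.
  by rewrite le_eqVlt; apply/orP; left; apply/eqP; field; rewrite gt_eqF.
have h2 : 4 / e ^+ 2 * (J%:R^-1 ^+ 2 * (J%:R * tau)) <= a / 2.
  rewrite (_ : 4 / e ^+ 2 * _ = (tau * 8 / (e ^+ 2 * a)) * (a / 2) / J%:R); last first.
    by field; rewrite !gt_eqF.
  rewrite ler_pdivrMr// mulrC ler_wpM2l ?divr_ge0// ?(ltW a0)//.
  by apply: ltW; apply: lt_le_trans hN _; rewrite ler_nat.
lra.
Qed.


Section stein_step.
Context (g g' : R -> R) (C : R).
Hypothesis g_derive : forall x : R, is_derive x 1 g (g' x).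
Hypothesis g'_cont : continuous g'.
Hypothesis g_le : forall x, `|g x| <= C.
Hypothesis g'_le : forall x, `|g' x| <= C.

Let far (dl x : R) : R := (dl < `|x|)%R%:R.

(** Oscillation bound for [g'], which is uniformly continuous only on bounded sets. The trivial
    bound [2 * C] is charged to the quadratic term when [|y| > b] and to [far] when [|x| > dl];
    second moments control the expectation of both. *)
Let modulus (e b dl : R) (y x : R) : R :=
  e + 2 * C / b ^+ 2 * y ^+ 2 + 2 * C * far dl x.

Let C0 : 0 <= C. Proof. exact: le_trans (normr_ge0 _) (g_le 0). Qed.

Let g_cont : continuous g.
Proof.
by move=> y; apply: differentiable_continuous; apply/derivable1_diffP; case: (g_derive y).
Qed.

Let measurable_far dl : measurable_fun setT (far dl).
Proof.
rewrite (_ : far dl = \1_[set x | dl < `|x|]).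
  apply: measurable_indic.
  rewrite (_ : [set x | _] = (fun x : R => `|x|) @^-1` `]dl, +oo[); last first.
    by apply/seteqP; split=> w /=; rewrite in_itv/= andbT.
  by rewrite -[X in measurable X]setTI; exact: normr_measurable.
apply/funext => x; rewrite indicE /far; congr (_%:R); congr nat_of_bool.
by apply/idP/idP; rewrite inE.
Qed.

Let far01 dl x : 0 <= far dl x <= 1.
Proof. by rewrite /far; case: (_ < _)%R; rewrite ?lexx ?ler01. Qed.

Let modulus_bound e b dl y x z : 0 < e -> 0 < b -> 0 < dl ->
  (forall x y, `|x| <= b -> `|y - x| <= dl -> `|g' y - g' x| <= e) ->
  `|z - y| <= `|x| -> `|g' z - g' y| <= modulus e b dl y x.
Proof.
move=> e0 b0 dl0 H zy; rewrite /modulus.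
have big : `|g' z - g' y| <= 2 * C.
  by apply: le_trans (ler_normB _ _) _; have := g'_le z; have := g'_le y; lra.
have t1 : 0 <= 2 * C / b ^+ 2 * y ^+ 2.
  by rewrite mulr_ge0 ?sqr_ge0// divr_ge0 ?sqr_ge0// mulr_ge0.
have t2 : 0 <= 2 * C * far dl x by rewrite mulr_ge0 ?mulr_ge0//; case/andP: (far01 dl x).
have [yb|yb] := leP `|y| b; last first.
  have : 2 * C <= 2 * C / b ^+ 2 * y ^+ 2.
    rewrite -mulrA ler_peMr ?mulr_ge0// mulrC ler_pdivlMr ?exprn_gt0// mul1r.
    by rewrite -[leRHS]real_normK ?num_real// lerXn2r ?nnegrE// ltW.
  lra.
have [xd|xd] := leP `|x| dl.
  by have := H y z yb (le_trans zy xd); lra.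
by rewrite /far xd mulr1 in t2 *; lra.
Qed.

Let taylor e b dl y x : 0 < e -> 0 < b -> 0 < dl ->
  (forall x y, `|x| <= b -> `|y - x| <= dl -> `|g' y - g' x| <= e) ->
  `|x * g (y + x) - x * g y - x ^+ 2 * g' y| <= x ^+ 2 * modulus e b dl y x.
Proof.
move=> e0 b0 dl0 H.
have [c cin E] : exists2 c, `|c - y| <= `|x| & g (y + x) - g y = g' c * x.
  have [x0|x0] := leP 0 x.
    have yx : y <= y + x by rewrite lerDl.
    have [c] := MVT_segment yx (fun z _ => g_derive z) (continuous_subspaceT g_cont).
    rewrite in_itv/= => /andP[c1 c2] ->; exists c; last by congr (_ * _); ring.
    by rewrite !ger0_norm//; lra.
  have yx : y + x <= y by lra.
  have [c] := MVT_segment yx (fun z _ => g_derive z) (continuous_subspaceT g_cont).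
  rewrite in_itv/= => /andP[c1 c2] E; exists c; last first.
    by rewrite -opprB E; ring.
  by rewrite (ltr0_norm x0) ler0_norm; lra.
rewrite (_ : _ - _ = x ^+ 2 * (g' c - g' y)); last first.
  by rewrite -mulrBr E; ring.
rewrite normrM (ger0_norm (sqr_ge0 x)) ler_wpM2l ?sqr_ge0//.
exact: modulus_bound.
Qed.

(** One summand [W] against the sum [B] of the others. In the expansion of [W g(B + W)] around [B],
    independence and centring kill [W g(B)] and factor [W^2 g'(B)]. Returning from [g'(B)] to
    [g'(B + W)] costs a second oscillation, hence the factors 2 and 4. *)
Lemma stein_step (W B : Omega -> R) (e b dl : R) :
  0 < e -> 0 < b -> 0 < dl ->
  (forall x y, `|x| <= b -> `|y - x| <= dl -> `|g' y - g' x| <= e) ->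
  intg W -> Ex W = 0 -> intg (fun w => W w ^+ 2) -> intg (fun w => B w ^+ 2) ->
  measurable_fun setT B -> indep_rv P W B ->
  `|Ex (fun w => W w * g (B w + W w)) - Ex (fun w => W w ^+ 2) * Ex (fun w => g' (B w + W w))|
   <= Ex (fun w => W w ^+ 2) * (2 * e + 4 * C / b ^+ 2 * Ex (fun w => B w ^+ 2)
        + 2 * C * Ex (fun w => far dl (W w))) + 2 * C * Ex (fun w => W w ^+ 2 * far dl (W w)).
Proof.
move=> e0 b0 dl0 H iW EW iW2 iB2 mB WB.
have mW := intg_measurable iW.
have mg : measurable_fun setT g by exact: continuous_measurable_fun.
have mg' : measurable_fun setT g' by exact: continuous_measurable_fun.
have mBW : measurable_fun setT (fun w => B w + W w) by exact: measurable_funD.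
have igW : intg (fun w => W w * g (B w + W w)).
  by apply: (@intg_mul_bounded _ _ _ _ _ _ C) => //; exact: measurableT_comp.
have igB : intg (fun w => W w * g (B w)).
  by apply: (@intg_mul_bounded _ _ _ _ _ _ C) => //; exact: measurableT_comp.
have ig' U : measurable_fun setT U -> intg (fun w => g' (U w)).
  by move=> mU; apply: (@intg_bounded _ _ _ _ _ C) => //; exact: measurableT_comp.
have ig2 : intg (fun w => W w ^+ 2 * g' (B w)).
  by apply: (@intg_mul_bounded _ _ _ _ _ _ C) => //; exact: measurableT_comp.
have indep_comp (f h : R -> R) : measurable_fun setT f -> measurable_fun setT h ->
    indep_rv P (fun w => f (W w)) (fun w => h (B w)).
  move=> mf mh X Y mX mY; apply: (WB (f @^-1` X) (h @^-1` Y)).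
    by rewrite -[X in measurable X]setTI; exact: mf.
  by rewrite -[X in measurable X]setTI; exact: mh.
have msq : measurable_fun setT (fun x : R => x ^+ 2) by exact: exprn_measurable.
have igBb : intg (fun w => g (B w)).
  by apply: (@intg_bounded _ _ _ _ _ C) => //; exact: measurableT_comp.
have [_ E1] := Ex_mul_indep iW igBb (indep_comp id g (@measurable_id _ _ _) mg).
have [_ E2] := Ex_mul_indep iW2 (ig' _ mB) (indep_comp (fun x => x ^+ 2) g' msq mg').
have ifar : intg (fun w => far dl (W w)).
  apply: (@intg_bounded _ _ _ _ _ 1); first exact: measurableT_comp (measurable_far dl) mW.
  by move=> w; rewrite ger0_norm; case/andP: (far01 dl (W w)).
have iW2far : intg (fun w => W w ^+ 2 * far dl (W w)).
  apply: (@intg_mul_bounded _ _ _ _ _ _ 1) => //; first exact: measurableT_comp (measurable_far dl) mW.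
  by move=> w; rewrite ger0_norm; case/andP: (far01 dl (W w)).
have [iWB EWB] := Ex_mul_indep iW2 iB2 (indep_comp _ _ msq msq).
pose t := Ex (fun w => W w ^+ 2).
have t0 : 0 <= t by apply: Ex_ge0 => w; exact: sqr_ge0.
have -> : Ex (fun w => W w * g (B w + W w)) - t * Ex (fun w => g' (B w + W w)) =
   Ex (fun w => W w * g (B w + W w) - W w * g (B w) - W w ^+ 2 * g' (B w)) -
   t * Ex (fun w => g' (B w + W w) - g' (B w)).
  have -> := ExB (intgB igW igB) ig2; have -> := ExB igW igB.
  have -> := ExB (ig' _ mBW) (ig' _ mB).
  by rewrite E1 E2 EW -/t; ring.
apply: le_trans (ler_normB _ _) _.
have i1 : intg (fun w => W w * g (B w + W w) - W w * g (B w) - W w ^+ 2 * g' (B w)).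
  by apply: intgB => //; exact: intgB.
have i2 : intg (fun w => g' (B w + W w) - g' (B w)) by apply: intgB; exact: ig'.
have iM1 : intg (fun w => W w ^+ 2 * modulus e b dl (B w) (W w)).
  rewrite (_ : (fun w => _) = fun w => e * W w ^+ 2 + 2 * C / b ^+ 2 * (W w ^+ 2 * B w ^+ 2) +
      2 * C * (W w ^+ 2 * far dl (W w))); last by apply/funext => w; rewrite /modulus; ring.
  by apply: intgD; [apply: intgD; exact: intgZ|exact: intgZ].
have iM2 : intg (fun w => modulus e b dl (B w) (W w)).
  by apply: intgD; [apply: intgD; [exact: intg_cst|exact: intgZ]|exact: intgZ].
have b1 : `|Ex (fun w => W w * g (B w + W w) - W w * g (B w) - W w ^+ 2 * g' (B w))| <=
    e * t + 2 * C / b ^+ 2 * (t * Ex (fun w => B w ^+ 2)) + 2 * C * Ex (fun w => W w ^+ 2 * far dl (W w)).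
  apply: le_trans (ler_norm_Ex i1) _.
  apply: (@le_trans _ _ (Ex (fun w => W w ^+ 2 * modulus e b dl (B w) (W w)))).
    by apply: ler_Ex => //; [exact: intg_norm|move=> w; exact: taylor].
  rewrite (_ : (fun w => _) = fun w => e * W w ^+ 2 + 2 * C / b ^+ 2 * (W w ^+ 2 * B w ^+ 2) +
      2 * C * (W w ^+ 2 * far dl (W w))); last by apply/funext => w; rewrite /modulus; ring.
  rewrite ExD; [|by apply: intgD; exact: intgZ|exact: intgZ].
  rewrite ExD; [|exact: intgZ|exact: intgZ].
  by rewrite !ExZ// EWB.
have b2 : `|Ex (fun w => g' (B w + W w) - g' (B w))| <=
    e + 2 * C / b ^+ 2 * Ex (fun w => B w ^+ 2) + 2 * C * Ex (fun w => far dl (W w)).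
  apply: le_trans (ler_norm_Ex i2) _.
  apply: (@le_trans _ _ (Ex (fun w => modulus e b dl (B w) (W w)))).
    apply: ler_Ex => //; first exact: intg_norm.
    by move=> w; apply: modulus_bound => //; rewrite addrAC subrr add0r.
  rewrite /modulus ExD; [|by apply: intgD; [exact: intg_cst|exact: intgZ]|exact: intgZ].
  rewrite ExD; [|exact: intg_cst|exact: intgZ].
  by rewrite Ex_cst !ExZ.
rewrite normrM (ger0_norm t0).
apply: le_trans (lerD b1 (ler_wpM2l t0 b2)) _.
rewrite le_eqVlt; apply/orP; left; apply/eqP; rewrite -/t.
by field; rewrite gt_eqF.
Qed.

End stein_step.

End limit_theorems.

Section limit_theorems.
Context d (Omega : measurableType d) (R : realType) (P : probability Omega R).

(** Stein's equation writes the difference of the means of [f] as [v E g'(A) - E A g(A)], a sum of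
    [J] differences to which [stein_step] applies with [B] the sum without the [j]-th term. Each is
    at most [K], and the constants make [J * K] at most [eta]. *)
Theorem central_limit (Z : nat -> Omega -> R) (v : R) : iid_rv P Z ->
  intg P (Z 0) -> Ex P (Z 0) = 0 -> intg P (fun w => Z 0 w ^+ 2) ->
  Ex P (fun w => Z 0 w ^+ 2) = v -> 0 < v ->
  cvg_in_distribution P (fun J w => (Num.sqrt J%:R)^-1 * \sum_(j < J) Z j w)
    (normal_prob 0 (Num.sqrt v)).
Proof.
move=> iZ i0 E0 i2 Ev v0 f cf [M fM].
have mZ j : measurable_fun setT (Z j) by have [] := iZ.
have [g [g' [C [dg cg' gC g'C gE]]]] := stein_solution v0 cf fM.
have C0 : 0 <= C by exact: le_trans (normr_ge0 _) (gC 0).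
set A := fun J w => (Num.sqrt J%:R)^-1 * \sum_(j < J) Z j w.
have mA J : measurable_fun setT (A J).
  by apply: measurable_funM => //; apply: measurable_sum => j; exact: mZ.
have mf : measurable_fun setT f by exact: continuous_measurable_fun.
have mg : measurable_fun setT g.
  by apply: continuous_measurable_fun => y; apply: differentiable_continuous; apply/derivable1_diffP; case: (dg y).
have mg' : measurable_fun setT g' by exact: continuous_measurable_fun.
have ifA J : intg P (fun w => f (A J w)).
  by apply: (@intg_bounded _ _ _ _ _ M) => //; exact: measurableT_comp.
rewrite (_ : (fun J => _) = fun J => (Ex P (fun w => f (A J w)))%:E); last first.
  by apply/funext => J; exact: (integral_Ex (ifA J)).
have ifN : intg (normal_prob 0 (Num.sqrt v)) f := @intg_bounded _ _ _ (normal_prob 0 (Num.sqrt v)) f M mf fM.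
rewrite (integral_normal_prob cf fM erefl).
apply: cvg_EFin; first exact: nearW.
apply/cvgrPdist_le => eta eta0.
(* Lindeberg's truncated second moment; identical distribution reduces it to [Z 0], and dominated
   convergence sends it to 0. *)
pose L dl J := Ex P (fun w => Z 0 w ^+ 2 * (dl < `|(Num.sqrt J%:R)^-1 * Z 0 w|)%R%:R).
have L0 dl : 0 < dl -> L dl J @[J --> \oo] --> 0.
  move=> dl0; rewrite -(Ex_cst P 0).
  have mI J : measurable_fun setT (fun w => (dl < `|(Num.sqrt J%:R)^-1 * Z 0 w|)%R%:R : R).
    rewrite (_ : (fun w => _) = \1_[set w | dl < `|(Num.sqrt J%:R)^-1 * Z 0 w|]).
      by apply: measurable_indic; apply: measurable_gt_norm; exact: measurable_funM.
    apply/funext => x; rewrite indicE; congr (_%:R); congr nat_of_bool.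
    by apply/idP/idP; rewrite inE.
  have [||||//] := @cvg_Ex_dominated _ _ _ P
    (fun J w => Z 0 w ^+ 2 * (dl < `|(Num.sqrt J%:R)^-1 * Z 0 w|)%R%:R) (cst 0) (fun w => Z 0 w ^+ 2).
  - by move=> J; apply: measurable_funM => //; exact: intg_measurable i2.
  - exact: i2.
  - move=> w; apply: cvg_near_cst; near=> J.
    have hJ : (`|Z 0 w| / dl) ^+ 2 < J%:R by near: J; exact: nbhs_infty_gtr.
    have J0 : 0 < J%:R :> R by apply: le_lt_trans hJ; exact: sqr_ge0.
    have sJ : 0 < Num.sqrt (J%:R : R) by rewrite sqrtr_gt0.
    have : `|Z 0 w| / dl <= Num.sqrt (J%:R : R).
      rewrite -(@ler_pXn2r _ 2)// ?nnegrE ?divr_ge0 ?(ltW dl0) ?(ltW sJ)//.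
      by rewrite sqr_sqrtr ltW.
    rewrite ler_pdivrMr// => h.
    have -> : (dl < `|(Num.sqrt J%:R)^-1 * Z 0 w|)%R = false.
      by apply/negbTE; rewrite -leNgt normrM gtr0_norm ?invr_gt0// ler_pdivrMl.
    by rewrite /= mulr0.
  - move=> J w; rewrite ger0_norm; first by case: (_ < _)%R; rewrite ?mulr1 ?mulr0 ?sqr_ge0.
    by rewrite mulr_ge0 ?sqr_ge0.
(* Chosen so that the first two of the four terms of [J * K] are at most [eta / 4]; the other two
   are small for large [J]. *)
pose e := eta / (8 * v); pose b := 1 + 16 * C * v ^+ 2 / eta.
have e0 : 0 < e by rewrite divr_gt0 ?mulr_gt0.
have b1 : 1 <= b by rewrite lerDl divr_ge0 ?mulr_ge0 ?sqr_ge0// ltW.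
have b0 : 0 < b by exact: lt_le_trans b1.
have [dl dl0 H] := uniform_continuity_segment b cg' e0.
have eta8 : 0 < eta / (8 * (C + 1)) by rewrite divr_gt0// mulr_gt0// ltr_wpDl.
have /cvgrPdist_lt /(_ _ eta8) HL := L0 _ dl0.
near=> J.
have J1 : (0 < J)%N by near: J; exact: nbhs_infty_gt.
have J0 : 0 < J%:R :> R by rewrite ltr0n.
have hJ : 8 * C * v ^+ 2 / (dl ^+ 2 * eta) < J%:R by near: J; exact: nbhs_infty_gtr.
have LJ : L dl J < eta / (8 * (C + 1)).
  have : `|0 - L dl J| < eta / (8 * (C + 1)) by near: J; exact: HL.
  by rewrite sub0r normrN; apply: le_lt_trans; exact: ler_norm.
have L_ge0 : 0 <= L dl J.
  by apply: Ex_ge0 => w; rewrite mulr_ge0 ?sqr_ge0.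
pose r := (Num.sqrt J%:R : R)^-1.
have r2 : r ^+ 2 = J%:R^-1 by rewrite /r exprVn sqr_sqrtr// ltW.
pose W j w := r * Z j w.
have iW : iid_rv P W.
  have mr : measurable_fun setT (fun x : R => r * x) by exact: mulrl_measurable.
  exact: (iid_rv_comp iZ mr).
have iW0 : intg P (W 0) by exact: intgZ.
have EW0 : Ex P (W 0) = 0 by rewrite ExZ// E0 mulr0.
have iW2 : intg P (fun w => W 0 w ^+ 2).
  rewrite (_ : (fun w => _) = fun w => r ^+ 2 * Z 0 w ^+ 2); first exact: intgZ.
  by apply/funext => w; rewrite exprMn.
pose tau := v / J%:R.
have tau0 : 0 <= tau by rewrite divr_ge0// ltW.
have EW2 : Ex P (fun w => W 0 w ^+ 2) = tau.
  rewrite (_ : (fun w => _) = fun w => r ^+ 2 * Z 0 w ^+ 2).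
    by rewrite ExZ// Ev r2 mulrC.
  by apply/funext => w; rewrite exprMn.
have AE w : A J w = \sum_(i <- iota 0 J) W i w.
  rewrite (_ : iota 0 J = index_iota 0 J) ?big_mkord; last by rewrite /index_iota subn0.
  by rewrite /A mulr_sumr.
pose far w : R := (dl < `|W 0 w|)%R%:R.
have mfarx : measurable_fun setT (fun x : R => (dl < `|x|)%R%:R : R).
  rewrite (_ : (fun w => _) = \1_[set x : R | dl < `|x|]).
    apply: measurable_indic.
    rewrite (_ : [set x | _] = (fun x : R => `|x|) @^-1` `]dl, +oo[); last first.
      by apply/seteqP; split=> w /=; rewrite in_itv/= andbT.
    by rewrite -[X in measurable X]setTI; exact: normr_measurable.
  apply/funext => x; rewrite indicE; congr (_%:R); congr nat_of_bool.
  by apply/idP/idP; rewrite inE.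
have ifar : intg P far.
  apply: (@intg_bounded _ _ _ _ _ 1); first exact: measurableT_comp mfarx (intg_measurable iW0).
  by move=> w; rewrite /far; case: (_ < _)%R; rewrite ?normr1 ?normr0.
have iW2far : intg P (fun w => W 0 w ^+ 2 * far w).
  apply: (@intg_mul_bounded _ _ _ _ _ _ 1) => //; first exact: intg_measurable ifar.
  by move=> w; rewrite /far; case: (_ < _)%R; rewrite ?normr1 ?normr0.
have Efar : Ex P far <= tau / dl ^+ 2.
  rewrite -EW2 mulrC -ExZ//; apply: ler_Ex => //; first exact: intgZ.
  move=> w; rewrite /far; case: (ltP dl `|W 0 w|) => [h|_]; last by rewrite mulr_ge0 ?invr_ge0 ?sqr_ge0.
  rewrite mulrC ler_pdivlMr ?exprn_gt0// mul1r -[leRHS]real_normK ?num_real//.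
  by rewrite lerXn2r ?nnegrE// ltW.
have EW2far : Ex P (fun w => W 0 w ^+ 2 * far w) = L dl J / J%:R.
  rewrite /L mulrC -r2 -ExZ; first by apply: eq_Ex => w; rewrite /far /W exprMn mulrA.
  rewrite (_ : (fun w => _) = fun w => J%:R * (W 0 w ^+ 2 * far w)); first exact: intgZ.
  by apply/funext => w; rewrite /far /W exprMn r2 !mulrA divff ?mul1r// gt_eqF.
have igA j : intg P (fun w => W j w * g (A J w)).
  apply: (@intg_mul_bounded _ _ _ _ _ _ C) => //; last exact: measurableT_comp.
  exact: (iid_rv_intg iW j iW0).1.
have ig'A : intg P (fun w => g' (A J w)).
  by apply: (@intg_bounded _ _ _ _ _ C) => //; exact: measurableT_comp.
pose K := tau * (2 * e + 4 * C / b ^+ 2 * v + 2 * C * (tau / dl ^+ 2)) + 2 * C * (L dl J / J%:R).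
have step j : j \in iota 0 J ->
    `|Ex P (fun w => W j w * g (A J w)) - tau * Ex P (fun w => g' (A J w))| <= K.
  move=> jJ; pose s := rem j (iota 0 J); pose B w := \sum_(i <- s) W i w.
  have us : uniq s by rewrite rem_uniq// iota_uniq.
  have js : j \notin s by rewrite mem_rem_uniq ?iota_uniq// inE eqxx.
  have AB w : A J w = B w + W j w by rewrite AE (big_rem j jJ)/= addrC.
  have [ij Ej] := iid_rv_intg iW j iW0.
  have [ij2 Ej2] := iid_rv_Ex j iW (@exprn_measurable R setT 2) iW2.
  have [iB2 EB2] := Ex_sqr_sum iW us iW2 iW0 EW0.
  have mB : measurable_fun setT B.
    by apply: measurable_sum => i; exact: intg_measurable (iid_rv_intg iW i iW0).1.
  have [_ Ejf] := iid_rv_Ex j iW mfarx ifar.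
  have mx2 : measurable_fun setT (fun x : R => x ^+ 2 * (dl < `|x|)%R%:R).
    by apply: measurable_funM => //; exact: exprn_measurable.
  have [_ Ejf2] := iid_rv_Ex j iW mx2 iW2far.
  have := stein_step dg cg' gC g'C e0 b0 dl0 H ij (etrans Ej EW0) ij2 iB2 mB (iid_rv_indep_sum iW us js).
  rewrite Ej2 Ejf Ejf2 EW2 -/far EW2far EB2 EW2.
  under [X in `|X - _|]eq_Ex do rewrite -AB.
  under [X in `|_ - _ * X|]eq_Ex do rewrite -AB.
  move=> h; apply: le_trans h _; rewrite /K lerD2r ler_wpM2l// -!addrA lerD2l.
  apply: lerD.
    have k0 : 0 <= 4 * C / b ^+ 2 by rewrite divr_ge0 ?sqr_ge0// mulr_ge0.
    apply: (ler_wpM2l k0).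
    rewrite /tau mulrC -mulrA ler_piMr ?(ltW v0)// mulrC ler_pdivrMr// mul1r ler_nat.
    by rewrite size_rem// size_iota leq_pred.
  by rewrite ler_wpM2l ?mulr_ge0.
have EfA : Ex P (fun w => f (A J w)) - Ex (normal_prob 0 (Num.sqrt v)) f =
    v * Ex P (fun w => g' (A J w)) - \sum_(j <- iota 0 J) Ex P (fun w => W j w * g (A J w)).
  rewrite -Ex_sum// -ExZ// -ExB//; last by apply: intg_sum.
    rewrite -[X in _ - X](Ex_cst P) -ExB//; last exact: intg_cst.
    by apply: eq_Ex => w; rewrite -mulr_suml -AE gE.
  exact: intgZ.
rewrite distrC EfA (_ : v * _ - _ =
   \sum_(j <- iota 0 J) (tau * Ex P (fun w => g' (A J w)) - Ex P (fun w => W j w * g (A J w)))); last first.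
  rewrite big_split/= sumrN; congr (_ - _).
  rewrite big_const_seq count_predT size_iota iter_addr_0 -mulr_natl /tau.
  by rewrite mulrA mulrCA divff ?gt_eqF// mulr1.
apply: le_trans (ler_norm_sum _ _ _) _.
apply: (@le_trans _ _ (\sum_(j <- iota 0 J) K)).
  by rewrite big_seq [leRHS]big_seq; apply: ler_sum => j jJ; rewrite distrC; exact: step.
rewrite big_const_seq count_predT size_iota iter_addr_0 -mulr_natl.
rewrite (_ : J%:R * K = 2 * (v * e) + 4 * C * v ^+ 2 / b ^+ 2 + 2 * C * v ^+ 2 / (J%:R * dl ^+ 2) + 2 * (C * L dl J)); last first.
  by rewrite /K /tau; field; rewrite !gt_eqF.
have t1 : 2 * (v * e) = eta / 4 by rewrite /e; field; rewrite gt_eqF.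
have t2 : 4 * C * v ^+ 2 / b ^+ 2 <= eta / 4.
  rewrite ler_pdivrMr ?exprn_gt0//.
  apply: (@le_trans _ _ (eta / 4 * b)); last first.
    by rewrite ler_wpM2l ?divr_ge0 ?(ltW eta0)// expr2 ler_peMr ?(ltW b0).
  rewrite (_ : eta / 4 * b = eta / 4 + 4 * C * v ^+ 2); last by rewrite /b; field; rewrite gt_eqF.
  by rewrite lerDr divr_ge0 ?(ltW eta0).
have t3 : 2 * C * v ^+ 2 / (J%:R * dl ^+ 2) <= eta / 4.
  rewrite ler_pdivrMr ?mulr_gt0 ?exprn_gt0//.
  rewrite (_ : 2 * C * v ^+ 2 = (8 * C * v ^+ 2 / (dl ^+ 2 * eta)) * (eta / 4 * dl ^+ 2)); last first.
    by field; rewrite !gt_eqF.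
  rewrite (_ : eta / 4 * (J%:R * dl ^+ 2) = J%:R * (eta / 4 * dl ^+ 2)); last by ring.
  apply: ler_wpM2r (ltW hJ).
  by rewrite mulr_ge0 ?sqr_ge0// divr_ge0// ltW.
have t4 : 2 * (C * L dl J) <= eta / 4.
  have : C * L dl J <= (C + 1) * (eta / (8 * (C + 1))).
    by apply: ler_pM => //; [lra|exact: ltW].
  rewrite (_ : (C + 1) * _ = eta / 8); first lra.
  by field; rewrite gt_eqF// ltr_wpDl.
by rewrite t1; lra.
Unshelve. all: by end_near. Qed.

(** Bounded second moments supply the tightness of [A]: the event [|A| > b] is charged to
    [A^2 / b^2], and on [[-b, b]] uniform continuity of [f] applies. *)
Lemma slutsky (X A : nat -> Omega -> R) (mu : set R -> \bar R) (t : R) :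
  (forall J, measurable_fun setT (X J)) -> (forall J, measurable_fun setT (A J)) ->
  (forall J, intg P (fun w => A J w ^+ 2) /\ Ex P (fun w => A J w ^+ 2) <= t) ->
  (forall e, 0 < e -> vanishing P (fun J => [set w | e < `|X J w - A J w|])) ->
  cvg_in_distribution P A mu -> cvg_in_distribution P X mu.
Proof.
move=> mX mA A2 XA Acvg f cf bf; have [M fM] := bf.
have := Acvg f cf bf.
have mf : measurable_fun setT f by exact: continuous_measurable_fun.
have M0 : 0 <= M by exact: le_trans (normr_ge0 _) (fM 0).
have t0 : 0 <= t.
  by apply: le_trans (A2 0%N).2; apply: Ex_ge0 => w; exact: sqr_ge0.
have ifU U : measurable_fun setT U -> intg P (fun w => f (U w)).
  by move=> mU; apply: (@intg_bounded _ _ _ _ _ M) => //; exact: measurableT_comp.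
have E1 : (fun J => (\int[P]_w (f (A J w))%:E)%E) = fun J => (Ex P (fun w => f (A J w)))%:E.
  by apply/funext => J; rewrite integral_Ex//; exact: ifU.
have E2 : (fun J => (\int[P]_w (f (X J w))%:E)%E) =
    fun J => ((Ex P (fun w => f (A J w)))%:E + (Ex P (fun w => f (X J w) - f (A J w)))%:E)%E.
  apply/funext => J; rewrite integral_Ex; last exact: ifU.
  by rewrite -EFinD ExB; [congr EFin; ring|exact: ifU|exact: ifU].
rewrite E1 E2 => c1; rewrite -[X in _ --> X]adde0.
apply: cvgeD => //.
  by rewrite fin_num_adde_defl.
apply: cvg_EFin; first exact: nearW.
apply/cvgrPdist_le => e e0.
pose b := 1 + 8 * M * t / e.
have b1 : 1 <= b by rewrite lerDl divr_ge0 ?mulr_ge0// ltW.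
have b0 : 0 < b by exact: lt_le_trans b1.
have e4 : 0 < e / 4 by rewrite divr_gt0.
have [dl dl0 H] := uniform_continuity_segment b cf e4.
have e8 : 0 < e / (8 * (M + 1)) by rewrite divr_gt0// mulr_gt0// ltr_wpDl.
have [mv vv] := XA _ dl0; have [N NJ] := vv _ e8.
near=> J; rewrite /= sub0r normrN.
have JN : (N <= J)%N by near: J; exact: nbhs_infty_ge.
have [iA2 EA2] := A2 J.
have iD : intg P (fun w => f (X J w) - f (A J w)) by apply: intgB; exact: ifU.
apply: le_trans (ler_norm_Ex iD) _.
set S := [set w | dl < `|X J w - A J w|].
have mS : measurable S := mv J.
apply: (@le_trans _ _ (Ex P (fun w => (e / 4 + 2 * M / b ^+ 2 * A J w ^+ 2) + 2 * M * \1_S w))).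
  apply: ler_Ex; first exact: intg_norm.
    apply: intgD; last by apply: intgZ; exact: intg_indic.
    by apply: intgD; [exact: intg_cst|exact: intgZ].
  move=> w.
  have big : `|f (X J w) - f (A J w)| <= 2 * M.
    by apply: le_trans (ler_normB _ _) _; have := fM (X J w); have := fM (A J w); lra.
  have p1 : 0 <= 2 * M / b ^+ 2 * A J w ^+ 2.
    by rewrite mulr_ge0 ?sqr_ge0// divr_ge0 ?sqr_ge0// mulr_ge0.
  have p2 : 0 <= 2 * M * \1_S w by rewrite !mulr_ge0.
  have [xd|xd] := leP `|X J w - A J w| dl; last first.
    have -> : \1_S w = 1 :> R by rewrite indicE mem_set.
    by rewrite mulr1; lra.
  have [ab|ab] := leP `|A J w| b.
    by have := H _ _ ab xd; lra.
  have : 2 * M <= 2 * M / b ^+ 2 * A J w ^+ 2.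
    rewrite -mulrA ler_peMr ?mulr_ge0// mulrC ler_pdivlMr ?exprn_gt0// mul1r.
    by rewrite -[leRHS]real_normK ?num_real// lerXn2r ?nnegrE// ltW.
  lra.
rewrite ExD; [|by apply: intgD; [exact: intg_cst|exact: intgZ]|by apply: intgZ; exact: intg_indic].
rewrite ExD; [|exact: intg_cst|exact: intgZ].
rewrite Ex_cst !ExZ//; last exact: intg_indic.
rewrite Ex_indic//.
have t2 : 2 * M / b ^+ 2 * Ex P (fun w => A J w ^+ 2) <= e / 4.
  apply: (@le_trans _ _ (2 * M / b ^+ 2 * t)).
    have k0 : 0 <= 2 * M / b ^+ 2 by rewrite divr_ge0 ?sqr_ge0// mulr_ge0.
    exact: ler_wpM2l k0 _ _ EA2.
  rewrite mulrAC ler_pdivrMr ?exprn_gt0//.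
  apply: (@le_trans _ _ (e / 4 * b)); last first.
    by rewrite ler_wpM2l ?divr_ge0 ?(ltW e0)// expr2 ler_peMr ?(ltW b0).
  rewrite (_ : e / 4 * b = e / 4 + 2 * M * t); last by rewrite /b; field; rewrite gt_eqF.
  by rewrite lerDr divr_ge0 ?(ltW e0).
have t3 : fine (P S) <= e / (8 * (M + 1)).
  by rewrite -lee_fin fineK ?fin_num_measure//; exact: NJ.
have t4 : M * fine (P S) <= (M + 1) * (e / (8 * (M + 1))).
  by apply: ler_pM => //; [exact: fine_ge0|lra].
rewrite (_ : (M + 1) * _ = e / 8) in t4; first lra.
by field; rewrite gt_eqF// ltr_wpDl.
Unshelve. all: by end_near. Qed.

End limit_theorems.

(** * Minimisation of quadratic forms *)

Section matrix_norm_bounds.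
Context (R : realType).

Lemma ler_entry_norm m n (A : 'M[R]_(m, n)) i j : `|A i j| <= `|A|.
Proof.
have -> : `|A| = mx_norm A by [].
by rewrite mx_normrE; exact: (le_bigmax _ (fun k : 'I_m * 'I_n => `|A k.1 k.2|) (i, j)).
Qed.

Lemma ler_norm_entries m n (A : 'M[R]_(m, n)) c : 0 <= c ->
  (forall i j, `|A i j| <= c) -> `|A| <= c.
Proof.
move=> c0 Ac; have -> : `|A| = mx_norm A by [].
by rewrite mx_normrE; apply: bigmax_le => // k _.
Qed.

Lemma ler_norm_mulmx m n p (A : 'M[R]_(m, n)) (B : 'M[R]_(n, p)) :
  `|A *m B| <= n%:R * `|A| * `|B|.
Proof.
apply: ler_norm_entries => [|i j]; first by rewrite !mulr_ge0.
rewrite mxE; apply: le_trans (ler_norm_sum _ _ _) _.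
apply: (@le_trans _ _ (\sum_(k < n) `|A| * `|B|)).
  by apply: ler_sum => k _; rewrite normrM ler_pM// ler_entry_norm.
by rewrite sumr_const card_ord -[_ *+ n]mulr_natl mulrA.
Qed.

Lemma norm_trmx m n (A : 'M[R]_(m, n)) : `|A^T| = `|A|.
Proof.
apply/eqP; rewrite eq_le; apply/andP; split; apply: ler_norm_entries => // i j.
  by rewrite mxE ler_entry_norm.
by have := ler_entry_norm A^T j i; rewrite mxE.
Qed.

Lemma unitmx_of_inj n (A : 'M[R]_n) :
  (forall x : 'cV_n, A *m x = 0 -> x = 0) -> A \in unitmx.
Proof.
move=> Ainj; rewrite -unitmx_tr -row_free_unit -kermx_eq0.
apply/eqP/row_matrixP => i; rewrite row0; apply: trmx_inj; rewrite trmx0.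
apply: Ainj; apply: trmx_inj; rewrite trmx_mul trmxK trmx0.
by rewrite -row_mul mulmx_ker row0.
Qed.

Definition bilin n (A : 'M[R]_n) (x y : 'cV[R]_n) : R := (x^T *m A *m y) 0 0.

Lemma bilinDl n (A : 'M[R]_n) x y z : bilin A (x + y) z = bilin A x z + bilin A y z.
Proof. by rewrite /bilin linearD/= !mulmxDl mxE. Qed.

Lemma bilinDr n (A : 'M[R]_n) x y z : bilin A x (y + z) = bilin A x y + bilin A x z.
Proof. by rewrite /bilin mulmxDr mxE. Qed.

Lemma bilinZl n (A : 'M[R]_n) c x z : bilin A (c *: x) z = c * bilin A x z.
Proof. by rewrite /bilin linearZ/= -!scalemxAl mxE. Qed.

Lemma bilinZr n (A : 'M[R]_n) c x z : bilin A x (c *: z) = c * bilin A x z.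
Proof. by rewrite /bilin -scalemxAr mxE. Qed.

Lemma bilinBA n (A B : 'M[R]_n) x y : bilin (A - B) x y = bilin A x y - bilin B x y.
Proof. by rewrite /bilin mulmxBr mulmxBl !mxE. Qed.

Lemma bilinC n (A : 'M[R]_n) x y : A^T = A -> bilin A x y = bilin A y x.
Proof.
move=> As; rewrite /bilin -[in LHS](trmxK (x^T *m A *m y)) mxE.
by rewrite !trmx_mul trmxK As mulmxA.
Qed.

Lemma ler_norm_bilin n (A : 'M[R]_n) x y :
  `|bilin A x y| <= n%:R ^+ 2 * `|A| * `|x| * `|y|.
Proof.
apply: le_trans (ler_entry_norm _ _ _) _; apply: le_trans (ler_norm_mulmx _ _) _.
have := ler_norm_mulmx x^T A; rewrite norm_trmx => h.
apply: (@le_trans _ _ (n%:R * (n%:R * `|x| * `|A|) * `|y|)).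
  by rewrite ler_wpM2r// ler_wpM2l.
by rewrite le_eqVlt; apply/orP; left; apply/eqP; ring.
Qed.

Lemma sqr_norm_le_dot n (x : 'cV[R]_n) : `|x| ^+ 2 <= (x^T *m x) 0 0.
Proof.
have E : (x^T *m x) 0 0 = \sum_i x i 0 ^+ 2.
  by rewrite mxE; apply: eq_bigr => i _; rewrite mxE expr2.
have s0 : 0 <= (x^T *m x) 0 0 by rewrite E sumr_ge0// => i _; exact: sqr_ge0.
rewrite -[leRHS](sqr_sqrtr s0) lerXn2r ?nnegrE ?sqrtr_ge0//.
apply: ler_norm_entries => [|i j]; first exact: sqrtr_ge0.
rewrite (ord1 j) -(@ler_pXn2r _ 2)// ?nnegrE ?sqrtr_ge0// sqr_sqrtr// real_normK ?num_real//.
by rewrite E (bigD1 i)//= lerDl sumr_ge0// => k _; exact: sqr_ge0.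
Qed.

(** [V] is only semidefinite. When [bilin V y y = 0], the polynomial in [t] is affine, and its
    non-negativity forces the cross term to vanish. *)
Lemma bilin_cauchy_schwarz n (V : 'M[R]_n) : V^T = V ->
  (forall x, 0 <= bilin V x x) ->
  forall x y, bilin V x y ^+ 2 <= bilin V x x * bilin V y y.
Proof.
move=> Vs V0 x y.
have Q t : 0 <= bilin V x x + 2 * t * bilin V x y + t ^+ 2 * bilin V y y.
  have := V0 (x + t *: y).
  rewrite bilinDl !bilinDr !bilinZl !bilinZr (bilinC y x Vs).
  rewrite [X in 0 <= X -> _](_ : _ = bilin V x x + 2 * t * bilin V x y + t ^+ 2 * bilin V y y)//.
  by ring.
have [yy|yy] := eqVneq (bilin V y y) 0.
  rewrite yy mulr0; have [->|xy] := eqVneq (bilin V x y) 0; first by rewrite expr0n.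
  (* At this [t] the affine polynomial would equal -1. *)
  have := Q (- (bilin V x x + 1) / (2 * bilin V x y)).
  rewrite yy mulr0 addr0 (_ : 2 * _ * _ = - (bilin V x x + 1)); first lra.
  by field.
have y0 : 0 < bilin V y y by rewrite lt_neqAle eq_sym yy V0.
have := Q (- bilin V x y / bilin V y y).
rewrite (_ : _ + _ + _ = bilin V x x - bilin V x y ^+ 2 / bilin V y y); last by field.
by rewrite subr_ge0 ler_pdivrMr.
Qed.

End matrix_norm_bounds.

(** A perturbation below the second threshold absorbs at most half of the coercivity, whence the
    doubled constant; the upper bound uses only [|U - W| <= 1]. *)
Lemma bilin_perturbation (R : realType) n (W U : 'M[R]_n) (k : R) : 0 < k ->
  (forall x, `|x| ^+ 2 <= k * bilin W x x) ->
  `|U - W| <= 1 -> `|U - W| <= (2 * k * (n%:R ^+ 2 + 1))^-1 -> forall x,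
  `|x| ^+ 2 <= 2 * k * bilin U x x /\
  bilin U x x <= (n%:R ^+ 2 * `|W| + n%:R ^+ 2) * `|x| ^+ 2.
Proof.
move=> k0 hk UW1 UW2 x.
set Q : R := n%:R ^+ 2; have Q0 : 0 <= Q by exact: sqr_ge0.
have c10 : 0 < 2 * k * (Q + 1) by rewrite !mulr_gt0// ltr_wpDl.
set dl := `|U - W|; have dl0 : 0 <= dl by exact: normr_ge0.
have UWb : `|bilin U x x - bilin W x x| <= Q * dl * `|x| * `|x|.
  by rewrite -bilinBA; exact: ler_norm_bilin.
have Wb : `|bilin W x x| <= Q * `|W| * `|x| * `|x| by exact: ler_norm_bilin.
have kdl : 2 * k * (Q * dl) <= 1.
  apply: (@le_trans _ _ (2 * k * (Q + 1) * (2 * k * (Q + 1))^-1)); last by rewrite divff// gt_eqF.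
  rewrite mulrA; apply: ler_pM => //; first by rewrite !mulr_ge0// ltW.
  by rewrite ler_wpM2l ?lerDl// mulr_ge0// ltW.
split.
  have := hk x; move: UWb; rewrite -mulrA -expr2 ler_norml => /andP[u1 _].
  have s0 := sqr_ge0 `|x|.
  have : k * (Q * dl * `|x| ^+ 2) <= `|x| ^+ 2 / 2.
    by have := ler_wpM2r s0 kdl; rewrite mul1r; lra.
  have := ler_wpM2l (ltW k0) u1.
  by rewrite mulrBr mulrN; lra.
have w1 := le_trans (ler_norm _) Wb.
have u1 := le_trans (ler_norm _) UWb.
have : Q * dl * `|x| * `|x| <= Q * `|x| * `|x| by rewrite !ler_wpM2r// ler_piMr.
by rewrite expr2 mulrDl !mulrA; lra.
Qed.

Section invmx_perturbation.
Context (R : realType) (n : nat) (V : 'M[R]_n).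

(** The identity [U^-1 - W = - U^-1 (U - V) W] is used twice: it first bounds [|U^-1|] by [2 |W|],
    then gives the estimate. Powers of [n] appear because the entrywise maximum norm is
    submultiplicative only up to the dimension. *)
Lemma invmx_continuous (e : R) : V \in unitmx -> 0 < e ->
  exists2 dl : R, 0 < dl & forall U : 'M[R]_n, `|U - V| <= dl ->
    U \in unitmx /\ `|invmx U - invmx V| <= e.
Proof.
move=> uV e0; set W := invmx V.
pose c := n%:R * `|W| * n%:R + 1.
have c0 : 0 < c by rewrite ltr_wpDl// !mulr_ge0.
pose k := 2 * (n%:R ^+ 2 * `|W| ^+ 2) + 1.
have k0 : 0 < k by rewrite ltr_wpDl// mulr_ge0// mulr_ge0// sqr_ge0.
exists (Num.min (1 / (2 * c)) (e / k)).
  by rewrite lt_min !divr_gt0// mulr_gt0.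
move=> U; rewrite le_min => /andP[UV1 UV2].
have cU : n%:R * `|W| * n%:R * `|U - V| <= 1 / 2.
  apply: (@le_trans _ _ (c * (1 / (2 * c)))).
    by apply: ler_pM => //; rewrite lerDl.
  by rewrite le_eqVlt; apply/orP; left; apply/eqP; field; rewrite gt_eqF.
have uU : U \in unitmx.
  apply: unitmx_of_inj => x Ux.
  have E : x = - (W *m (U - V) *m x).
    rewrite mulmxBr mulmxBl -[W *m U *m x]mulmxA Ux mulmx0 sub0r opprK.
    by rewrite mulVmx// mul1mx.
  apply/eqP; rewrite -normr_le0.
  have : `|x| <= 1 / 2 * `|x|.
    rewrite {1}E normrN; apply: le_trans (ler_norm_mulmx _ _) _.
    rewrite ler_wpM2r//; apply: le_trans cU.
    apply: le_trans (ler_wpM2l _ (ler_norm_mulmx _ _)) _ => //.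
    by rewrite le_eqVlt; apply/orP; left; apply/eqP; ring.
  lra.
split=> //.
have E : invmx U - W = - (invmx U *m (U - V) *m W).
  by rewrite mulmxBr mulmxBl mulVmx// mul1mx -mulmxA mulmxV// mulmx1 opprB.
have B (X : 'M[R]_n) : `|X *m (U - V) *m W| <= n%:R ^+ 2 * `|X| * `|U - V| * `|W|.
  apply: le_trans (ler_norm_mulmx _ _) _; rewrite ler_wpM2r//.
  apply: le_trans (ler_wpM2l _ (ler_norm_mulmx _ _)) _ => //.
  by rewrite le_eqVlt; apply/orP; left; apply/eqP; ring.
have BU : `|invmx U| <= 2 * `|W|.
  have h : `|invmx U| <= `|W| + 1 / 2 * `|invmx U|.
    rewrite -{1}[invmx U](subrK W) addrC; apply: le_trans (ler_normD _ _) _.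
    rewrite lerD2l E normrN; apply: le_trans (B _) _.
    apply: (@le_trans _ _ ((n%:R * `|W| * n%:R * `|U - V|) * `|invmx U|)).
      by rewrite le_eqVlt; apply/orP; left; apply/eqP; ring.
    by rewrite ler_wpM2r.
  by lra.
rewrite E normrN; apply: le_trans (B _) _.
apply: (@le_trans _ _ (2 * (n%:R ^+ 2 * `|W| ^+ 2) * `|U - V|)).
  apply: (@le_trans _ _ (n%:R ^+ 2 * (2 * `|W|) * `|U - V| * `|W|)).
    by rewrite !ler_wpM2r// ler_wpM2l// sqr_ge0.
  by rewrite le_eqVlt; apply/orP; left; apply/eqP; ring.
apply: (@le_trans _ _ (k * (e / k))).
  by apply: ler_pM => //; rewrite lerDl.
by rewrite mulrC divfK// gt_eqF.
Qed.

End invmx_perturbation.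

(** * Expansion of the minimiser of a weighted quadratic criterion *)

Section gmm_minimiser.
Context (R : realType) (p q : nat) (G : 'M[R]_(q, p)) (V : 'M[R]_q).
Hypothesis Vs : V^T = V.
Hypothesis V0 : forall x, 0 <= bilin V x x.
Hypothesis uV : V \in unitmx.
Hypothesis Ginj : forall x : 'cV_p, G *m x = 0 -> x = 0.

Let W := invmx V.
Let H := G^T *m W *m G.
(** The weighted least-squares map: the minimiser in [h] of the [W]-norm of [a + G *m h] is
    [- gmm_influence *m a]. *)
Definition gmm_influence : 'M[R]_(p, q) := invmx H *m G^T *m W.

Lemma gmm_weight_sym : W^T = W.
Proof. by rewrite /W trmx_inv Vs. Qed.

Lemma bilin_weight x : bilin W x x = bilin V (W *m x) (W *m x).
Proof.
by rewrite /bilin trmx_mul gmm_weight_sym -!mulmxA [V *m _]mulmxA mulmxV// mul1mx.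
Qed.

(** With [y = W x], the squared Euclidean norm of [x] is [bilin V x y] and [bilin W x x] is
    [bilin V y y]. Cauchy-Schwarz for [V] and the trivial upper bound on [bilin V x x] give the
    estimate, with no eigenvalues. *)
Lemma gmm_weight_coercive : exists2 k : R, 0 < k &
  forall x, `|x| ^+ 2 <= k * bilin W x x.
Proof.
exists (q%:R ^+ 2 * `|V| + 1); first by rewrite ltr_wpDl// mulr_ge0// sqr_ge0.
move=> x; set k := _ + 1.
have [->|x0] := eqVneq x 0.
  by rewrite normr0 expr0n/= mulr_ge0// ?addr_ge0// ?mulr_ge0// ?sqr_ge0// bilin_weight V0.
have nx : 0 < `|x| by rewrite normr_gt0.
have dE : (x^T *m x) 0 0 = bilin V x (W *m x).
  by rewrite /bilin -mulmxA [V *m _]mulmxA mulmxV// mul1mx.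
have h1 := bilin_cauchy_schwarz Vs V0 x (W *m x).
rewrite -dE -bilin_weight in h1.
have h2 : bilin V x x <= k * `|x| ^+ 2.
  apply: le_trans (ler_norm _) _; apply: le_trans (ler_norm_bilin _ _ _) _.
  rewrite -mulrA -expr2 ler_wpM2r ?sqr_ge0//.
  by rewrite /k lerDl.
have W0 : 0 <= bilin W x x by rewrite bilin_weight V0.
have h3 : (`|x| ^+ 2) ^+ 2 <= (`|x| ^+ 2) * (k * bilin W x x).
  apply: (@le_trans _ _ (((x^T *m x) 0 0) ^+ 2)).
    by rewrite lerXn2r ?nnegrE ?sqr_ge0 ?sqr_norm_le_dot// (le_trans _ (sqr_norm_le_dot x)) ?sqr_ge0.
  apply: le_trans h1 _; rewrite mulrA [_ * k]mulrC.
  by rewrite ler_wpM2r.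
by move: h3; rewrite expr2 ler_pM2l// exprn_gt0.
Qed.

Lemma gmm_hessian_unit : H \in unitmx.
Proof.
apply: unitmx_of_inj => x Hx; apply: Ginj.
have [k k0 hk] := gmm_weight_coercive.
have E : bilin W (G *m x) (G *m x) = 0.
  by rewrite /bilin trmx_mul -!mulmxA [W *m _]mulmxA [G^T *m _]mulmxA [G^T *m _]mulmxA -/H Hx mulmx0 mxE.
have := hk (G *m x); rewrite E mulr0 => h.
apply/eqP; rewrite -normr_eq0 -sqrf_eq0 eq_le h /=.
exact: sqr_ge0.
Qed.

Lemma gmm_hessian_sym : H^T = H.
Proof. by rewrite /H !trmx_mul trmxK gmm_weight_sym mulmxA. Qed.

Lemma gmm_influenceG : gmm_influence *m G = 1%:M.
Proof. by rewrite /gmm_influence -!mulmxA [G^T *m _]mulmxA mulVmx// gmm_hessian_unit. Qed.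

Lemma gmm_injective_bound (h : 'cV[R]_p) :
  `|h| <= q%:R * `|gmm_influence| * `|G *m h|.
Proof.
by rewrite -{1}[h]mul1mx -gmm_influenceG -mulmxA; exact: ler_norm_mulmx.
Qed.

(** The sandwich formula collapses since [W] is the inverse of [V]. The vector is the transposed row
    of minus the influence map, the linear functional of the sample moments that the estimator
    follows. *)
Lemma gmm_variance_influence (k0 : 'I_p) :
  bilin V (- (row k0 gmm_influence)^T) (- (row k0 gmm_influence)^T) = invmx H k0 k0.
Proof.
rewrite -scaleN1r bilinZl bilinZr mulrA mulrNN !mul1r /bilin trmxK.
transitivity ((gmm_influence *m V *m gmm_influence^T) k0 k0).
  by rewrite -row_mul [LHS]mxE [RHS]mxE; apply: eq_bigr => a _; rewrite !mxE.
congr (fun_of_matrix _ k0 k0).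
have sH : (invmx H)^T = invmx H by rewrite trmx_inv gmm_hessian_sym.
rewrite /gmm_influence !trmx_mul trmxK sH gmm_weight_sym -!mulmxA.
rewrite [W *m (V *m _)]mulmxA mulVmx// mul1mx.
have -> : G^T *m (W *m (G *m invmx H)) = 1%:M by rewrite !mulmxA -/H mulmxV ?gmm_hessian_unit.
by rewrite mulmx1.
Qed.

(** Excludes the point mass as limit law, and justifies the division by the variance in the
    Gauss-Markov argument. *)
Lemma gmm_variance_gt0 (k0 : 'I_p) : 0 < invmx H k0 k0.
Proof.
have uH := gmm_hessian_unit.
have [k kk0 hk] := gmm_weight_coercive.
pose e : 'cV[R]_p := delta_mx k0 0.
have -> : invmx H k0 k0 = bilin W (G *m (invmx H *m e)) (G *m (invmx H *m e)).
  have sH : (invmx H)^T = invmx H by rewrite trmx_inv gmm_hessian_sym.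
  rewrite /bilin !trmx_mul sH -!mulmxA.
  have -> : G^T *m (W *m (G *m (invmx H *m e))) = e.
    by rewrite !mulmxA -/H mulmxV// mul1mx.
  by rewrite /e trmx_delta -rowE -colE !mxE.
have hy := hk (G *m (invmx H *m e)); set y := G *m _ in hy *.
rewrite -(pmulr_rgt0 _ kk0); apply: lt_le_trans hy.
rewrite exprn_gt0// normr_gt0; apply/eqP => /Ginj E.
have : e = 0 by rewrite -[e]mul1mx -(mulmxV uH) -mulmxA E mulmx0.
by move/matrixP/(_ k0 0); rewrite !mxE !eqxx => /eqP; rewrite oner_eq0.
Qed.

(** No derivative of the criterion is taken. With [a = |gh 0|], the minimiser [h1] and the
    least-squares solution [ht] are both [O(a)], and there the criterion differs from its quadratic
    model by [O(dl a^2)]. The model at [h1] exceeds its minimum by the [W]-square of [G (h1 - ht)],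
    which is therefore [O(dl a^2)] too. That [dl] does not depend on [U], [gh] or [r] makes the
    statement usable on random samples. *)
Lemma gmm_minimiser_expansion (e : R) : 0 < e ->
  exists2 dl : R, 0 < dl & forall (U : 'M[R]_q) (gh : 'cV[R]_p -> 'cV[R]_q)
    (r : R) (h1 : 'cV[R]_p),
    `|U - W| <= dl ->
    (forall h, `|h| <= r -> `|gh h - gh 0 - G *m h| <= dl * `|h|) ->
    q%:R * `|gmm_influence| * `|gh 0| <= r ->
    `|h1| <= r ->
    (forall h, `|h| <= r -> bilin U (gh h1) (gh h1) <= bilin U (gh h) (gh h)) ->
    `|h1 + gmm_influence *m gh 0| <= e * `|gh 0|.
Proof.
move=> e0; have [k k0 hk] := gmm_weight_coercive.
pose Q : R := q%:R ^+ 2; have Q0 : 0 <= Q by exact: sqr_ge0.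
pose cW := Q * `|W|; have cW0 : 0 <= cW by rewrite mulr_ge0.
pose L := q%:R * `|gmm_influence|; have L0 : 0 <= L by rewrite mulr_ge0.
pose Ga := p%:R * `|G|; have Ga0 : 0 <= Ga by rewrite mulr_ge0.
(* In units of [a]: [B] bounds [|gh h1|], [E1] bounds [|h1|], [L] bounds the least-squares solution,
   [F] bounds the linear model and [2 * F] the function [gh] at either point; [Nn] collects the
   errors of the quadratic model. *)
pose B := 1 + 2 * k * (cW + Q).
have B1 : 1 <= B by rewrite lerDl !mulr_ge0 ?(ltW k0)// addr_ge0.
pose E1 := 2 * L * (B + 1).
have E10 : 0 <= E1 by rewrite !mulr_ge0// addr_ge0// (le_trans _ B1).
pose F := 1 + Ga * E1 + Ga * L + E1 + L.
have GE : 0 <= Ga * E1 by exact: mulr_ge0.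
have GL : 0 <= Ga * L by exact: mulr_ge0.
have F0 : 0 <= F by rewrite /F; lra.
pose Nn := 2 * (3 * cW + 4 * Q) * F ^+ 2.
have Nn0 : 0 <= Nn by rewrite mulr_ge0 ?sqr_ge0// mulr_ge0//; lra.
pose c1 := 2 * k * (Q + 1); pose c2 := 2 * L + 1; pose c3 := L ^+ 2 * k * Nn + 1.
have c10 : 0 < c1 by rewrite !mulr_gt0// ltr_wpDl.
have c20 : 0 < c2 by rewrite ltr_wpDl// mulr_ge0.
have c30 : 0 < c3 by rewrite ltr_wpDl// mulr_ge0// mulr_ge0 ?sqr_ge0// ltW.
(* In order: boundedness of [U], half of its coercivity, absorption of [dl |h1|] into [|h1|], and
   the final comparison with [e ^+ 2]. *)
exists (Num.min (Num.min 1 c1^-1) (Num.min c2^-1 (e ^+ 2 / c3))).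
  by rewrite !lt_min ltr01 !invr_gt0 c10 c20 divr_gt0// exprn_gt0.
move=> U gh r h1; set dl := Num.min _ _ => UW lin rbig h1r minU.
have dl0 : 0 <= dl by exact: le_trans UW.
have : dl <= dl by exact: lexx.
rewrite {2}/dl !le_min => /andP[/andP[dl1 dlc1] /andP[dlc2 dlc3]].
set a := `|gh 0|; have a0 : 0 <= a by exact: normr_ge0.
have UWb x y : `|bilin U x y - bilin W x y| <= Q * dl * `|x| * `|y|.
  rewrite -bilinBA; apply: le_trans (ler_norm_bilin _ _ _) _.
  by rewrite !ler_wpM2r// ler_wpM2l.
have Wb x y : `|bilin W x y| <= cW * `|x| * `|y| by exact: ler_norm_bilin.
have UWp := bilin_perturbation k0 hk (le_trans UW dl1) (le_trans UW dlc1).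
have Ucoer x : `|x| ^+ 2 <= 2 * k * bilin U x x by have [] := UWp x.
have Uup x : bilin U x x <= (cW + Q) * `|x| ^+ 2 by have [] := UWp x.
have r0 : 0 <= r by exact: le_trans h1r.
have s1 : `|gh h1| <= B * a.
  rewrite -(@ler_pXn2r _ 2)// ?nnegrE ?mulr_ge0 ?(le_trans _ B1)//.
  apply: le_trans (Ucoer _) _.
  apply: (@le_trans _ _ (2 * k * ((cW + Q) * a ^+ 2))).
    rewrite ler_wpM2l ?mulr_ge0 ?(ltW k0)//; apply: le_trans (minU 0 _) (Uup _).
    by rewrite normr0.
  rewrite exprMn mulrA ler_wpM2r ?sqr_ge0//.
  apply: (@le_trans _ _ B); first by rewrite lerDr.
  by rewrite expr2 ler_peMr// (le_trans _ B1).
have s2 : `|h1| <= E1 * a.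
  have t1 : `|G *m h1| <= B * a + a + dl * `|h1|.
    rewrite (_ : G *m h1 = gh h1 - gh 0 - (gh h1 - gh 0 - G *m h1)); last first.
      by rewrite opprB addrC subrK.
    apply: le_trans (ler_normB _ _) _; apply: lerD; last exact: lin.
    by apply: le_trans (ler_normB _ _) _; rewrite lerD2r.
  have t2 : L * dl <= 1 / 2.
    have : c2 * dl <= c2 * c2^-1 by rewrite ler_wpM2l// ltW.
    by rewrite divff ?gt_eqF// /c2 mulrDl mul1r; lra.
  have t3 := gmm_injective_bound h1; rewrite -/L in t3.
  have t4 : `|h1| <= L * (B * a + a) + L * dl * `|h1|.
    by apply: le_trans t3 _; rewrite -mulrA -mulrDr ler_wpM2l.
  have := ler_wpM2r (normr_ge0 h1) t2; rewrite /E1.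
  by have -> : 2 * L * (B + 1) * a = 2 * (L * (B * a + a)); [ring|lra].
set ht := - (gmm_influence *m gh 0).
have s3 : `|ht| <= L * a by rewrite normrN; exact: ler_norm_mulmx.
have Gb (h : 'cV[R]_p) : `|G *m h| <= Ga * `|h| by exact: ler_norm_mulmx.
have cases h : `|h| <= (E1 + L) * a -> `|h| <= r ->
    [/\ `|gh 0 + G *m h| <= F * a , `|gh h| <= 2 * F * a &
     `|bilin U (gh h) (gh h) - bilin W (gh 0 + G *m h) (gh 0 + G *m h)| <= Nn / 2 * dl * a ^+ 2].
  move=> hE hr; set x := gh 0 + G *m h; set rho := gh h - x.
  have ghE : gh h = x + rho by rewrite /rho addrC subrK.
  have x1 : `|x| <= F * a.
    apply: le_trans (ler_normD _ _) _; apply: (@le_trans _ _ (a + Ga * ((E1 + L) * a))).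
      by rewrite lerD2l; apply: le_trans (Gb _) _; rewrite ler_wpM2l.
    rewrite (_ : a + _ = (1 + Ga * E1 + Ga * L) * a); last by ring.
    by rewrite ler_wpM2r// /F; lra.
  have rho1 : `|rho| <= dl * (F * a).
    have -> : rho = gh h - gh 0 - G *m h by rewrite /rho /x opprD addrA.
    apply: le_trans (lin _ hr) _; rewrite ler_wpM2l//; apply: le_trans hE _.
    by rewrite ler_wpM2r// /F; lra.
  have Fa0 : 0 <= F * a by exact: mulr_ge0.
  have rho2 : `|rho| <= F * a by apply: le_trans rho1 _; rewrite ler_piMl.
  have g2 : `|gh h| <= 2 * F * a.
    by rewrite ghE; apply: le_trans (ler_normD _ _) _; lra.
  split=> //.
  have -> : bilin U (gh h) (gh h) - bilin W x x =
     (bilin U (gh h) (gh h) - bilin W (gh h) (gh h)) +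
     (bilin W x rho + bilin W rho x + bilin W rho rho).
    have -> : bilin W (gh h) (gh h) = bilin W x x + bilin W x rho + bilin W rho x + bilin W rho rho.
      by rewrite ghE bilinDl !bilinDr; ring.
    by ring.
  have FF : 0 <= F * a * (F * a) by rewrite mulr_ge0.
  have b1 : `|bilin W x rho| <= cW * (F * a) * (dl * (F * a)).
    by apply: le_trans (Wb _ _) _; apply: ler_pM => //; [rewrite mulr_ge0|rewrite ler_wpM2l].
  have b2 : `|bilin W rho x| <= cW * (F * a) * (dl * (F * a)).
    apply: le_trans (Wb _ _) _; rewrite mulrAC.
    by apply: ler_pM => //; [rewrite mulr_ge0|rewrite ler_wpM2l].
  have b3 : `|bilin W rho rho| <= cW * (F * a) * (dl * (F * a)).
    by apply: le_trans (Wb _ _) _; apply: ler_pM => //; [rewrite mulr_ge0|rewrite ler_wpM2l].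
  have b4 : `|bilin U (gh h) (gh h) - bilin W (gh h) (gh h)| <= Q * dl * (2 * F * a) * (2 * F * a).
    apply: le_trans (UWb _ _) _; apply: ler_pM => //; first by rewrite !mulr_ge0.
    by rewrite ler_wpM2l// mulr_ge0.
  have n1 := ler_normD (bilin U (gh h) (gh h) - bilin W (gh h) (gh h)) (bilin W x rho + bilin W rho x + bilin W rho rho).
  have n2 := ler_normD (bilin W x rho + bilin W rho x) (bilin W rho rho).
  have n3 := ler_normD (bilin W x rho) (bilin W rho x).
  rewrite (_ : Nn / 2 * dl * a ^+ 2 = 3 * (cW * (F * a) * (dl * (F * a))) + Q * dl * (2 * F * a) * (2 * F * a)).
    by lra.
  by rewrite /Nn; field.
have htr : `|ht| <= r by apply: le_trans rbig; rewrite normrN; exact: ler_norm_mulmx.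
have E1L : E1 <= E1 + L by rewrite lerDl.
have LE1 : L <= E1 + L by rewrite lerDr.
have [_ _ d1] := cases h1 (le_trans s2 (ler_wpM2r a0 E1L)) h1r.
have [_ _ d2] := cases ht (le_trans s3 (ler_wpM2r a0 LE1)) htr.
set x1 := gh 0 + G *m h1 in d1; set x2 := gh 0 + G *m ht in d2.
pose dd := h1 - ht.
have dE : bilin W x1 x1 = bilin W x2 x2 + bilin W (G *m dd) (G *m dd).
  have -> : x1 = x2 + G *m dd by rewrite /x1 /x2 /dd mulmxBr -addrA [G *m ht + _]addrC subrK.
  (* First-order condition of the quadratic model at [ht]: the residual [x2] is [W]-orthogonal to
     the range of [G], so the excess is a pure square. *)
  have o : bilin W (G *m dd) x2 = 0.
    rewrite /bilin trmx_mul -!mulmxA [G^T *m _]mulmxA.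
    have -> : G^T *m W *m x2 = 0.
      rewrite /x2 mulmxDr /ht mulmxN mulmxN /gmm_influence.
      rewrite mulmxA -/H !mulmxA mulmxV ?gmm_hessian_unit// mul1mx.
      by rewrite addrN.
    by rewrite mulmx0 mxE.
  rewrite (bilinDl W x2) (bilinDr W x2 x2) (bilinDr W (G *m dd) x2) (bilinC x2 (G *m dd) gmm_weight_sym) o.
  by rewrite addr0 add0r.
have key : bilin W (G *m dd) (G *m dd) <= Nn * dl * a ^+ 2.
  have := minU _ htr; move: d1 d2; rewrite !ler_norml => /andP[u1 _] /andP[_ u2].
  by move: dE u1 u2 => -> *; lra.
have -> : h1 + gmm_influence *m gh 0 = dd by rewrite /dd /ht opprK.
rewrite -(@ler_pXn2r _ 2)// ?nnegrE ?mulr_ge0 ?(ltW e0)// exprMn.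
have t1 : `|dd| ^+ 2 <= L ^+ 2 * `|G *m dd| ^+ 2.
  by rewrite -exprMn lerXn2r ?nnegrE ?mulr_ge0//; exact: gmm_injective_bound.
have t2 := hk (G *m dd).
apply: le_trans t1 _.
apply: (@le_trans _ _ (L ^+ 2 * (k * (Nn * dl * a ^+ 2)))).
  rewrite ler_wpM2l ?sqr_ge0//; apply: le_trans t2 _.
  by rewrite ler_wpM2l// ltW.
rewrite (_ : _ * _ = L ^+ 2 * k * Nn * dl * a ^+ 2); last by ring.
rewrite ler_wpM2r ?sqr_ge0//.
apply: (@le_trans _ _ (c3 * (e ^+ 2 / c3))); last by rewrite mulrC divfK// gt_eqF.
apply: ler_pM => //; first by rewrite mulr_ge0// mulr_ge0 ?sqr_ge0// ltW.
by rewrite /c3 lerDl.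
Qed.

End gmm_minimiser.

(** * Asymptotics of the two-step estimator *)

Section two_step_core.
Context (R : realType) (p q r : nat).
Context (lam : 'cV[R]_p -> 'cV[R]_r) (D : 'M[R]_(r, p)) (K : set 'cV[R]_p).
Context (Sm : 'M[R]_(q, r)) (M : 'I_q -> 'I_r -> 'I_q -> 'I_r -> R).
Context (C2 Lam r0 : R).
Hypothesis lamD : forall h, `|h| <= 1 -> `|lam h - lam 0 - D *m h| <= C2 * `|h| ^+ 2.
Hypothesis lamK : forall h, K h -> `|lam h| <= Lam.
Hypothesis r00 : 0 < r0.
Hypothesis Kball : forall h, `|h| <= r0 -> K h.

(** The outer product of [S *m lam h] with itself, with each product [S a i * S b k] replaced by
    [X a i b k]: the sample and population weighting matrices come from averages and means of the
    same products. *)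
Definition moment_var (X : 'I_q -> 'I_r -> 'I_q -> 'I_r -> R) (h : 'cV[R]_p) : 'M[R]_q :=
  \matrix_(a, b) \sum_i \sum_k lam h i 0 * lam h k 0 * X a i b k.

Let G := Sm *m D.
Let V := moment_var M 0.

Hypothesis Sm0 : Sm *m lam 0 = 0.
Hypothesis Kid : forall e, 0 < e -> exists2 c, 0 < c &
  forall h, K h -> e <= `|h| -> c <= `|Sm *m lam h|.
Hypothesis Vs : V^T = V.
Hypothesis V0 : forall x, 0 <= bilin V x x.
Hypothesis uV : V \in unitmx.
Hypothesis Ginj : forall x : 'cV_p, G *m x = 0 -> x = 0.

Let K0 : K 0. Proof. by apply: Kball; rewrite normr0 ltW. Qed.

Let Lam0 : 0 <= Lam. Proof. exact: le_trans (normr_ge0 _) (lamK K0). Qed.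

Let C1 := p%:R * `|D| + `|C2|.

Let lam_lip h : `|h| <= 1 -> `|lam h - lam 0| <= C1 * `|h|.
Proof.
move=> h1; rewrite -[lam h - lam 0](subrK (D *m h)).
apply: le_trans (ler_normD _ _) _; rewrite /C1 mulrDl addrC; apply: lerD.
  exact: ler_norm_mulmx.
apply: le_trans (lamD h1) _; apply: (@le_trans _ _ (`|C2| * `|h| ^+ 2)).
  by rewrite ler_wpM2r ?sqr_ge0// ler_norm.
by rewrite ler_wpM2l// expr2 ler_piMr.
Qed.

Let minimiser_close (U : 'M[R]_q) (k c : R) (gh : 'cV[R]_p -> 'cV[R]_q) h1 :
  0 <= k -> 0 <= c ->
  (forall x, `|x| ^+ 2 <= k * bilin U x x /\ bilin U x x <= c * `|x| ^+ 2) ->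
  bilin U (gh h1) (gh h1) <= bilin U (gh 0) (gh 0) ->
  `|gh h1| <= (1 + k * c) * `|gh 0|.
Proof.
move=> k0 c0 H le; have kc0 : 0 <= k * c by exact: mulr_ge0.
rewrite -(@ler_pXn2r _ 2)// ?nnegrE ?mulr_ge0 ?addr_ge0//.
apply: le_trans (H _).1 _; apply: (@le_trans _ _ (k * (c * `|gh 0| ^+ 2))).
  by rewrite ler_wpM2l//; apply: le_trans le (H _).2.
rewrite exprMn mulrA ler_wpM2r ?sqr_ge0// expr2.
by apply: (@le_trans _ _ (1 + k * c)); [rewrite lerDr|rewrite ler_peMr ?addr_ge0// lerDl].
Qed.

Let B1 : R := 1 + 1 * (q%:R ^+ 2 * `|1%:M : 'M[R]_q|).

(** At either minimiser the moment vector is at most a constant times its norm at [0], which is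
    [O(dl)]; identification turns this into [|h1|, |h2| < rho]. Nearness of [h1] to 0 makes the
    weighting matrix close to [V], hence invertible; nearness of [h2] puts it into the ball where
    the linear expansion holds. *)
Lemma two_step_core (e : R) : 0 < e -> exists2 dl : R, 0 < dl &
  forall (Sh : 'M[R]_(q, r)) (Mh : 'I_q -> 'I_r -> 'I_q -> 'I_r -> R) (h1 h2 : 'cV[R]_p),
  `|Sh - Sm| <= dl ->
  (forall a i b k, `|Mh a i b k - M a i b k| <= dl) ->
  K h1 ->
  (forall h, K h -> bilin 1%:M (Sh *m lam h1) (Sh *m lam h1) <=
                    bilin 1%:M (Sh *m lam h) (Sh *m lam h)) ->
  (moment_var Mh h1 \in unitmx -> K h2 /\
   forall h, K h -> bilin (invmx (moment_var Mh h1)) (Sh *m lam h2) (Sh *m lam h2) <=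
                    bilin (invmx (moment_var Mh h1)) (Sh *m lam h) (Sh *m lam h)) ->
  `|h2 + gmm_influence G V *m (Sh *m lam 0)| <= e * `|Sh *m lam 0|.
Proof.
move=> e0.
have [d1 d10 H1] := gmm_minimiser_expansion Vs V0 uV Ginj e0.
have [k k0 hk] := gmm_weight_coercive Vs V0 uV.
pose c1 := 2 * k * (q%:R ^+ 2 + 1).
have c10 : 0 < c1 by rewrite !mulr_gt0// ltr_wpDl// sqr_ge0.
pose e1 := Num.min d1 (Num.min 1 c1^-1).
have e10 : 0 < e1 by rewrite !lt_min d10 ltr01 invr_gt0.
have [d2 d20 H2] := invmx_continuous uV e10.
pose Mx : R := \sum_a \sum_i \sum_b \sum_k `|M a i b k|.
have Mx0 : 0 <= Mx by do 4 (apply: sumr_ge0 => ? _).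
have MxM a i b l : `|M a i b l| <= Mx.
  have n1 (I : finType) (F : I -> R) (x : I) : (forall y, 0 <= F y) -> F x <= \sum_y F y.
    by move=> F0; rewrite (bigD1 x)//= lerDl sumr_ge0.
  rewrite /Mx; apply: le_trans (n1 _ _ a _); last by move=> ?; do 3 (apply: sumr_ge0 => ? _).
  apply: le_trans (n1 _ _ i _); last by move=> ?; do 2 (apply: sumr_ge0 => ? _).
  apply: le_trans (n1 _ _ b _); last by move=> ?; apply: sumr_ge0 => ? _.
  exact: (n1 _ (fun k => `|M a i b k|) l).
pose s1 := 4 * r%:R ^+ 2 * Lam * C1 * Mx + 1.
have C10 : 0 <= C1 by rewrite addr_ge0// mulr_ge0.
have s10 : 0 < s1 by rewrite ltr_wpDl// !mulr_ge0// sqr_ge0.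
pose s2 := 2 * (r%:R * `|Sm| * `|C2|) + 1.
have s20 : 0 < s2 by rewrite ltr_wpDl// !mulr_ge0.
(* [r1] keeps the weighting matrix within [d2] of [V]; [r2] keeps the ball inside [K] and the
   quadratic remainder of [lam] below half of [d1 * |h|]. *)
pose r1 := Num.min 1 (d2 / s1).
pose r2 := Num.min (Num.min 1 r0) (d1 / s2).
have r10 : 0 < r1 by rewrite lt_min ltr01 divr_gt0.
have r20 : 0 < r2 by rewrite !lt_min ltr01 r00 divr_gt0.
pose rho := Num.min r1 r2.
have rho0 : 0 < rho by rewrite lt_min r10.
have [c c0 Hc] := Kid rho0.
pose B2 : R := 1 + 2 * k * (q%:R ^+ 2 * `|invmx V| + q%:R ^+ 2).
have B20 : 0 <= B2.
  by rewrite addr_ge0// mulr_ge0// ?mulr_ge0 ?(ltW k0)// addr_ge0// ?mulr_ge0// sqr_ge0.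
have B10 : 0 <= B1 by rewrite addr_ge0// mulr_ge0// mulr_ge0// sqr_ge0.
pose t1 := (B1 + B2 + 1) * (r%:R * Lam) + 1.
have rL0 : 0 <= r%:R * Lam by rewrite mulr_ge0.
have BB0 : 0 <= B1 + B2 + 1 by lra.
have t10 : 0 < t1 by rewrite ltr_wpDl//; exact: mulr_ge0 BB0 rL0.
pose t2 := 2 * r%:R ^+ 2 * Lam ^+ 2 + 1.
have t20 : 0 < t2 by rewrite ltr_wpDl// mulr_ge0// ?mulr_ge0// sqr_ge0.
pose t3 := 2 * (r%:R * C1) + 1.
have t30 : 0 < t3 by rewrite ltr_wpDl// mulr_ge0// mulr_ge0.
pose t4 := q%:R * `|gmm_influence G V| * (r%:R * Lam) + 1.
have t40 : 0 < t4 by rewrite ltr_wpDl// !mulr_ge0.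
have frac (x y z : R) : 0 <= x -> 0 < y -> 0 <= z -> z <= y / (x + 1) -> x * z <= y.
  move=> x0 y0 z0 zy; have x1 : 0 < x + 1 by rewrite ltr_wpDl.
  apply: (@le_trans _ _ ((x + 1) * (y / (x + 1)))).
    by apply: ler_pM => //; rewrite lerDl.
  by rewrite mulrC divfK// gt_eqF.
(* The four thresholds serve consistency, the weighting matrix, the linearisation, and the size of
   the least-squares solution relative to [r2]. *)
exists (Num.min (Num.min (c / 2 / t1) (d2 / t2)) (Num.min (d1 / t3) (r2 / t4))).
  by rewrite !lt_min !divr_gt0.
move=> Sh Mh h1 h2; set dl := Num.min _ _ => SS MM Kh1 min1 min2.
have dl0 : 0 <= dl by exact: le_trans SS.
have : dl <= dl by exact: lexx.
rewrite {2}/dl !le_min => /andP[/andP[dlt1 dlt2] /andP[dlt3 dlt4]].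
pose gh h := Sh *m lam h.
have ghdist h : K h -> `|gh h - Sm *m lam h| <= r%:R * dl * Lam.
  move=> Kh; rewrite -mulmxBl; apply: le_trans (ler_norm_mulmx _ _) _.
  by apply: ler_pM => //; [rewrite ler_wpM2l|exact: lamK].
have gh0 : `|gh 0| <= r%:R * dl * Lam by have := ghdist _ K0; rewrite Sm0 subr0.
have consist (B : R) h : 0 <= B -> B <= B1 + B2 -> K h -> `|gh h| <= B * `|gh 0| -> `|h| < rho.
  move=> B0 BB Kh ghB; rewrite ltNge; apply/negP => /(Hc _ Kh).
  apply/negP; rewrite -ltNge.
  apply: (@le_lt_trans _ _ ((B1 + B2 + 1) * (r%:R * Lam) * dl)).
    rewrite -[Sm *m _](subKr (gh h)); apply: le_trans (ler_normB _ _) _.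
    rewrite (_ : _ * dl = (B1 + B2) * (r%:R * dl * Lam) + r%:R * dl * Lam); last by ring.
    apply: lerD; last exact: ghdist.
    apply: le_trans ghB _; apply: ler_pM => //.
  apply: (@le_lt_trans _ _ (c / 2)); last by lra.
  by apply: frac => //; [exact: mulr_ge0 BB0 rL0|rewrite divr_gt0].
have h1rho : `|h1| < rho.
  apply: (consist B1) => //; first by rewrite lerDl.
  apply: (@minimiser_close 1%:M) => //; last exact: min1.
  move=> x; split.
    by rewrite mul1r /bilin mulmx1; exact: sqr_norm_le_dot.
  apply: le_trans (ler_norm _) _; apply: le_trans (ler_norm_bilin _ _ _) _.
  by rewrite -mulrA -expr2.
have h1r1 : `|h1| <= r1 by apply: le_trans (ltW h1rho) _; rewrite ge_min lexx.
have h11 : `|h1| <= 1 by apply: le_trans h1r1 _; rewrite ge_min lexx.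
have Vclose : `|moment_var Mh h1 - V| <= d2.
  apply: ler_norm_entries => [|a b]; first exact: ltW.
  rewrite !mxE -sumrB.
  apply: le_trans (ler_norm_sum _ _ _) _.
  apply: (@le_trans _ _ (\sum_(i < r) \sum_(l < r) (Lam ^+ 2 * dl + 2 * Lam * (C1 * `|h1|) * Mx))).
    apply: ler_sum => i _; rewrite -sumrB; apply: le_trans (ler_norm_sum _ _ _) _.
    apply: ler_sum => l _.
    set u := lam h1 i 0; set w := lam h1 l 0; set u0 := lam 0 i 0; set w0 := lam 0 l 0.
    have lb h j : K h -> `|lam h j 0| <= Lam.
      by move=> Kh; apply: le_trans (ler_entry_norm _ _ _) (lamK Kh).
    have ld j : `|lam h1 j 0 - lam 0 j 0| <= C1 * `|h1|.
      have := ler_entry_norm (lam h1 - lam 0) j 0; rewrite !mxE => hh.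
      exact: le_trans hh (lam_lip h11).
    rewrite (_ : _ - _ = u * w * (Mh a i b l - M a i b l) +
      ((u - u0) * w + u0 * (w - w0)) * M a i b l); last by ring.
    apply: le_trans (ler_normD _ _) _; apply: lerD.
      rewrite !normrM expr2; apply: ler_pM => //.
      by apply: ler_pM => //; exact: lb.
    rewrite normrM; apply: ler_pM => //.
    apply: le_trans (ler_normD _ _) _; rewrite !normrM.
    rewrite (_ : 2 * Lam * _ = C1 * `|h1| * Lam + Lam * (C1 * `|h1|)); last by ring.
    by apply: lerD; apply: ler_pM => //; first [exact: ld|exact: lb].
  rewrite !sumr_const !card_ord -!mulrnA -[_ *+ (r * r)]mulr_natl natrM.
  have a1 : (2 * r%:R ^+ 2 * Lam ^+ 2) * dl <= d2.
    by apply: frac => //; rewrite mulr_ge0// ?mulr_ge0// sqr_ge0.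
  have a2 : (4 * r%:R ^+ 2 * Lam * C1 * Mx) * `|h1| <= d2.
    apply: frac => //; first by rewrite !mulr_ge0// sqr_ge0.
    by apply: le_trans h1r1 _; rewrite ge_min lexx orbT.
  rewrite (_ : _ * _ = ((2 * r%:R ^+ 2 * Lam ^+ 2) * dl + (4 * r%:R ^+ 2 * Lam * C1 * Mx) * `|h1|) / 2); last by field.
  by lra.
(* Invertibility of the estimated weighting matrix unlocks the second-step hypothesis, which says
   nothing otherwise. *)
have [uU UW] := H2 _ Vclose.
have [Kh2 {}min2] := min2 uU.
set U := invmx (moment_var Mh h1) in UW min2.
move: UW; rewrite !le_min => /andP[UW1 /andP[UW2 UW3]].
have h2rho : `|h2| < rho.
  apply: (consist B2) => //; first by rewrite lerDr.
  have k20 : 0 <= 2 * k by rewrite mulr_ge0// ltW.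
  have cc0 : 0 <= q%:R ^+ 2 * `|invmx V| + q%:R ^+ 2 by rewrite addr_ge0// ?mulr_ge0// sqr_ge0.
  exact: (minimiser_close k20 cc0 (bilin_perturbation k0 hk UW2 UW3) (min2 _ K0)).
apply: (H1 U gh r2) => //.
- move=> h hr2.
  have h1' : `|h| <= 1 by apply: le_trans hr2 _; rewrite !ge_min lexx.
  have h3 : `|h| <= d1 / s2 by apply: le_trans hr2 _; rewrite ge_min lexx orbT.
  rewrite (_ : gh h - gh 0 - G *m h =
     (Sh - Sm) *m (lam h - lam 0) + Sm *m (lam h - lam 0 - D *m h)); last first.
    by rewrite /gh /G -mulmxBr mulmxBl [Sm *m (_ - D *m h)]mulmxBr addrA subrK mulmxA.
  apply: le_trans (ler_normD _ _) _.
  have b1 : `|(Sh - Sm) *m (lam h - lam 0)| <= r%:R * dl * (C1 * `|h|).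
    apply: le_trans (ler_norm_mulmx _ _) _.
    by apply: ler_pM => //; [rewrite ler_wpM2l|exact: lam_lip].
  have b2 : `|Sm *m (lam h - lam 0 - D *m h)| <= r%:R * `|Sm| * (`|C2| * `|h| ^+ 2).
    apply: le_trans (ler_norm_mulmx _ _) _; rewrite ler_wpM2l ?mulr_ge0//.
    by apply: le_trans (lamD h1') _; rewrite ler_wpM2r ?sqr_ge0// ler_norm.
  have a1 : 2 * (r%:R * C1) * dl <= d1 by apply: frac => //; rewrite mulr_ge0// mulr_ge0.
  have a2 : 2 * (r%:R * `|Sm| * `|C2|) * `|h| <= d1 by apply: frac => //; rewrite !mulr_ge0.
  apply: le_trans (lerD b1 b2) _.
  rewrite (_ : _ + _ = ((2 * (r%:R * C1) * dl) + 2 * (r%:R * `|Sm| * `|C2|) * `|h|) / 2 * `|h|); last by field.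
  by rewrite ler_wpM2r//; lra.
- apply: (@le_trans _ _ (q%:R * `|gmm_influence G V| * (r%:R * Lam) * dl)).
    rewrite -[leRHS]mulrA; apply: ler_wpM2l; first by rewrite mulr_ge0.
    by rewrite mulrAC.
  by apply: frac => //; rewrite !mulr_ge0.
- by apply: le_trans (ltW h2rho) _; rewrite ge_min lexx orbT.
- move=> h hr2; apply: min2; apply: Kball; apply: le_trans hr2 _.
  by rewrite !ge_min lexx orbT.
Qed.

End two_step_core.

(** * Central limit theorem for the second-step minimiser *)

Section gmm_limit.
Context d (Omega : measurableType d) (R : realType) (P : probability Omega R).
Local Notation Ex := (Ex P).
Local Notation intg := (intg P).
Context (p q r : nat).
Context (lam : 'cV[R]_p -> 'cV[R]_r) (D : 'M[R]_(r, p)) (K : set 'cV[R]_p).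
Context (C2 Lam r0 : R).
Hypothesis lamD : forall h, `|h| <= 1 -> `|lam h - lam 0 - D *m h| <= C2 * `|h| ^+ 2.
Hypothesis lamK : forall h, K h -> `|lam h| <= Lam.
Hypothesis r00 : 0 < r0.
Hypothesis Kball : forall h, `|h| <= r0 -> K h.
Context (S : nat -> Omega -> 'M[R]_(q, r)).

Let X j w a i b k : R := S j w a i * S j w b k.

Hypothesis iS1 : forall a i, iid_rv P (fun j w => S j w a i).
Hypothesis iS2 : forall a i b k, iid_rv P (fun j w => X j w a i b k).
Hypothesis iS3 : forall c : 'rV_q, iid_rv P (fun j w => (c *m (S j w *m lam 0)) 0 0).
Hypothesis int1 : forall a i, intg (fun w => S 0 w a i).
Hypothesis int2 : forall a i b k, intg (fun w => X 0 w a i b k).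

Let Sm : 'M[R]_(q, r) := \matrix_(a, i) Ex (fun w => S 0 w a i).
Let M a i b k := Ex (fun w => X 0 w a i b k).
Let G := Sm *m D.
Let V := moment_var lam M 0.
Let W := invmx V.
Let H := G^T *m W *m G.

Hypothesis Sm0 : Sm *m lam 0 = 0.
Hypothesis Kid : forall e, 0 < e -> exists2 c, 0 < c &
  forall h, K h -> e <= `|h| -> c <= `|Sm *m lam h|.
Hypothesis uV : V \in unitmx.
Hypothesis Ginj : forall x : 'cV_p, G *m x = 0 -> x = 0.

Definition sample_moment (J : nat) (w : Omega) : 'M[R]_(q, r) :=
  J%:R^-1 *: \sum_(j < J) S j w.

Definition sample_moment_var (J : nat) (w : Omega) (h : 'cV[R]_p) : 'M[R]_q :=
  J%:R^-1 *: \sum_(j < J) ((S j w *m lam h) *m (S j w *m lam h)^T).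

Let Mhat J w a i b k := J%:R^-1 * \sum_(j < J) X j w a i b k.

Lemma moment_var_outer j w h :
  moment_var lam (X j w) h = (S j w *m lam h) *m (S j w *m lam h)^T.
Proof.
apply/matrixP => a b; rewrite !mxE big_ord1 !mxE big_distrlr/=.
by apply: eq_bigr => i _; apply: eq_bigr => k _; rewrite /X; ring.
Qed.

Lemma moment_var_sample J w h :
  moment_var lam (Mhat J w) h = sample_moment_var J w h.
Proof.
apply/matrixP => a b; rewrite /sample_moment_var mxE [RHS]mxE summxE mulr_sumr.
under [RHS]eq_bigr do rewrite -moment_var_outer mxE mulr_sumr.
rewrite [RHS]exchange_big/=; apply: eq_bigr => i _.
under [RHS]eq_bigr do rewrite mulr_sumr.
rewrite [RHS]exchange_big/=; apply: eq_bigr => k _.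
by rewrite /Mhat !mulr_sumr; apply: eq_bigr => j _; ring.
Qed.

Lemma bilin_moment_var (Y : 'I_q -> 'I_r -> 'I_q -> 'I_r -> R) (x : 'cV[R]_q) h :
  bilin (moment_var lam Y h) x x =
  \sum_a \sum_b \sum_i \sum_k (x a 0 * x b 0 * (lam h i 0 * lam h k 0)) * Y a i b k.
Proof.
rewrite /bilin -mulmxA mxE; apply: eq_bigr => a _.
rewrite !mxE mulr_sumr; apply: eq_bigr => b _.
rewrite !mxE mulr_suml mulr_sumr; apply: eq_bigr => i _.
by rewrite mulr_suml mulr_sumr; apply: eq_bigr => k _; ring.
Qed.

Lemma Ex_sqr_moment (x : 'cV[R]_q) :
  intg (fun w => (x^T *m (S 0 w *m lam 0)) 0 0 ^+ 2) /\
  Ex (fun w => (x^T *m (S 0 w *m lam 0)) 0 0 ^+ 2) = bilin V x x.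
Proof.
have E w : (x^T *m (S 0 w *m lam 0)) 0 0 ^+ 2 = bilin (moment_var lam (X 0 w) 0) x x.
  rewrite moment_var_outer /bilin; set u := S 0 w *m lam 0.
  clearbody u.
  have -> : x^T *m (u *m u^T) *m x = (x^T *m u) *m (x^T *m u)^T.
    by rewrite trmx_mul trmxK -!mulmxA.
  by rewrite [RHS]mxE big_ord1 [_^T _ _]mxE expr2.
rewrite (_ : (fun w => _) = fun w => \sum_a \sum_b \sum_i \sum_k
   (x a 0 * x b 0 * (lam 0 i 0 * lam 0 k 0)) * X 0 w a i b k); last first.
  by apply/funext => w; rewrite E bilin_moment_var.
have i4 a b i : intg (fun w => \sum_k (x a 0 * x b 0 * (lam 0 i 0 * lam 0 k 0)) * X 0 w a i b k).
  by apply: intg_sum => k _; exact/intgZ/int2.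
have i3 a b : intg (fun w => \sum_i \sum_k (x a 0 * x b 0 * (lam 0 i 0 * lam 0 k 0)) * X 0 w a i b k).
  by apply: intg_sum => i _; exact: i4.
have i2 a : intg (fun w => \sum_b \sum_i \sum_k (x a 0 * x b 0 * (lam 0 i 0 * lam 0 k 0)) * X 0 w a i b k).
  by apply: intg_sum => b _; exact: i3.
split; first by apply: intg_sum => a _; exact: i2.
rewrite bilin_moment_var Ex_sum => [|a _]; last exact: i2.
apply: eq_bigr => a _; rewrite Ex_sum => [|b _]; last exact: i3.
apply: eq_bigr => b _; rewrite Ex_sum => [|i _]; last exact: i4.
apply: eq_bigr => i _; rewrite Ex_sum => [|k _]; last exact/intgZ/int2.
by apply: eq_bigr => k _; rewrite ExZ//; exact: int2.
Qed.

Lemma Ex_moment (x : 'cV[R]_q) :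
  intg (fun w => (x^T *m (S 0 w *m lam 0)) 0 0) /\
  Ex (fun w => (x^T *m (S 0 w *m lam 0)) 0 0) = 0.
Proof.
have E (A : 'M[R]_(q, r)) : (x^T *m (A *m lam 0)) 0 0 = \sum_a \sum_i (x a 0 * lam 0 i 0) * A a i.
  rewrite mxE; apply: eq_bigr => a _; rewrite !mxE mulr_sumr.
  by apply: eq_bigr => i _; ring.
rewrite (_ : (fun w => _) = fun w => \sum_a \sum_i (x a 0 * lam 0 i 0) * S 0 w a i); last first.
  by apply/funext => w; rewrite E.
have i2 a : intg (fun w => \sum_i (x a 0 * lam 0 i 0) * S 0 w a i).
  by apply: intg_sum => i _; exact/intgZ/int1.
split; first by apply: intg_sum => a _; exact: i2.
transitivity ((x^T *m (Sm *m lam 0)) 0 0); last by rewrite Sm0 mulmx0 mxE.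
rewrite E Ex_sum => [|a _]; last exact: i2.
apply: eq_bigr => a _; rewrite Ex_sum => [|i _]; last exact/intgZ/int1.
by apply: eq_bigr => i _; rewrite ExZ ?mxE//; exact: int1.
Qed.

Lemma moment_var_sym : V^T = V.
Proof.
apply/matrixP => a b; rewrite !mxE exchange_big/=.
apply: eq_bigr => i _; apply: eq_bigr => k _; rewrite mulrC [RHS]mulrC; congr (_ * _).
  by apply: eq_Ex => w; rewrite /X mulrC.
by rewrite mulrC.
Qed.

Lemma moment_var_ge0 x : 0 <= bilin V x x.
Proof. by rewrite -(Ex_sqr_moment x).2; apply: Ex_ge0 => w; exact: sqr_ge0. Qed.

Context (first second : nat -> Omega -> 'cV[R]_p) (k0 : 'I_p).
Hypothesis msecond : forall J, measurable_fun setT (fun w => second J w k0 0).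
Hypothesis first_min : forall J w, K (first J w) /\ forall h, K h ->
  bilin 1%:M (sample_moment J w *m lam (first J w)) (sample_moment J w *m lam (first J w)) <=
  bilin 1%:M (sample_moment J w *m lam h) (sample_moment J w *m lam h).
Hypothesis second_min : forall J w, sample_moment_var J w (first J w) \in unitmx ->
  K (second J w) /\ forall h, K h ->
  bilin (invmx (sample_moment_var J w (first J w)))
    (sample_moment J w *m lam (second J w)) (sample_moment J w *m lam (second J w)) <=
  bilin (invmx (sample_moment_var J w (first J w)))
    (sample_moment J w *m lam h) (sample_moment J w *m lam h).

Let Z (x : 'cV[R]_q) j w := (x^T *m (S j w *m lam 0)) 0 0.

Let iZ x : iid_rv P (Z x). Proof. exact: iS3. Qed.

Let normalized x J w := (Num.sqrt J%:R)^-1 * \sum_(j < J) Z x j w.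

Let normalized_sqr x J : intg (fun w => normalized x J w ^+ 2) /\
  Ex (fun w => normalized x J w ^+ 2) <= bilin V x x.
Proof.
have [i2 E2] := Ex_sqr_moment x; have [i1 E1] := Ex_moment x.
have [iS ES] := Ex_sqr_sum (iZ x) (iota_uniq 0 J) i2 i1 E1.
have E : (fun w => normalized x J w ^+ 2) =
    fun w => J%:R^-1 * (\sum_(j <- iota 0 J) Z x j w) ^+ 2.
  apply/funext => w; rewrite /normalized exprMn exprVn sqr_sqrtr//.
  by rewrite (_ : iota 0 J = index_iota 0 J) ?big_mkord//; rewrite /index_iota subn0.
rewrite E; split; first exact: intgZ.
rewrite ExZ// ES size_iota mulrA E2.
(* At [J = 0] the left side is 0, whence an inequality instead of an equality. *)
case: J {iS ES E} => [|J]; first by rewrite mulr0 mul0r moment_var_ge0.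
by rewrite mulVf ?pnatr_eq0// mul1r.
Qed.

Let avg_vanishing (Y : nat -> Omega -> R) (e : R) : iid_rv P Y -> intg (Y 0) -> 0 < e ->
  vanishing P (fun J => [set w | e < `|J%:R^-1 * (\sum_(j < J) Y j w) - Ex (Y 0)|]).
Proof.
move=> iY i0 e0.
have mB : measurable_fun setT (fun x : R => x - Ex (Y 0)) by apply: measurable_funB.
have iYc := iid_rv_comp iY mB.
have i0c : intg (fun w => Y 0 w - Ex (Y 0)) by apply: intgB => //; exact: intg_cst.
have E0c : Ex (fun w => Y 0 w - Ex (Y 0)) = 0.
  by rewrite ExB ?Ex_cst ?subrr//; exact: intg_cst.
have h := weak_law iYc i0c E0c e0.
apply: vanishingS h.
  move=> J; apply: measurable_gt_norm; apply: measurable_funB => //.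
  apply: measurable_funM => //; apply: measurable_sum => j.
  by have [mY _ _] := iY; exact: mY.
exists 1%N => J J1 w /=; rewrite sumrB mulrBr sumr_const card_ord.
by rewrite -[Ex _ *+ J]mulr_natl mulrA mulVf ?mul1r// pnatr_eq0 -lt0n.
Qed.

(** Off this finite union, the averages of entries and of products of entries lie within [dl] of
    their means, and the deterministic expansion applies pointwise in [w]. *)
Let bad (dl : R) J : set Omega :=
  (\big[setU/set0]_(k : 'I_q * 'I_r)
     [set w | dl < `|J%:R^-1 * (\sum_(j < J) S j w k.1 k.2) - Ex (fun w => S 0 w k.1 k.2)|]) `|`
  (\big[setU/set0]_(k : ('I_q * 'I_r) * ('I_q * 'I_r))
     [set w | dl < `|Mhat J w k.1.1 k.1.2 k.2.1 k.2.2 - M k.1.1 k.1.2 k.2.1 k.2.2|]).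

Let bad_vanishing dl : 0 < dl -> vanishing P (bad dl).
Proof.
move=> dl0; apply: vanishingU; apply: vanishing_bigU => k.
  exact: (avg_vanishing (iS1 _ _) (int1 _ _) dl0).
exact: (avg_vanishing (iS2 _ _ _ _) (int2 _ _ _ _) dl0).
Qed.

Let good_bounds dl J w : 0 < dl -> ~ bad dl J w ->
  `|sample_moment J w - Sm| <= dl /\ forall a i b k, `|Mhat J w a i b k - M a i b k| <= dl.
Proof.
move=> dl0 nb; split.
  apply: ler_norm_entries => [|a i]; first exact: ltW.
  rewrite !mxE summxE leNgt; apply/negP => h; apply: nb; left.
  by rewrite (bigD1 (a, i))//=; left.
move=> a i b k; rewrite leNgt; apply/negP => h; apply: nb; right.
by rewrite (bigD1 ((a, i), (b, k)))//=; left.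
Qed.

(** Off the bad event, the scaled estimator differs from the linear statistic by at most [eps] times
    [sqrt J |g0|], whose second moment is at most [tau] for every [J]; Markov's inequality then
    gives what [slutsky] requires. *)
Theorem gmm_clt : cvg_in_distribution P
  (fun J w => Num.sqrt J%:R * second J w k0 0)
  (normal_prob 0 (Num.sqrt (invmx H k0 k0))).
Proof.
pose x0 : 'cV[R]_q := - (row k0 (gmm_influence G V))^T.
have [i2 E2] := Ex_sqr_moment x0; have [i1 E1] := Ex_moment x0.
have Ev : Ex (fun w => Z x0 0 w ^+ 2) = invmx H k0 k0.
  rewrite E2 /x0.
  by rewrite (gmm_variance_influence moment_var_sym moment_var_ge0 uV Ginj).
have v0 := gmm_variance_gt0 moment_var_sym moment_var_ge0 uV Ginj k0.
have clt := central_limit (iZ x0) i1 E1 i2 Ev v0.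
have mZ x j : measurable_fun setT (Z x j) by have [] := iZ x.
have mN x J : measurable_fun setT (normalized x J).
  by apply: measurable_funM => //; apply: measurable_sum => j; exact: mZ.
have mX J : measurable_fun setT (fun w => Num.sqrt J%:R * second J w k0 0).
  by apply: measurable_funM.
apply: (slutsky mX (mN x0) (normalized_sqr x0)) clt => e e0.
pose tau := \sum_a bilin V (delta_mx a 0) (delta_mx a 0).
have tau0 : 0 <= tau by apply: sumr_ge0 => a _; exact: moment_var_ge0.
have mE J : measurable [set w | e < `|Num.sqrt J%:R * second J w k0 0 - normalized x0 J w|].
  by apply: measurable_gt_norm; exact: measurable_funB.
split=> // eta eta0.
(* Makes [eps^2 tau / e^2] at most [eta / 2]; the cap at 1 allows [eps^2 <= eps]. *)
pose eps := Num.min 1 (e ^+ 2 * (eta / 2) / (tau + 1)).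
have tau10 : 0 < tau + 1 by rewrite ltr_wpDl.
have eps0 : 0 < eps by rewrite lt_min ltr01 divr_gt0// mulr_gt0 ?exprn_gt0// divr_gt0.
have eps0' : 0 <= eps by exact: ltW.
have [dl dl0 core] := two_step_core lamD lamK r00 Kball Sm0 Kid moment_var_sym moment_var_ge0 uV Ginj eps0.
have eta20 : 0 < eta / 2 by rewrite divr_gt0.
have [mbad vbad] := bad_vanishing dl0; have [N NJ] := vbad _ eta20.
exists (maxn N 1) => J; rewrite geq_max => /andP[JN J1].
have J0 : 0 < J%:R :> R by rewrite ltr0n.
have sJ : 0 < Num.sqrt (J%:R : R) by rewrite sqrtr_gt0.
pose T w := \sum_a normalized (delta_mx a 0) J w ^+ 2.
have iT : intg T by apply: intg_sum => a _; exact: (normalized_sqr _ J).1.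
have ET : Ex T <= tau.
  rewrite Ex_sum => [|a _]; last exact: (normalized_sqr _ J).1.
  by apply: ler_sum => a _; exact: (normalized_sqr _ J).2.
have T0 w : 0 <= T w by apply: sumr_ge0 => a _; exact: sqr_ge0.
have mT : measurable [set w | e ^+ 2 < `|eps ^+ 2 * T w|].
  by apply: measurable_gt_norm; apply: measurable_funM => //; exact: intg_measurable iT.
set F := [set w | e ^+ 2 < `|eps ^+ 2 * T w|] in mT.
apply: (@le_trans _ _ (P (bad dl J `|` F))).
  apply: le_measure; rewrite ?inE//; first exact: measurableU.
  move=> w /= ew; have [|nb] := pselect (bad dl J w); [by left|right].
  have [g1 g2] := good_bounds dl0 nb.
  have [Kf fmin] := first_min J w.
  have smin := @second_min J w; rewrite -moment_var_sample in smin.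
  have := core _ _ _ _ g1 g2 Kf fmin smin.
  set g0 := sample_moment J w *m lam 0 => h.
  have gE x : normalized x J w = Num.sqrt J%:R * (x^T *m g0) 0 0.
    rewrite /normalized /g0 /sample_moment -scalemxAl -scalemxAr mxE mulmx_suml mulmx_sumr summxE.
    rewrite mulrA; congr (_ * _).
    have := @sqr_sqrtr _ (J%:R : R) (ltW J0); move: sJ; set z := Num.sqrt _ => z0 <-.
    by field; rewrite gt_eqF.
  have XA : Num.sqrt J%:R * second J w k0 0 - normalized x0 J w =
      Num.sqrt J%:R * (second J w + gmm_influence G V *m g0) k0 0.
    rewrite gE -mulrBr; congr (_ * _).
    rewrite [RHS]mxE; congr (_ + _).
    by rewrite /x0 linearN/= trmxK mulNmx mxE opprK -row_mul mxE.
  have g0T : J%:R * `|g0| ^+ 2 <= T w.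
    apply: le_trans (ler_wpM2l (ltW J0) (sqr_norm_le_dot g0)) _.
    rewrite mxE mulr_sumr; apply: ler_sum => a _.
    rewrite gE exprMn sqr_sqrtr ?(ltW J0)// trmx_delta -rowE !mxE.
    by rewrite expr2.
  rewrite /F/= ger0_norm ?mulr_ge0 ?sqr_ge0//.
  apply: (@lt_le_trans _ _ (eps ^+ 2 * (J%:R * `|g0| ^+ 2))); last first.
    by rewrite ler_wpM2l ?sqr_ge0.
  rewrite (_ : _ * _ = (Num.sqrt J%:R * (eps * `|g0|)) ^+ 2); last first.
    by rewrite !exprMn sqr_sqrtr ?(ltW J0)//; ring.
  rewrite ltrXn2r ?nnegrE ?(ltW e0)//=; apply: lt_le_trans ew _.
  rewrite XA normrM (gtr0_norm sJ) ler_wpM2l ?(ltW sJ)//.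
  exact: le_trans (ler_entry_norm _ _ _) h.
apply: (le_trans (measureU2 P (mbad J) mT)).
rewrite (_ : eta = eta / 2 + eta / 2); last by lra.
rewrite EFinD; apply: leeD; first exact: NJ.
apply: (@le_trans _ _ (Ex (fun w => eps ^+ 2 / e ^+ 2 * T w))%:E).
  apply: prob_le_Ex => //; first exact: intgZ.
    by move=> w; rewrite mulr_ge0// divr_ge0 ?sqr_ge0.
  move=> w; rewrite /F/= ger0_norm ?mulr_ge0 ?sqr_ge0// => /ltW h.
  by rewrite mulrAC ler_pdivlMr ?exprn_gt0// mul1r.
rewrite lee_fin ExZ//; apply: (@le_trans _ _ (eps ^+ 2 / e ^+ 2 * tau)).
  by rewrite ler_wpM2l// divr_ge0 ?sqr_ge0.
rewrite mulrAC ler_pdivrMr ?exprn_gt0//.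
apply: (@le_trans _ _ (eps * (tau + 1))).
  rewrite expr2; apply: ler_pM => //; rewrite ?mulr_ge0 ?(ltW eps0)//.
    by rewrite ler_piMr ?(ltW eps0)// ge_min lexx.
  by rewrite lerDl.
apply: (@le_trans _ _ (e ^+ 2 * (eta / 2) / (tau + 1) * (tau + 1))).
  by rewrite ler_wpM2r ?(ltW tau10)// ge_min lexx orbT.
by rewrite divfK ?gt_eqF// mulrC.
Qed.

End gmm_limit.

(** * Interpolation of polynomial moment functions *)

(* The nodes [x] are chosen so that the rank of their matrix is maximal. *)
Lemma finite_interpolation (R : fieldType) (A : Type) n (psi : A -> 'rV[R]_n) :
  exists r (x : 'I_r -> A), forall y,
    psi y = psi y *m pinvmx (\matrix_i psi (x i)) *m \matrix_i psi (x i).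
Proof.
pose Q k := `[< exists r (x : 'I_r -> A), \rank (\matrix_i psi (x i)) = k >].
have exQ : exists k, Q k.
  exists (\rank (\matrix_(i < 0) (0 : 'rV[R]_n))); apply/asboolP; exists 0%N.
  have x (i : 'I_0) : A by case: i.
  by exists x; congr mxrank; apply/matrixP => -[].
have bQ k : Q k -> (k <= n)%N by move=> /asboolP[r [x <-]]; exact: rank_leq_col.
case: (ex_maxnP exQ bQ) => k /asboolP[r [x rk]] kmax.
exists r, x => y; set Psi := \matrix_i _; apply/esym/mulmxKpV.
pose x' (i : 'I_(r + 1)) := if fintype.split i is inl j then x j else y.
have E : \matrix_i psi (x' i) = col_mx Psi (psi y).
  apply/row_matrixP => i; rewrite rowK /x' -[in RHS](splitK i).
  case: (fintype.split i) => j /=.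
    by rewrite rowKu rowK.
  by rewrite rowKd ord1 row_id.
have le : (\rank (col_mx Psi (psi y)) <= \rank Psi)%N.
  by rewrite rk; apply: kmax; apply/asboolP; exists (r + 1)%N, x'; rewrite E.
have sub : (Psi <= col_mx Psi (psi y))%MS by rewrite -{1}addsmxE addsmxSl.
have : (col_mx Psi (psi y) <= Psi)%MS.
  have [le1 E1] := mxrank_leqif_sup sub.
  by rewrite -E1 eqn_leq le1 le.
by rewrite col_mx_sub => /andP[].
Qed.

(** Derivatives of the moment functions are read off quadratic remainder bounds, which hold for
    polynomials and survive sums and expectations. *)
Lemma derive1_quadratic_bound (R : realType) (f : R -> R) (x l C : R) :
  (forall t, `|t| <= 1 -> `|f (x + t) - f x - t * l| <= C * t ^+ 2) ->
  derive1 f x = l.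
Proof.
move=> fC; rewrite /derive1; apply: cvg_lim => //.
have C0 : 0 <= C.
  by have := fC 1; rewrite normr1 lexx expr1n mulr1 => /(_ isT); exact: le_trans.
apply/cvgrPdist_le => e e0; near=> t.
have t0 : t != 0 by near: t; exact: nbhs_dnbhs_neq.
have t1 : `|t| <= Num.min 1 (e / (C + 1)).
  near: t; apply: nbhs_dnbhs.
  have m0 : 0 < Num.min 1 (e / (C + 1)) :> R by rewrite lt_min ltr01 divr_gt0// ltr_wpDl.
  have := @nbhsx_ballx R R^o 0 _ m0; apply: filterS => u.
  by rewrite /ball/= sub0r normrN => /ltW.
move: t1; rewrite le_min => /andP[t1 t2].
have nt : 0 < `|t| by rewrite normr_gt0.
rewrite -(ler_pM2l nt) -normrM.
have -> : t * (l - t^-1 *: (f (t + x) - f x)) = - (f (x + t) - f x - t * l).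
  by rewrite /GRing.scale/= [t + x]addrC; field.
rewrite normrN; apply: le_trans (fC _ t1) _.
rewrite -real_normK ?num_real// expr2 mulrA mulrC ler_pM2l//.
apply: (@le_trans _ _ ((C + 1) * (e / (C + 1)))).
  by apply: ler_pM => //; rewrite lerDl.
by rewrite mulrC divfK// gt_eqF// ltr_wpDl.
Unshelve. all: by end_near.
Qed.

Section cubic.
Context (R : realType) (p : nat).
Implicit Types (f g : 'cV[R]_p -> R) (h : 'cV[R]_p).

Definition affine f := exists c0 (c : 'rV[R]_p), forall h, f h = c0 + (c *m h) 0 0.

Lemma affine_cst c : affine (fun=> c).
Proof. by exists c, 0 => h; rewrite mul0mx mxE addr0. Qed.

Lemma affine_coord a : affine (fun h => h a 0).
Proof. by exists 0, (delta_mx 0 a) => h; rewrite -rowE mxE add0r. Qed.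

Lemma affineD f g : affine f -> affine g -> affine (fun h => f h + g h).
Proof.
move=> [a [u fE]] [b [v gE]]; exists (a + b), (u + v) => h.
by rewrite fE gE mulmxDl [(_ + _ : matrix _ _ _) 0 0]mxE; ring.
Qed.

Lemma affineZ k f : affine f -> affine (fun h => k * f h).
Proof.
move=> [a [u fE]]; exists (k * a), (k *: u) => h.
by rewrite fE -scalemxAl [(_ *: (_ : matrix _ _ _)) 0 0]mxE; ring.
Qed.

Lemma affine_sum (I : Type) (s : seq I) (Q : pred I) (F : I -> 'cV[R]_p -> R) :
  (forall i, affine (F i)) -> affine (fun h => \sum_(i <- s | Q i) F i h).
Proof.
move=> aF; elim: s => [|i s IH].
  by under eq_fun do rewrite big_nil; exact: affine_cst.
under eq_fun do rewrite big_cons.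
by case: (Q i) => //; exact: affineD.
Qed.

(** The leading coordinate 1 turns polynomials of degree at most 3 into cubic forms. *)
Definition homogenize h : 'cV[R]_(1 + p) := col_mx 1%:M h.

Definition cubic f := exists c : 'I_(1 + p) -> 'I_(1 + p) -> 'I_(1 + p) -> R,
  forall h, f h = \sum_a \sum_b \sum_e
    c a b e * (homogenize h a 0 * homogenize h b 0 * homogenize h e 0).

Lemma affine_homogenize f : affine f ->
  exists c : 'I_(1 + p) -> R, forall h, f h = \sum_a c a * homogenize h a 0.
Proof.
move=> [c0 [c fE]]; exists (fun a => row_mx c0%:M c 0 a) => h.
rewrite fE; transitivity ((row_mx c0%:M c *m homogenize h) 0 0); last by rewrite mxE.
by rewrite mul_row_col mulmx1 !mxE eqxx.
Qed.

Lemma cubicM3 f g k : affine f -> affine g -> affine k ->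
  cubic (fun h => f h * g h * k h).
Proof.
move=> /affine_homogenize[u fE] /affine_homogenize[v gE] /affine_homogenize[w kE].
exists (fun a b e => u a * v b * w e) => h; rewrite fE gE kE.
rewrite big_distrlr/= mulr_suml; apply: eq_bigr => a _.
rewrite mulr_suml; apply: eq_bigr => b _.
rewrite mulr_sumr; apply: eq_bigr => e _; ring.
Qed.

Lemma cubicM f g : affine f -> affine g -> cubic (fun h => f h * g h).
Proof.
move=> af ag; have := cubicM3 af ag (affine_cst 1).
by under eq_fun do rewrite mulr1.
Qed.

Lemma affine_cubic f : affine f -> cubic f.
Proof.
by move=> af; have := cubicM af (affine_cst 1); under eq_fun do rewrite mulr1.
Qed.

Lemma cubicD f g : cubic f -> cubic g -> cubic (fun h => f h + g h).
Proof.
move=> [u fE] [v gE]; exists (fun a b e => u a b e + v a b e) => h.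
rewrite fE gE -big_split/=; apply: eq_bigr => a _.
rewrite -big_split/=; apply: eq_bigr => b _.
by rewrite -big_split/=; apply: eq_bigr => e _; rewrite mulrDl.
Qed.

Lemma cubicZ k f : cubic f -> cubic (fun h => k * f h).
Proof.
move=> [u fE]; exists (fun a b e => k * u a b e) => h.
rewrite fE mulr_sumr; apply: eq_bigr => a _.
rewrite mulr_sumr; apply: eq_bigr => b _.
by rewrite mulr_sumr; apply: eq_bigr => e _; rewrite mulrA.
Qed.

Lemma cubic_sum (I : Type) (s : seq I) (Q : pred I) (F : I -> 'cV[R]_p -> R) :
  (forall i, cubic (F i)) -> cubic (fun h => \sum_(i <- s | Q i) F i h).
Proof.
move=> aF; elim: s => [|i s IH].
  by under eq_fun do rewrite big_nil; exact/affine_cubic/affine_cst.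
under eq_fun do rewrite big_cons.
by case: (Q i) => //; exact: cubicD.
Qed.

(** [Q] must be closed under products although [cubic] is not: the properties concerned hold for
    polynomials of every degree, and monomials are products of coordinates. *)
Lemma cubic_ind (Q : ('cV[R]_p -> R) -> Prop) :
  (forall c, Q (fun=> c)) -> (forall a, Q (fun h => h a 0)) ->
  (forall f g, Q f -> Q g -> Q (fun h => f h + g h)) ->
  (forall f g, Q f -> Q g -> Q (fun h => f h * g h)) ->
  forall f, cubic f -> Q f.
Proof.
move=> Qc Qx QD QM f [c fE]; rewrite (funext fE : f = _).
have Qs (I : finType) (F : I -> 'cV[R]_p -> R) : (forall i, Q (F i)) ->
    Q (fun h => \sum_i F i h).
  move=> QF; elim: (index_enum I) => [|i s IH].
    by under eq_fun do rewrite big_nil; exact: Qc.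
  by under eq_fun do rewrite big_cons; exact: QD.
have Qh a : Q (fun h => homogenize h a 0).
  rewrite /homogenize -(@splitK 1 p a); case: (fintype.split a) => i /=.
    by under eq_fun do rewrite col_mxEu; exact: Qc.
  by under eq_fun do rewrite col_mxEd; exact: Qx.
apply: (Qs _ (fun a h => _)) => a; apply: (Qs _ (fun b h => _)) => b.
apply: (Qs _ (fun e h => _)) => e.
by apply: (QM (fun=> _) (fun h => _ * _)) => //; apply: (QM (fun h => _ * _)) => //; exact: QM.
Qed.

Lemma cubic_bounded f (B : R) : cubic f -> exists C, forall h, `|h| <= B -> `|f h| <= C.
Proof.
move=> cf; move: f cf; apply: cubic_ind.
- by move=> c; exists `|c|.
- by move=> a; exists B => h; exact: le_trans (ler_entry_norm _ _ _).
- move=> f g [C fC] [D gD]; exists (C + D) => h hB.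
  by apply: le_trans (ler_normD _ _) (lerD (fC _ hB) (gD _ hB)).
- move=> f g [C fC] [D gD]; exists (C * D) => h hB.
  by rewrite normrM; apply: ler_pM => //; [exact: fC|exact: gD].
Qed.

Lemma cubic_continuous f : cubic f -> continuous f.
Proof.
move=> cf; move: f cf; apply: cubic_ind.
- by move=> c; exact: cst_continuous.
- by move=> a; exact: coord_continuous.
- by move=> f g cf cg x; apply: continuousD; [exact: cf|exact: cg].
- by move=> f g cf cg x; apply: continuousM; [exact: cf|exact: cg].
Qed.

(** Product rule with remainder: on the unit ball each factor is Lipschitz at 0, so the product of
    two increments is of second order. *)
Lemma cubic_expansion f : cubic f -> exists (D : 'rV[R]_p) (C : R), forall h, `|h| <= 1 ->
  `|f h - f 0 - (D *m h) 0 0| <= C * `|h| ^+ 2.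
Proof.
move=> cf; move: f cf; apply: cubic_ind.
- by move=> c; exists 0, 0 => h h1; rewrite mul0mx mxE subrr subr0 normr0 mul0r.
- move=> a; exists (delta_mx 0 a), 0 => h h1.
  by rewrite -rowE !mxE subr0 subrr normr0 mul0r.
- move=> f g [D [C fC]] [D' [C' gC]]; exists (D + D'), (C + C') => h h1.
  rewrite mulmxDl mxE (_ : _ - _ = (f h - f 0 - (D *m h) 0 0) + (g h - g 0 - (D' *m h) 0 0)); last by ring.
  by apply: le_trans (ler_normD _ _) _; rewrite mulrDl; apply: lerD; [exact: fC|exact: gC].
- have aux f D (C : R) : (forall h, `|h| <= 1 -> `|f h - f 0 - (D *m h) 0 0| <= C * `|h| ^+ 2) ->
      forall h, `|h| <= 1 -> `|f h - f 0| <= (`|C| + p%:R * `|D|) * `|h|.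
    move=> fC h h1; rewrite -[f h - f 0](subrK ((D *m h) 0 0)).
    apply: le_trans (ler_normD _ _) _; rewrite mulrDl; apply: lerD.
      apply: le_trans (fC _ h1) _; apply: (@le_trans _ _ (`|C| * `|h| ^+ 2)).
        by rewrite ler_wpM2r ?sqr_ge0// ler_norm.
      by rewrite ler_wpM2l// expr2 ler_piMr.
    by apply: le_trans (ler_entry_norm _ _ _) _; exact: ler_norm_mulmx.
  move=> f g [D [C fC]] [D' [C' gC]].
  exists (f 0 *: D' + g 0 *: D), (`|f 0| * `|C'| + `|g 0| * `|C| +
    (`|C| + p%:R * `|D|) * (`|C'| + p%:R * `|D'|)) => h h1.
  rewrite (_ : _ - _ = f 0 * (g h - g 0 - (D' *m h) 0 0) + g 0 * (f h - f 0 - (D *m h) 0 0)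
     + (f h - f 0) * (g h - g 0)); last first.
    by rewrite mulmxDl -!scalemxAl !mxE; ring.
  apply: le_trans (ler_normD _ _) _; rewrite [leRHS]mulrDl; apply: lerD.
    apply: le_trans (ler_normD _ _) _; rewrite [leRHS]mulrDl; apply: lerD; rewrite normrM -mulrA ler_wpM2l//.
      by apply: le_trans (gC _ h1) _; rewrite ler_wpM2r ?sqr_ge0// ler_norm.
    by apply: le_trans (fC _ h1) _; rewrite ler_wpM2r ?sqr_ge0// ler_norm.
  rewrite normrM expr2 mulrACA; apply: ler_pM => //; first exact: (aux _ _ _ _ fC).
  exact: (aux _ _ _ _ gC).
Qed.

(** Finite interpolation for the vector [psi] of all monomials: every cubic polynomial is a linear
    functional of [psi], so one set of nodes and weights serves all of them. The weights are
    combinations of monomials, hence cubic. *)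
Lemma cubic_interpolation : exists r (x : 'I_r -> 'cV[R]_p) (lam : 'cV[R]_p -> 'cV[R]_r),
  (forall f, cubic f -> forall h, f h = \sum_i lam h i 0 * f (x i)) /\
  forall i, cubic (fun h => lam h i 0).
Proof.
pose I := ('I_(1 + p) * 'I_(1 + p) * 'I_(1 + p))%type.
pose mono (i : I) h := homogenize h i.1.1 0 * homogenize h i.1.2 0 * homogenize h i.2 0.
pose psi h : 'rV[R]_#|{: I}| := \row_l mono (enum_val l) h.
have [r [x xE]] := finite_interpolation psi.
have sumE (F : I -> R) : \sum_a \sum_b \sum_e F (a, b, e) = \sum_i F i.
  rewrite pair_big/= pair_big/=; apply: eq_bigr => -[[a b] e] _ //.
have monoE f : cubic f -> exists u : 'cV[R]_#|{: I}|, forall h, f h = (psi h *m u) 0 0.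
  move=> [c fE]; exists (\col_l c (enum_val l).1.1 (enum_val l).1.2 (enum_val l).2) => h.
  rewrite fE (sumE (fun i => c i.1.1 i.1.2 i.2 * mono i h)) mxE.
  rewrite (reindex_onto (@enum_val I predT) enum_rank)/=; last by move=> i _; rewrite enum_rankK.
  by apply: eq_big => [i|i _]; rewrite ?enum_valK ?eqxx// !mxE mulrC.
have cmono i : cubic (mono i).
  exists (fun a b e => ((a, b, e) == i)%:R) => h.
  rewrite (sumE (fun j => (j == i)%:R * mono j h)) (bigD1 i)//= eqxx mul1r big1 ?addr0//.
  by move=> j /negbTE ->; rewrite mul0r.
exists r, x, (fun h => (psi h *m pinvmx (\matrix_i psi (x i)))^T); split.
  move=> f /monoE[u fE] h; rewrite fE {1}xE -[_ *m _ *m u]mulmxA mxE.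
  apply: eq_bigr => i _; rewrite [in RHS]mxE fE; congr (_ * _).
  rewrite [LHS]mxE [RHS]mxE; apply: eq_bigr => l _; congr (_ * _).
  by rewrite !mxE.
move=> i; rewrite (_ : (fun h => _) = fun h =>
    \sum_l (pinvmx (\matrix_i psi (x i))) l i * mono (enum_val l) h).
  by apply: cubic_sum => l; exact: cubicZ.
by apply/funext => h; rewrite !mxE; apply: eq_bigr => l _; rewrite !mxE mulrC.
Qed.

End cubic.

Lemma mxDE (R : nmodType) m n (A B : 'M[R]_(m, n)) i j : (A + B) i j = A i j + B i j.
Proof. by rewrite mxE. Qed.

Lemma mxBE (R : zmodType) m n (A B : 'M[R]_(m, n)) i j : (A - B) i j = A i j - B i j.
Proof. by rewrite !mxE. Qed.

Lemma mxNE (R : zmodType) m n (A : 'M[R]_(m, n)) i j : (- A) i j = - A i j.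
Proof. by rewrite mxE. Qed.

Lemma mxZE (R : pzRingType) m n k (A : 'M[R]_(m, n)) i j : (k *: A) i j = k * A i j.
Proof. by rewrite mxE. Qed.

(** * GMM with cubic moment functions *)

Section cubic_gmm.
Context d (Omega : measurableType d) (R : realType) (P : probability Omega R).
Local Notation Ex := (Ex P).
Local Notation intg := (intg P).
Context (p q : nat) (m : nat -> Omega -> 'cV[R]_p -> 'cV[R]_q).
Hypothesis m_cubic : forall j w a, cubic (fun h => m j w h a 0).
Hypothesis m_intg : forall a h, intg (fun w => m 0 w h a 0).

Definition moment_mean (h : 'cV[R]_p) : 'cV[R]_q := \col_a Ex (fun w => m 0 w h a 0).
Definition moment_jacobian : 'M[R]_(q, p) :=
  \matrix_(a, c) Ex (fun w => derive1 (fun t : R => m 0 w (t *: delta_mx c 0) a 0) 0).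

(** The random part of the moment function is the matrix of its node values; the dependence on [h]
    sits in the non-random [lam]. Expectation and differentiation in [h] act on different factors
    and commute without an envelope for the derivative. *)
Lemma moment_interpolation : exists r (x : 'I_r -> 'cV[R]_p) (lam : 'cV[R]_p -> 'cV[R]_r)
    (D : 'M[R]_(r, p)) (C2 : R),
  [/\ forall j w h, m j w h = (\matrix_(a, i) m j w (x i) a 0) *m lam h,
      forall i, cubic (fun h => lam h i 0),
      forall h, `|h| <= 1 -> `|lam h - lam 0 - D *m h| <= C2 * `|h| ^+ 2,
      (forall h, moment_mean h = (\matrix_(a, i) Ex (fun w => m 0 w (x i) a 0)) *m lam h) &
      moment_jacobian = (\matrix_(a, i) Ex (fun w => m 0 w (x i) a 0)) *m D].
Proof.
have [r [x [lam [lamE clam]]]] := @cubic_interpolation R p.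
have /choice[D0 /choice[C0 DC]] := fun i => cubic_expansion (clam i).
pose D := \matrix_i D0 i; pose C2 := \sum_i `|C0 i|.
have lamD h : `|h| <= 1 -> `|lam h - lam 0 - D *m h| <= C2 * `|h| ^+ 2.
  move=> h1; apply: ler_norm_entries => [|i k].
    by rewrite mulr_ge0 ?sqr_ge0// sumr_ge0.
  rewrite ord1; have := DC i h h1.
  have -> : (lam h - lam 0 - D *m h) i 0 = lam h i 0 - lam 0 i 0 - (D0 i *m h) 0 0.
    rewrite !mxE; congr (_ - _); apply: eq_bigr => l _.
    by rewrite !mxE.
  move=> le; apply: le_trans le _; rewrite ler_wpM2r ?sqr_ge0//.
  by apply: le_trans (ler_norm _) _; rewrite /C2 (bigD1 i)//= lerDl sumr_ge0.
have mE j w h : m j w h = (\matrix_(a, i) m j w (x i) a 0) *m lam h.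
  apply/colP => a; rewrite (lamE _ (m_cubic j w a)) mxE.
  by apply: eq_bigr => i _; rewrite mxE mulrC.
exists r, x, lam, D, C2; split => //.
  move=> h; apply/colP => a; rewrite !mxE.
  under eq_Ex do rewrite (lamE _ (m_cubic _ _ _)).
  rewrite Ex_sum => [|i _]; last exact: intgZ.
  by apply: eq_bigr => i _; rewrite ExZ// mxE mulrC.
apply/matrixP => a c; rewrite !mxE.
have dE w : derive1 (fun t : R => m 0 w (t *: delta_mx c 0) a 0) 0 =
    \sum_i m 0 w (x i) a 0 * D i c.
  apply: (@derive1_quadratic_bound _ _ _ _
     (r%:R * `|\matrix_(a, i) m 0 w (x i) a 0| * `|C2| * `|delta_mx c 0 : 'cV[R]_p| ^+ 2)) => t t1.
  rewrite add0r scale0r !mE.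
  set A := \matrix_(_, _) _; set e := delta_mx c 0.
  have e1 : `|e| <= 1.
    by apply: ler_norm_entries => // i k; rewrite mxE; case: (_ && _); rewrite ?normr1 ?normr0.
  have -> : (A *m lam (t *: e)) a 0 - (A *m lam 0) a 0 - t * \sum_i m 0 w (x i) a 0 * D i c =
      (A *m (lam (t *: e) - lam 0 - D *m (t *: e))) a 0.
    rewrite !mulmxBr !mxBE; congr (_ - _).
    rewrite -scalemxAr -scalemxAr mulmxA mxZE -colE; congr (_ * _).
    by rewrite !mxE; apply: eq_bigr => i _; rewrite !mxE.
  apply: le_trans (ler_entry_norm _ _ _) _; apply: le_trans (ler_norm_mulmx _ _) _.
  have te : `|t *: e| <= 1 by rewrite normrZ mulr_ile1.
  apply: (@le_trans _ _ (r%:R * `|A| * (`|C2| * `|t *: e| ^+ 2))).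
    rewrite ler_wpM2l ?mulr_ge0//; apply: le_trans (lamD _ te) _.
    by rewrite ler_wpM2r ?sqr_ge0// ler_norm.
  by rewrite normrZ exprMn real_normK ?num_real// le_eqVlt; apply/orP; left; apply/eqP; ring.
under eq_Ex do rewrite dE.
rewrite Ex_sum => [|i _].
  apply: eq_bigr => i _; set y := D i c.
  under eq_Ex do rewrite mulrC.
  by rewrite ExZ// mulrC [in RHS]mxE.
by under eq_fun do rewrite mulrC; exact: intgZ.
Qed.

Lemma moment_mean_expansion : exists C : R, forall h, `|h| <= 1 ->
  `|moment_mean h - moment_mean 0 - moment_jacobian *m h| <= C * `|h| ^+ 2.
Proof.
have [r [x [lam [D [C2 [_ _ lamD mE ->]]]]]] := moment_interpolation.
set A := \matrix_(_, _) _ in mE *; exists (r%:R * `|A| * C2) => h h1.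
rewrite !mE -mulmxA -!mulmxBr; apply: le_trans (ler_norm_mulmx _ _) _.
by rewrite -[leRHS]mulrA ler_wpM2l ?mulr_ge0//; exact: lamD.
Qed.

(** Reads the Jacobian off the mean when the mean is affine along a ray, so that the integrands need
    not be differentiated. The step [t] is small enough for the quadratic remainder, divided by [t],
    to fall below [e]. *)
Lemma moment_jacobianE (c : 'rV[R]_q) (h : 'cV[R]_p) (y : R) :
  (forall t, (c *m moment_mean (t *: h)) 0 0 = (c *m moment_mean 0) 0 0 + t * y) ->
  (c *m moment_jacobian *m h) 0 0 = y.
Proof.
move=> cE; have [C hC] := moment_mean_expansion.
have [h0|h0] := eqVneq h 0.
  have := cE 1; rewrite h0 scaler0 mul1r => E.
  rewrite mulmx0 mxE; apply: (addrI ((c *m moment_mean 0) 0 0)).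
  by rewrite -E addr0.
have nh : 0 < `|h| by rewrite normr_gt0.
apply/eqP; rewrite -subr_eq0 -normr_le0; apply/ler_addgt0Pr => e e0; rewrite add0r.
pose B := q%:R * `|c| * `|C| * `|h| ^+ 2.
have B0 : 0 <= B by rewrite !mulr_ge0// sqr_ge0.
pose t := Num.min `|h|^-1 (e / (B + 1)).
have B1 : 0 < B + 1 by rewrite ltr_wpDl.
have t0 : 0 < t by rewrite lt_min invr_gt0 nh divr_gt0.
have th : `|t *: h| <= 1.
  by rewrite normrZ gtr0_norm// -ler_pdivlMr// div1r ge_min lexx.
have := ler_entry_norm (c *m (moment_mean (t *: h) - moment_mean 0 - moment_jacobian *m (t *: h))) 0 0.
have -> : (c *m (moment_mean (t *: h) - moment_mean 0 - moment_jacobian *m (t *: h))) 0 0 =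
    t * (y - (c *m moment_jacobian *m h) 0 0).
  by rewrite !mulmxBr !mxBE cE -scalemxAr -scalemxAr mulmxA mxZE; ring.
move=> le; have {le} := le_trans le (ler_norm_mulmx _ _).
rewrite normrM gtr0_norm// => le.
have {le} : t * `|y - (c *m moment_jacobian *m h) 0 0| <= t * (t * B).
  apply: le_trans le _; rewrite /B.
  apply: (@le_trans _ _ (q%:R * `|c| * (`|C| * `|t *: h| ^+ 2))).
    rewrite ler_wpM2l ?mulr_ge0//; apply: le_trans (hC _ th) _.
    by rewrite ler_wpM2r ?sqr_ge0// ler_norm.
  rewrite normrZ exprMn gtr0_norm// le_eqVlt; apply/orP; left; apply/eqP; ring.
rewrite ler_pM2l// distrC => le; apply: le_trans le _.
apply: (@le_trans _ _ (e / (B + 1) * (B + 1))); last by rewrite divfK ?gt_eqF.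
apply: ler_pM => //; first exact: ltW.
  by rewrite ge_min lexx orbT.
by rewrite lerDl.
Qed.

Lemma moment_mean_cubic a : cubic (fun h => moment_mean h a 0).
Proof.
have [r [x [lam [D [C2 [_ clam _ mE _]]]]]] := moment_interpolation.
set A := \matrix_(_, _) _ in mE.
rewrite (_ : (fun h => _) = fun h => \sum_i A a i * lam h i 0).
  by apply: cubic_sum => i; exact: cubicZ.
by apply/funext => h; rewrite mE [LHS]mxE.
Qed.

Hypothesis m_iid1 : forall (c : 'rV_q) h, iid_rv P (fun j w => (c *m m j w h) 0 0).
Hypothesis m_iid2 : forall a h b h', iid_rv P (fun j w => m j w h a 0 * m j w h' b 0).
Hypothesis m_intg2 : forall a h b h', intg (fun w => m 0 w h a 0 * m 0 w h' b 0).
Context (K : set 'cV[R]_p) (r0 : R).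
Hypothesis r00 : 0 < r0.
Hypothesis Kball : forall h, `|h| <= r0 -> K h.
Hypothesis Kcompact : compact K.
Hypothesis mean0 : moment_mean 0 = 0.
Hypothesis ident : forall h, K h -> moment_mean h = 0 -> h = 0.

Definition moment_second : 'M[R]_q := \matrix_(a, b) Ex (fun w => m 0 w 0 a 0 * m 0 w 0 b 0).

Hypothesis uV : moment_second \in unitmx.
Hypothesis Ginj : forall x : 'cV_p, moment_jacobian *m x = 0 -> x = 0.

Definition moment_avg J w h : 'cV[R]_q := J%:R^-1 *: \sum_(j < J) m j w h.
Definition moment_second_avg J w h : 'M[R]_q :=
  J%:R^-1 *: \sum_(j < J) (m j w h *m (m j w h)^T).

Context (first second : nat -> Omega -> 'cV[R]_p) (k0 : 'I_p).
Hypothesis msecond : forall J, measurable_fun setT (fun w => second J w k0 0).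
Hypothesis first_min : forall J w, K (first J w) /\ forall h, K h ->
  bilin 1%:M (moment_avg J w (first J w)) (moment_avg J w (first J w)) <=
  bilin 1%:M (moment_avg J w h) (moment_avg J w h).
Hypothesis second_min : forall J w, moment_second_avg J w (first J w) \in unitmx ->
  K (second J w) /\ forall h, K h ->
  bilin (invmx (moment_second_avg J w (first J w)))
    (moment_avg J w (second J w)) (moment_avg J w (second J w)) <=
  bilin (invmx (moment_second_avg J w (first J w))) (moment_avg J w h) (moment_avg J w h).

Let efficient_variance :=
  invmx (moment_jacobian^T *m invmx moment_second *m moment_jacobian) k0 k0.

Lemma moment_second_sym : moment_second^T = moment_second.
Proof. by apply/matrixP => a b; rewrite !mxE; apply: eq_Ex => w; rewrite mulrC. Qed.

Lemma bilin_moment_second x : intg (fun w => (x^T *m m 0 w 0) 0 0 ^+ 2) /\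
  bilin moment_second x x = Ex (fun w => (x^T *m m 0 w 0) 0 0 ^+ 2).
Proof.
have E : (fun w => (x^T *m m 0 w 0) 0 0 ^+ 2) =
    fun w => \sum_a \sum_b (x a 0 * x b 0) * (m 0 w 0 a 0 * m 0 w 0 b 0).
  apply/funext => w; rewrite expr2 mxE big_distrlr/=; apply: eq_bigr => a _.
  by apply: eq_bigr => b _; rewrite !mxE; ring.
have i1 a : intg (fun w => \sum_b (x a 0 * x b 0) * (m 0 w 0 a 0 * m 0 w 0 b 0)).
  by apply: intg_sum => b _; exact: intgZ.
rewrite E; split; first by apply: intg_sum => a _; exact: i1.
rewrite Ex_sum// /bilin -mulmxA mxE; apply: eq_bigr => a _.
rewrite Ex_sum => [|b _]; last exact: intgZ.
rewrite !mxE mulr_sumr; apply: eq_bigr => b _.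
by rewrite !mxE ExZ//; ring.
Qed.

Lemma moment_second_ge0 x : 0 <= bilin moment_second x x.
Proof. by rewrite (bilin_moment_second x).2; apply: Ex_ge0 => w; exact: sqr_ge0. Qed.

Lemma efficient_variance_gt0 : 0 < efficient_variance.
Proof. exact: gmm_variance_gt0 moment_second_sym moment_second_ge0 uV Ginj k0. Qed.

(* Gauss-Markov: [bilin V a y = bilin V y y] for [y = V^-1 G H^-1 e], so that the
   claim is the Cauchy-Schwarz inequality for [V]. *)
Lemma efficient_variance_min (a : 'cV[R]_q) :
  a^T *m moment_jacobian = (delta_mx k0 0 : 'cV_p)^T ->
  efficient_variance <= bilin moment_second a a.
Proof.
move=> aG; have uH := gmm_hessian_unit moment_second_sym moment_second_ge0 uV Ginj.
have sH := gmm_hessian_sym moment_jacobian moment_second_sym.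
have sW := gmm_weight_sym moment_second_sym.
set G := moment_jacobian in aG uH sH *; set V := moment_second in uH sH sW *.
set H := G^T *m invmx V *m G in uH sH *.
pose e : 'cV[R]_p := delta_mx k0 0.
pose y := invmx V *m (G *m (invmx H *m e)).
have eHe : (e^T *m (invmx H *m e)) 0 0 = efficient_variance.
  by rewrite /e trmx_delta -rowE -colE !mxE.
have ay : bilin V a y = efficient_variance.
  rewrite /bilin -[LHS]/((_ *m _) 0 0) -mulmxA /y [V *m (_ *m _)]mulmxA mulmxV// mul1mx.
  by rewrite mulmxA aG eHe.
have yy : bilin V y y = efficient_variance.
  rewrite /bilin -mulmxA {2}/y [V *m (_ *m _)]mulmxA mulmxV// mul1mx.
  rewrite /y !trmx_mul trmx_inv sH sW -!mulmxA.
  have -> : G^T *m (invmx V *m (G *m (invmx H *m e))) = e.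
    by rewrite !mulmxA -/H mulmxV// mul1mx.
  exact: eHe.
have := bilin_cauchy_schwarz moment_second_sym moment_second_ge0 a y.
rewrite -/V ay yy expr2 ler_pM2r//; exact: efficient_variance_gt0.
Qed.

Theorem cubic_gmm_clt : cvg_in_distribution P
  (fun J w => Num.sqrt J%:R * second J w k0 0)
  (normal_prob 0 (Num.sqrt efficient_variance)).
Proof.
have [r [x [lam [D [C2 [mE clam lamD meanE jacE]]]]]] := moment_interpolation.
pose S j w := \matrix_(a, i) m j w (x i) a 0 : 'M[R]_(q, r).
have [Kb KB] : exists B, forall h, K h -> `|h| <= B.
  have [B [_ hB]] := compact_bounded Kcompact.
  exists (B + 1) => h Kh; apply: (hB (B + 1)) => //; by rewrite ltrDl.
have /choice[Lb LbP] := fun i => cubic_bounded Kb (clam i).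
have lamK h : K h -> `|lam h| <= \sum_i `|Lb i|.
  move=> Kh; apply: ler_norm_entries => [|i k]; first exact: sumr_ge0.
  rewrite ord1; apply: le_trans (LbP i h (KB _ Kh)) _.
  by apply: le_trans (ler_norm _) _; rewrite (bigD1 i)//= lerDl sumr_ge0.
have SmE : \matrix_(a, i) Ex (fun w => S 0 w a i) = \matrix_(a, i) Ex (fun w => m 0 w (x i) a 0).
  by apply/matrixP => a i; rewrite !mxE; apply: eq_Ex => w; rewrite mxE.
have VE : moment_second = moment_var lam
    (fun a i b k => Ex (fun w => S 0 w a i * S 0 w b k)) 0.
  apply/matrixP => a b; rewrite !mxE.
  transitivity (Ex (fun w => \sum_i \sum_k lam 0 i 0 * lam 0 k 0 * (S 0 w a i * S 0 w b k))).
    apply: eq_Ex => w; rewrite {1 2}mE !mxE big_distrlr/=; apply: eq_bigr => i _.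
    by apply: eq_bigr => k _; rewrite /S; ring.
  have i0 i k : intg (fun w => S 0 w a i * S 0 w b k).
    by rewrite /S; under eq_fun do rewrite !mxE; exact: m_intg2.
  rewrite Ex_sum => [|i _]; last by apply: intg_sum => k _; exact: intgZ.
  apply: eq_bigr => i _; rewrite Ex_sum => [|k _]; last exact: intgZ.
  by apply: eq_bigr => k _; rewrite ExZ.
have avgE J w h : sample_moment S J w *m lam h = moment_avg J w h.
  rewrite /sample_moment /moment_avg -scalemxAl mulmx_suml; congr (_ *: _).
  by apply: eq_bigr => j _; rewrite mE.
have varE J w h : sample_moment_var lam S J w h = moment_second_avg J w h.
  rewrite /sample_moment_var /moment_second_avg; congr (_ *: _).
  by apply: eq_bigr => j _; rewrite !mE.
rewrite /efficient_variance VE jacE -SmE.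
have fmin J w : K (first J w) /\ forall h, K h ->
    bilin 1%:M (sample_moment S J w *m lam (first J w)) (sample_moment S J w *m lam (first J w)) <=
    bilin 1%:M (sample_moment S J w *m lam h) (sample_moment S J w *m lam h).
  by rewrite !avgE; have [H1 H2] := first_min J w; split => // h Kh; rewrite avgE; exact: H2.
apply: (gmm_clt lamD lamK r00 Kball _ _ _ _ _ _ _ _ _ _ fmin) => //.
- move=> a i; rewrite (_ : (fun j w => _) = fun j w => ((delta_mx 0 a : 'rV_q) *m m j w (x i)) 0 0)//.
  by apply/funext => j; apply/funext => w; rewrite -rowE !mxE.
- move=> a i b k; rewrite (_ : (fun j w => _) = fun j w => m j w (x i) a 0 * m j w (x k) b 0)//.
  by apply/funext => j; apply/funext => w; rewrite !mxE.
- move=> c; rewrite (_ : (fun j w => _) = fun j w => (c *m m j w 0) 0 0)//.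
  by apply/funext => j; apply/funext => w; rewrite -mE.
- by move=> a i; rewrite /S; under eq_fun do rewrite mxE.
- by move=> a i b k; rewrite /S; under eq_fun do rewrite !mxE.
- by rewrite SmE -meanE.
(* Quantitative identification: the sum of squares of the mean moments is continuous and positive on
   the compact part of [K] where [e <= |h|], hence bounded below there. *)
- move=> e e0.
  pose A := K `&` [set h | e <= `|h|].
  have [A0|nA] := pselect (A !=set0); last first.
    by exists 1 => // h Kh eh; exfalso; apply: nA; exists h.
  have cA : compact A.
    apply: compact_closedI => //.
    rewrite (_ : [set h | _] = (fun h : 'cV[R]_p => `|h|) @^-1` [set t | e <= t])//.
    apply: closed_comp => [h _|]; last exact: closed_ge.
    exact: norm_continuous.
  pose f h := \sum_a moment_mean h a 0 ^+ 2.
  have cf : continuous f.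
    have cD (f1 f2 : 'cV[R]_p -> R) : continuous f1 -> continuous f2 -> continuous (fun h => f1 h + f2 h).
      by move=> c1 c2 x1; apply: continuousD; [exact: c1|exact: c2].
    have cM (f1 f2 : 'cV[R]_p -> R) : continuous f1 -> continuous f2 -> continuous (fun h => f1 h * f2 h).
      by move=> c1 c2 x1; apply: continuousM; [exact: c1|exact: c2].
    rewrite /f; elim: (index_enum _) => [|a s IH].
      by under eq_fun do rewrite big_nil; exact: cst_continuous.
    under eq_fun do rewrite big_cons expr2.
    by apply: cD => //; apply: cM; exact: cubic_continuous (moment_mean_cubic a).
  have [h0 hA0 hmin] := compact_EVT_min A0 cA (continuous_subspaceT cf).
  move: hA0; rewrite inE => -[/= Kh0 eh0].
  have f0 h : 0 <= f h by apply: sumr_ge0 => a _; exact: sqr_ge0.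
  have fh0 : 0 < f h0.
    rewrite lt_neqAle f0 andbT eq_sym; apply/negP => /eqP fz.
    have : h0 = 0.
      apply: ident => //; apply/colP => a; rewrite [RHS]mxE; apply/eqP.
      rewrite -sqrf_eq0; have := @psumr_eq0P _ _ predT _ (fun a _ => sqr_ge0 _) fz.
      by move=> ->.
    by move=> h00; move: eh0; rewrite h00 normr0 leNgt e0.
  (* Passage from the sum of squares to the maximum norm; [q.+1] instead of [q] avoids a division by
     zero. *)
  exists (Num.sqrt (f h0 / q.+1%:R)); first by rewrite sqrtr_gt0 divr_gt0.
  move=> h Kh eh; rewrite SmE -meanE.
  rewrite -[leRHS]ger0_norm// -sqrtr_sqr ler_wsqrtr//.
  rewrite ler_pdivrMr//; apply: le_trans (hmin h _) _; first by rewrite inE; split.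
  apply: (@le_trans _ _ (\sum_(a < q) `|moment_mean h| ^+ 2)).
    apply: ler_sum => a _; rewrite -real_normK ?num_real//.
    by rewrite lerXn2r ?nnegrE// ler_entry_norm.
  rewrite sumr_const card_ord -[leLHS]mulr_natr; apply: ler_wpM2l; first exact: sqr_ge0.
  by rewrite ler_nat.
- by rewrite -VE.
- by move=> y; rewrite SmE -jacE; exact: Ginj.
- move=> J w; rewrite !varE !avgE => u; have [H1 H2] := second_min u.
  by split => // h Kh; rewrite avgE; exact: H2.
Qed.

End cubic_gmm.

Section translation.
Context (R : realType) d (Omega : measurableType d) (p q : nat).
Context (f : nat -> Omega -> 'cV[R]_p -> 'cV[R]_q) (c : 'cV[R]_p).

Lemma moment_avg_translate J w th : moment_avg (fun j w h => f j w (c + h)) J w (th - c) =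
  J%:R^-1 *: \sum_(j < J) f j w th.
Proof. by rewrite /moment_avg [c + _]addrC subrK. Qed.

Lemma moment_second_avg_translate J w th :
  moment_second_avg (fun j w h => f j w (c + h)) J w (th - c) =
  J%:R^-1 *: \sum_(j < J) (f j w th *m (f j w th)^T).
Proof. by rewrite /moment_second_avg [c + _]addrC subrK. Qed.

End translation.

(** * The moment functions *)

Section moment_functions.
Context (R : realType) (K T : nat) (pool : 'I_T -> 'I_T.-1 -> {set 'I_T}).
Implicit Types (z : obs R K T) (b bY : 'cV[R]_K) (th h : param R K).

Lemma pbetaD th h : pbeta (th + h) = pbeta th + pbeta h.
Proof. exact: linearD. Qed.

Lemma pbetaYD th h : pbetaY (th + h) = pbetaY th + pbetaY h.
Proof. by rewrite /pbetaY !linearD. Qed.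

Lemma pkappaD th h : pkappa (th + h) = pkappa th + pkappa h.
Proof. by rewrite /pkappa !linearD mxE. Qed.

Lemma pbetaZ k h : pbeta (k *: h) = k *: pbeta h.
Proof. exact: linearZ. Qed.

Lemma pbetaYZ k h : pbetaY (k *: h) = k *: pbetaY h.
Proof. by rewrite /pbetaY !linearZ. Qed.

Lemma pkappaZ k h : pkappa (k *: h) = k * pkappa h.
Proof. by rewrite /pkappa !linearZ mxE. Qed.

Lemma affine_pbeta th l : affine (fun h => pbeta (th + h) l 0).
Proof.
under eq_fun do rewrite pbetaD mxE.
apply: affineD; first exact: affine_cst.
by under eq_fun do rewrite mxE; exact: affine_coord.
Qed.

Lemma affine_pbetaY th l : affine (fun h => pbetaY (th + h) l 0).
Proof.
under eq_fun do rewrite pbetaYD mxE.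
apply: affineD; first exact: affine_cst.
by under eq_fun do rewrite !mxE; exact: affine_coord.
Qed.

Lemma affine_pkappa th : affine (fun h => pkappa (th + h)).
Proof.
under eq_fun do rewrite pkappaD.
apply: affineD; first exact: affine_cst.
by rewrite /pkappa; under eq_fun do rewrite !mxE; exact: affine_coord.
Qed.

Lemma affine_residual (y : R) (x : 'I_K -> R) (b : param R K -> 'cV[R]_K) :
  (forall l, affine (fun h => b h l 0)) ->
  affine (fun h => y - \sum_l x l * b h l 0).
Proof.
move=> ab; under eq_fun do rewrite -mulN1r.
apply: affineD; first exact: affine_cst.
by apply: affineZ; apply: affine_sum => l; exact: affineZ.
Qed.

Lemma gtilde_m1 z th k : gtilde pool z th (lshift _ k) 0 = m1 z (pbeta th) k 0.
Proof. by rewrite /gtilde col_mxEu. Qed.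

Lemma gtilde_m3 z th k : gtilde pool z th (rshift _ (lshift _ k)) 0 = m3 z (pbetaY th) k 0.
Proof. by rewrite /gtilde col_mxEd col_mxEu. Qed.

Lemma gtilde_g1 z th k : gtilde pool z th (rshift _ (rshift _ k)) 0 = g1_at pool z th k 0.
Proof. by rewrite /gtilde !col_mxEd. Qed.

(** The degree 3 comes from the single term [kappa * Rlo * Rtilde] of [g1], a product of three
    affine functions; all other terms have degree at most 2. *)
Lemma gtilde_cubic z th a : cubic (fun h => gtilde pool z (th + h) a 0).
Proof.
have cubic_m (V : 'cV[R]_T) (b : param R K -> 'cV[R]_K) k :
    (forall l, affine (fun h => b h l 0)) ->
    cubic (fun h => ((ddot (obsX z))^T *m (ddot V - ddot (obsX z) *m b h)) k 0).
  move=> ab; under eq_fun do rewrite mxE.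
  apply: cubic_sum => t; apply: cubicM; first exact: affine_cst.
  have := affine_residual (ddot V t 0) (ddot (obsX z) t) ab.
  by congr affine; apply/funext => h; rewrite !mxE.
rewrite -(splitK a); case: (fintype.split a) => i /=.
  under eq_fun do rewrite /gtilde col_mxEu.
  by apply: cubic_m => l; exact: affine_pbeta.
rewrite -(splitK i); case: (fintype.split i) => k /=.
  under eq_fun do rewrite /gtilde col_mxEd col_mxEu.
  by apply: cubic_m => l; exact: affine_pbetaY.
under eq_fun do rewrite /gtilde !col_mxEd /g1_at /g1 mxE.
apply: cubic_sum => t.
have aR s : affine (fun h => Rtilde z (pbeta (th + h)) s 0).
  have := affine_residual (obsR z s 0) (obsX z s) (affine_pbeta th).
  by congr affine; apply/funext => h; rewrite !mxE.
have aY s : affine (fun h => Ytilde z (pbetaY (th + h)) s 0).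
  have := affine_residual (obsY z s 0) (obsX z s) (affine_pbetaY th).
  by congr affine; apply/funext => h; rewrite !mxE.
have aL : affine (fun h => Rlo pool z (pbeta (th + h)) t k).
  by rewrite /Rlo; under eq_fun do rewrite mxE; exact: affine_sum.
rewrite (_ : (fun h => _) = fun h =>
    Rlo pool z (pbeta (th + h)) t k * Ytilde z (pbetaY (th + h)) t 0 +
    (-1) * (Rlo pool z (pbeta (th + h)) t k * pkappa (th + h) * Rtilde z (pbeta (th + h)) t 0)).
  apply: cubicD; first exact: cubicM.
  by apply/cubicZ/cubicM3 => //; exact: affine_pkappa.
by apply/funext => h; rewrite mxE mxBE mxZE; ring.
Qed.

Lemma m1D z b (h : 'cV_K) : m1 z (b + h) = m1 z b - (ddot (obsX z))^T *m ddot (obsX z) *m h.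
Proof. by rewrite /m1 [_ *m (b + h)]mulmxDr opprD addrA mulmxBr mulmxA. Qed.

Lemma m3D z b (h : 'cV_K) : m3 z (b + h) = m3 z b - (ddot (obsX z))^T *m ddot (obsX z) *m h.
Proof. by rewrite /m3 [_ *m (b + h)]mulmxDr opprD addrA mulmxBr mulmxA. Qed.

Lemma g1D z b bY (k h : R) :
  g1 pool z b bY (k + h) = g1 pool z b bY k - h *: ((Rlo pool z b)^T *m Rtilde z b).
Proof. by rewrite /g1 scalerDl opprD addrA mulmxBr -scalemxAr. Qed.

Lemma gtilde_m1D z th h k : gtilde pool z (th + h) (lshift _ k) 0 =
  gtilde pool z th (lshift _ k) 0 - ((ddot (obsX z))^T *m ddot (obsX z) *m pbeta h) k 0.
Proof.
transitivity (m1 z (pbeta (th + h)) k 0); first exact: gtilde_m1.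
by rewrite pbetaD m1D mxBE; congr (_ - _); exact/esym/gtilde_m1.
Qed.

Lemma gtilde_m3D z th h k : gtilde pool z (th + h) (rshift _ (lshift _ k)) 0 =
  gtilde pool z th (rshift _ (lshift _ k)) 0 -
  ((ddot (obsX z))^T *m ddot (obsX z) *m pbetaY h) k 0.
Proof.
transitivity (m3 z (pbetaY (th + h)) k 0); first exact: gtilde_m3.
by rewrite pbetaYD m3D mxBE; congr (_ - _); exact/esym/gtilde_m3.
Qed.

(** Increments along [kappa] suffice for identification: the other two blocks of moments determine
    [beta] and [betaY] beforehand. *)
Lemma gtilde_g1D z th h k : pbeta h = 0 -> pbetaY h = 0 ->
  gtilde pool z (th + h) (rshift _ (rshift _ k)) 0 =
  gtilde pool z th (rshift _ (rshift _ k)) 0 -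
  pkappa h * ((Rlo pool z (pbeta th))^T *m Rtilde z (pbeta th)) k 0.
Proof.
move=> hb hbY; transitivity (g1_at pool z (th + h) k 0); first exact: gtilde_g1.
rewrite /g1_at pbetaD pbetaYD pkappaD hb hbY !addr0 g1D mxBE mxZE; congr (_ - _).
exact/esym/gtilde_g1.
Qed.

End moment_functions.

(** * Measurability of matrix-valued functions of the data *)

Section measurability.
Context d (U : measurableType d) (R : realType).

Definition mx_measurable m n (A : U -> 'M[R]_(m, n)) :=
  forall i j, measurable_fun setT (fun u => A u i j).

Lemma mx_measurable_cst m n (A : 'M[R]_(m, n)) : mx_measurable (fun=> A).
Proof. by move=> i j; exact: measurable_cst. Qed.

Lemma mx_measurableD m n (A B : U -> 'M[R]_(m, n)) :
  mx_measurable A -> mx_measurable B -> mx_measurable (fun u => A u + B u).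
Proof. by move=> mA mB i j; under eq_fun do rewrite mxE; exact: measurable_funD. Qed.

Lemma mx_measurableB m n (A B : U -> 'M[R]_(m, n)) :
  mx_measurable A -> mx_measurable B -> mx_measurable (fun u => A u - B u).
Proof. by move=> mA mB i j; under eq_fun do rewrite mxBE; exact: measurable_funB. Qed.

Lemma mx_measurableZ m n k (A : U -> 'M[R]_(m, n)) :
  mx_measurable A -> mx_measurable (fun u => k *: A u).
Proof. by move=> mA i j; under eq_fun do rewrite mxE; exact: measurable_funM. Qed.

Lemma mx_measurableM m n p (A : U -> 'M[R]_(m, n)) (B : U -> 'M[R]_(n, p)) :
  mx_measurable A -> mx_measurable B -> mx_measurable (fun u => A u *m B u).
Proof.
move=> mA mB i j; under eq_fun do rewrite mxE.
by apply: measurable_sum => k; exact: measurable_funM.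
Qed.

Lemma mx_measurable_trmx m n (A : U -> 'M[R]_(m, n)) :
  mx_measurable A -> mx_measurable (fun u => (A u)^T).
Proof. by move=> mA i j; under eq_fun do rewrite mxE; exact: mA. Qed.

Lemma mx_measurable_col_mx m1 m2 n (A : U -> 'M[R]_(m1, n)) (B : U -> 'M[R]_(m2, n)) :
  mx_measurable A -> mx_measurable B -> mx_measurable (fun u => col_mx (A u) (B u)).
Proof.
move=> mA mB i j; rewrite -(splitK i); case: (fintype.split i) => k /=.
  by under eq_fun do rewrite col_mxEu; exact: mA.
by under eq_fun do rewrite col_mxEd; exact: mB.
Qed.

Lemma mx_measurable_ddot T n (A : U -> 'M[R]_(T, n)) :
  mx_measurable A -> mx_measurable (fun u => ddot (A u)).
Proof.
move=> mA i j; under eq_fun do rewrite mxE.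
apply: measurable_funB => //; apply: measurable_funM => //.
exact: measurable_sum.
Qed.

Lemma mx_measurable_leave_out T (pool : 'I_T -> 'I_T.-1 -> {set 'I_T}) (v : U -> 'cV[R]_T) :
  mx_measurable v -> mx_measurable (fun u => leave_out pool (v u)).
Proof.
move=> mv t k; under eq_fun do rewrite mxE big_mkcond/=.
by apply: measurable_sum => s; case: (s \in _).
Qed.

(** The domain [U] is kept arbitrary: integrability takes it to be [Omega], the i.i.d. property
    takes it to be the space of tuples of data entries. *)
Definition obs_measurable K T (Z : U -> obs R K T) :=
  [/\ mx_measurable (fun u => obsX (Z u)), mx_measurable (fun u => obsR (Z u)) &
      mx_measurable (fun u => obsY (Z u))].

Context (K T : nat) (pool : 'I_T -> 'I_T.-1 -> {set 'I_T}) (Z : U -> obs R K T).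
Hypothesis mZ : obs_measurable Z.

Lemma mx_measurable_Rtilde b : mx_measurable (fun u => Rtilde (Z u) b).
Proof.
have [mX mR mY] := mZ; apply: mx_measurableB => //.
by apply: mx_measurableM => //; exact: mx_measurable_cst.
Qed.

Lemma mx_measurable_Ytilde b : mx_measurable (fun u => Ytilde (Z u) b).
Proof.
have [mX mR mY] := mZ; apply: mx_measurableB => //.
by apply: mx_measurableM => //; exact: mx_measurable_cst.
Qed.

Lemma mx_measurable_Rlo b : mx_measurable (fun u => Rlo pool (Z u) b).
Proof. exact/mx_measurable_leave_out/mx_measurable_Rtilde. Qed.

Lemma mx_measurable_gtilde th : mx_measurable (fun u => gtilde pool (Z u) th).
Proof.
have [mX mR mY] := mZ.
apply: mx_measurable_col_mx; last apply: mx_measurable_col_mx.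
- apply: mx_measurableM; first exact/mx_measurable_trmx/mx_measurable_ddot.
  apply: mx_measurableB; first exact: mx_measurable_ddot.
  by apply: mx_measurableM; [exact: mx_measurable_ddot|exact: mx_measurable_cst].
- apply: mx_measurableM; first exact/mx_measurable_trmx/mx_measurable_ddot.
  apply: mx_measurableB; first exact: mx_measurable_ddot.
  by apply: mx_measurableM; [exact: mx_measurable_ddot|exact: mx_measurable_cst].
- apply: mx_measurableM; first exact/mx_measurable_trmx/mx_measurable_Rlo.
  apply: mx_measurableB; first exact: mx_measurable_Ytilde.
  exact/mx_measurableZ/mx_measurable_Rtilde.
Qed.

End measurability.

(** * Decomposition and i.i.d. structure of the teacher data *)

Section teachers.
Context d (Omega : measurableType d) (R : realType) (P : probability Omega R).
Context (K T : nat) (M : va_model P K T).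

Lemma Rbar_obsE j w : Rbar_obs M j w = Xbar M j w *m beta0 M + mubar M j w + epsbar M j w.
Proof.
apply/colP => t; rewrite !mxE /test_score big_split big_split/= 2!mulrDr.
congr (_ + _).
rewrite sumr_const card_ord; congr (_ + _); last first.
  by rewrite mulrC -[X in X / _]mulr_natr mulfK// pnatr_eq0 -lt0n class_size_gt0.
rewrite exchange_big/= mulr_sumr; apply: eq_bigr => k _.
by rewrite !mxE -mulr_suml mulrA.
Qed.

Lemma Ybar_obsE j w :
  Ybar_obs M j w = Xbar M j w *m betaY0 M + kappa0 M *: mubar M j w + etabar M j w.
Proof.
apply/colP => t; rewrite !mxE /earnings big_split big_split/= 2!mulrDr.
congr (_ + _).
rewrite sumr_const card_ord; congr (_ + _); last first.
  by rewrite mulrC -[X in X / _]mulr_natr mulfK// pnatr_eq0 -lt0n class_size_gt0.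
rewrite exchange_big/= mulr_sumr; apply: eq_bigr => k _.
by rewrite !mxE -mulr_suml mulrA.
Qed.

Lemma Rtilde0 j w : Rtilde (Zobs M j w) (beta0 M) = mubar M j w + epsbar M j w.
Proof. by rewrite /Rtilde/= Rbar_obsE -[_ + _ + _]addrA addrAC subrr add0r. Qed.

Lemma Ytilde0 j w :
  Ytilde (Zobs M j w) (betaY0 M) = kappa0 M *: mubar M j w + etabar M j w.
Proof. by rewrite /Ytilde/= Ybar_obsE -[_ + _ + _]addrA addrAC subrr add0r. Qed.

Lemma mx_measurable_class_avg j (H : 'I_T -> 'I_(class_size M j) -> Omega -> R) :
  (forall t i, measurable_fun setT (H t i)) -> mx_measurable (class_avg H).
Proof.
move=> mH t k; under eq_fun do rewrite mxE.
by apply: measurable_funM => //; exact: measurable_sum.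
Qed.

Lemma mx_measurable_Xbar j : mx_measurable (Xbar M j).
Proof.
move=> t k; under eq_fun do rewrite mxE.
by apply: (mx_measurable_class_avg (H := fun t i => covar t i k)) => s i; exact: measurable_funP.
Qed.

Lemma mx_measurable_mubar j : mx_measurable (mubar M j).
Proof. by move=> t k; under eq_fun do rewrite mxE; exact: measurable_funP. Qed.

Lemma mx_measurable_epsbar j : mx_measurable (epsbar M j).
Proof. by apply: mx_measurable_class_avg => t i; exact: measurable_funP. Qed.

Lemma mx_measurable_etabar j : mx_measurable (etabar M j).
Proof. by apply: mx_measurable_class_avg => t i; exact: measurable_funP. Qed.

Lemma obs_measurable_Zobs j : obs_measurable (Zobs M j).
Proof.
have mX := mx_measurable_Xbar j; have mmu := mx_measurable_mubar j.
split=> //=.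
- under eq_fun do rewrite Rbar_obsE.
  apply: mx_measurableD; last exact: mx_measurable_epsbar.
  apply: mx_measurableD => //; apply: mx_measurableM => //; exact: mx_measurable_cst.
- under eq_fun do rewrite Ybar_obsE.
  apply: mx_measurableD; last exact: mx_measurable_etabar.
  apply: mx_measurableD; last exact: mx_measurableZ.
  by apply: mx_measurableM => //; exact: mx_measurable_cst.
Qed.

Lemma mx_measurable_teacher_data j : mx_measurable (teacher_data M j).
Proof.
have [mX mR mY] := obs_measurable_Zobs j.
have mrow m n1 n2 (A : Omega -> 'M[R]_(m, n1)) (B : Omega -> 'M[R]_(m, n2)) :
    mx_measurable A -> mx_measurable B -> mx_measurable (fun u => row_mx (A u) (B u)).
  move=> mA mB i k; rewrite -(splitK k); case: (fintype.split k) => l /=.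
    by under eq_fun do rewrite row_mxEl; exact: mA.
  by under eq_fun do rewrite row_mxEr; exact: mB.
apply: (mrow) => //; apply: (mrow); first exact: mx_measurable_mubar.
apply: (mrow); first exact: mx_measurable_epsbar.
by apply: (mrow) => //; exact: mx_measurable_etabar.
Qed.

(** [teacher_data] does not contain the scores; they are recovered from its covariate, value-added
    and noise blocks, whereas earnings are stored directly. *)
Let decode (A : 'M[R]_(T, K + (1 + (1 + (1 + 1))))) : obs R K T :=
  Obs (lsubmx A)
      (lsubmx A *m beta0 M + lsubmx (rsubmx A) + lsubmx (rsubmx (rsubmx A)))
      (lsubmx (rsubmx (rsubmx (rsubmx A)))).

Let decodeK j w : decode (teacher_data M j w) = Zobs M j w.
Proof. by rewrite /decode /teacher_data !(row_mxKl, row_mxKr) /Zobs Rbar_obsE. Qed.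

Hypothesis data_iid : iid P (teacher_data M).

(** The measurability hypothesis ranges over all domains because [f] is evaluated on the decoded
    tuple rather than on [Omega], and [obs] carries no sigma-algebra. *)
Lemma iid_rv_Zobs (f : obs R K T -> R) :
  (forall d' (U : measurableType d') (Z : U -> obs R K T),
     obs_measurable Z -> measurable_fun setT (fun u => f (Z u))) ->
  iid_rv P (fun j w => f (Zobs M j w)).
Proof.
move=> mf; pose F (u : (T * (K + (1 + (1 + (1 + 1))))).-tuple R) :=
  f (decode (vec_mx (\row_k tnth u k))).
rewrite (_ : (fun j w => _) = fun j w => F [tuple mx_coord (teacher_data M j) k w | k < _]).
  apply: iid_rv_of_iid => //.
    move=> j k; rewrite /mx_coord; have [i l] := mxvec_indexP k; under eq_fun do rewrite mxvecE.
    exact: mx_measurable_teacher_data.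
  apply: mf.
  have mA : mx_measurable (fun u : (T * (K + (1 + (1 + (1 + 1))))).-tuple R =>
      (vec_mx (\row_k tnth u k) : 'M[R]_(T, _))).
    by move=> i l; under eq_fun do rewrite !mxE; exact: measurable_tnth.
  have ml : mx_measurable (fun u : (T * (K + (1 + (1 + (1 + 1))))).-tuple R =>
      lsubmx (vec_mx (\row_k tnth u k) : 'M[R]_(T, _))).
    by move=> i l; under eq_fun do rewrite mxE; exact: mA.
  split => //=.
    apply: mx_measurableD; last by move=> i l; under eq_fun do rewrite !mxE; exact: measurable_tnth.
    apply: mx_measurableD; last by move=> i l; under eq_fun do rewrite !mxE; exact: measurable_tnth.
    by apply: mx_measurableM => //; exact: mx_measurable_cst.
  by move=> i l; under eq_fun do rewrite !mxE; exact: measurable_tnth.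
apply/funext => j; apply/funext => w; rewrite -decodeK /F; congr (f (decode _)).
apply: (can_inj mxvecK); apply/rowP => k; rewrite vec_mxK mxE.
by rewrite tnth_mktuple.
Qed.

End teachers.

(* With [a s = L s * e s], for [s <> s'] the smaller of [`|a s|] and [`|a s'|] is
   at most their geometric mean, which the products [L s * L s'] and
   [e s * e s'] control: every [a t] is integrable as soon as their sum is. *)
Lemma ler_norm_sum_prod (R : realType) n (L e : 'I_n -> R) t :
  `|L t * e t| <= `|\sum_s L s * e s| +
    \sum_s \sum_(s' | s' != s) (`|L s * L s'| + `|e s * e s'|).
Proof.
pose D s s' := `|L s * L s'| + `|e s * e s'|.
pose a s := L s * e s.
have D0 s s' : 0 <= D s s' by rewrite addr_ge0.
have aD s s' : `|a s| <= `|a s'| -> `|a s| <= D s s'.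
  move=> le; rewrite -(@ler_pXn2r _ 2)// ?nnegrE//.
  apply: (@le_trans _ _ (`|a s| * `|a s'|)); first by rewrite expr2 ler_wpM2l.
  rewrite -normrM (_ : a s * a s' = (L s * L s') * (e s * e s')); last by rewrite /a; ring.
  rewrite normrM /D sqrrD.
  have := mulr_ge0 (normr_ge0 (L s * L s')) (normr_ge0 (e s * e s')).
  have := sqr_ge0 `|L s * L s'|; have := sqr_ge0 `|e s * e s'|.
  by rewrite mulr2n; lra.
have sumD0 (Q : pred 'I_n) s : 0 <= \sum_(s' | Q s') D s s' by exact: sumr_ge0.
have [/existsP[s' /andP[s't ats']]|/existsPn nex] := boolP [exists s', (s' != t) && (`|a t| <= `|a s'|)].
  apply: le_trans (aD _ _ ats') _; rewrite -[leLHS]add0r; apply: lerD => //.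
  rewrite (bigD1 t)//= (bigD1 s')//= -addrA lerDl addr_ge0//.
  - by apply: sumr_ge0 => s _; exact: D0.
  - by apply: sumr_ge0 => s _; exact: sumD0.
have le s : s != t -> `|a s| <= D t s.
  move=> st; have := nex s; rewrite st/= -ltNge => /ltW /aD.
  by rewrite /D mulrC [e s * _]mulrC.
have -> : L t * e t = (\sum_s a s) - \sum_(s | s != t) a s.
  by rewrite (bigD1 t)//= addrK.
apply: le_trans (ler_normB _ _) _; apply: lerD => //.
apply: le_trans (ler_norm_sum _ _ _) _; rewrite [leRHS](bigD1 t)//=.
apply: (@le_trans _ _ (\sum_(s | s != t) D t s)); first exact: ler_sum.
by rewrite lerDl; apply: sumr_ge0 => s _; exact: sumr_ge0.
Qed.

(** * Mean zero of the leave-out moments *)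

Section orthogonality.
Context d (Omega : measurableType d) (R : realType) (P : probability Omega R).
Local Notation Ex := (Ex P).
Local Notation intg := (intg P).

Lemma intg_mul_sqr (X Y : Omega -> R) : measurable_fun setT X -> measurable_fun setT Y ->
  intg (fun w => X w ^+ 2) -> intg (fun w => Y w ^+ 2) -> intg (fun w => X w * Y w).
Proof.
move=> mX mY iX iY; apply: (intg_le _ (intgD iX iY)); first exact: measurable_funM.
move=> w; rewrite normrM [leRHS]ger0_norm ?addr_ge0 ?sqr_ge0//.
rewrite -(real_normK (num_real (X w))) -(real_normK (num_real (Y w))).
set x := `|X w|; set y := `|Y w|.
have := sqr_ge0 (x - y); have := sqr_ge0 x; have := sqr_ge0 y.
by rewrite sqrrB mulr2n; lra.
Qed.

Lemma intg_sqr (X : Omega -> R) : measurable_fun setT X -> intg (fun w => X w ^+ 2) -> intg X.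
Proof.
move=> mX iX; have := intg_mul_sqr mX (measurable_cst (1 : R)) iX (intg_cst P (1 ^+ 2)).
by apply: eq_intg => w; rewrite mulr1.
Qed.

Lemma intg_sqrD (X Y : Omega -> R) : measurable_fun setT X -> measurable_fun setT Y ->
  intg (fun w => X w ^+ 2) -> intg (fun w => Y w ^+ 2) -> intg (fun w => (X w + Y w) ^+ 2).
Proof.
move=> mX mY iX iY; have iXY := intg_mul_sqr mX mY iX iY.
have := intgD (intgD iX (intgZ 2 iXY)) iY.
by apply: eq_intg => w; ring.
Qed.

Lemma intg_sqrZ k (X : Omega -> R) : intg (fun w => X w ^+ 2) -> intg (fun w => (k * X w) ^+ 2).
Proof. by move=> iX; have := intgZ (k ^+ 2) iX; apply: eq_intg => w; rewrite exprMn. Qed.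

Lemma intg_sqr_sum (I : Type) (s : seq I) (Q : pred I) (F : I -> Omega -> R) :
  (forall i, measurable_fun setT (F i)) ->
  (forall i, Q i -> intg (fun w => F i w ^+ 2)) -> intg (fun w => (\sum_(i <- s | Q i) F i w) ^+ 2).
Proof.
move=> mF iF; elim: s => [|i s IH].
  by under eq_fun do rewrite big_nil expr0n; exact: intg_cst.
under eq_fun do rewrite big_cons.
case Qi: (Q i) => //; apply: intg_sqrD => //; last exact: iF.
by rewrite (_ : (fun w => _) = fun w => \sum_(i <- s) if Q i then F i w else 0);
  [apply: measurable_sum => k; case: (Q k)|apply/funext => w; rewrite big_mkcond].
Qed.

(** The condition [E[Z | V] = 0] tested against bounded functions of [V], so that it makes sense
    when [V * Z] is not integrable. *)
Definition mean_orthogonal (V Z : Omega -> R) : Prop :=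
  forall (h : R -> R) c, measurable_fun setT h -> (forall x, `|h x| <= c) ->
  Ex (fun w => Z w * h (V w)) = 0.

(* [V i * Z] need not be integrable for a single [i]. With at most two summands,
   clipping each of them decreases the absolute value of the sum, which makes
   dominated convergence available. *)
Lemma Ex_sum_mean_orthogonal (I : finType) (A : {set I}) (V : I -> Omega -> R) (Z : Omega -> R) :
  (#|A| <= 2)%N -> (forall i, measurable_fun setT (V i)) -> intg Z ->
  (forall i, i \in A -> mean_orthogonal (V i) Z) ->
  intg (fun w => (\sum_(i in A) V i w) * Z w) -> Ex (fun w => (\sum_(i in A) V i w) * Z w) = 0.
Proof.
move=> A2 mV iZ oZ iVZ; have mZ := intg_measurable iZ.
have clipA n w : `|\sum_(i in A) clip n (V i w)| <= `|\sum_(i in A) V i w|.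
  have := A2; rewrite leq_eqVlt => /orP[|].
    move=> /cards2P[i [k [ik ->]]].
    by rewrite !big_setU1 ?inE//= !big_set1; exact: clip_lipschitz_odd.
  rewrite ltnS leq_eqVlt => /orP[|].
    move=> /cards1P[i ->].
    by rewrite !big_set1 clip_le.
  by rewrite ltnS leqn0 cards_eq0 => /eqP ->; rewrite !big_set0.
have mcV n i : measurable_fun setT (fun w => clip n (V i w)).
  by apply: measurableT_comp => //; exact: measurable_clip.
pose X n w := (\sum_(i in A) clip n (V i w)) * Z w.
have mX n : measurable_fun setT (X n).
  apply: measurable_funM => //; under eq_fun do rewrite big_mkcond/=.
  by apply: measurable_sum => i; case: (i \in A).
have Xcvg w : X n w @[n --> \oo] --> (\sum_(i in A) V i w) * Z w.
  apply: cvgM; last exact: cvg_cst.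
  elim: (index_enum I) => [|i s IH].
    by under eq_fun do rewrite big_nil; rewrite big_nil; exact: cvg_cst.
  under eq_fun do rewrite big_cons; rewrite big_cons.
  by case: (i \in A) => //; apply: cvgD => //; exact: clip_cvg.
have Xle n w : `|X n w| <= `|(\sum_(i in A) V i w) * Z w| by rewrite !normrM ler_wpM2r.
have [_] := cvg_Ex_dominated mX (intg_norm iVZ) Xcvg Xle.
have -> : (fun n => Ex (X n)) = fun=> 0.
  apply/funext => n; rewrite /X.
  have ic i : intg (fun w => Z w * clip n (V i w)).
    by apply: (@intg_mul_bounded _ _ _ _ _ _ n%:R) => // w; exact: clip_bounded.
  under eq_Ex do rewrite mulrC mulr_sumr.
  rewrite Ex_sum// big1// => i iA; apply: (oZ i iA _ n%:R).
    exact: measurable_clip.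
  by move=> x; exact: clip_bounded.
by move=> /cvg_lim <-//; rewrite lim_cst.
Qed.

Context (T : nat) (mu eps eta : 'I_T -> Omega -> R) (kappa : R).
Hypothesis mmu : forall t, measurable_fun setT (mu t).
Hypothesis mu2 : forall t, intg (fun w => mu t w ^+ 2).
Hypothesis ieps : forall t, intg (eps t).
Hypothesis eps2 : forall t, intg (fun w => eps t w ^+ 2).
Hypothesis ieta : forall t, intg (eta t).
Hypothesis eps0 : forall t, Ex (eps t) = 0.
Hypothesis mu_eps : forall s t, mean_orthogonal (mu s) (eps t).
Hypothesis mu_eta : forall s t, s != t -> mean_orthogonal (mu s) (eta t).
Hypothesis eps_eps : forall s t, s != t -> indep_rv P (eps s) (eps t).
Hypothesis eps_eta : forall s t, s != t -> indep_rv P (eps s) (eta t).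
Hypothesis eta_eta : forall s t, s != t -> indep_rv P (eta s) (eta t).

(** Noise times noise is integrable by independence across years, and [mu] times [eps] by square
    integrability. For [eta] only a first moment is at hand, so the sum of the [mu] times [eta]
    terms is isolated by subtracting the other three kinds of products from the integrable total. *)
Lemma Ex_leave_out_moment (A : 'I_T -> {set 'I_T}) :
  (forall t, t \notin A t) -> (forall t, (#|A t| <= 2)%N) ->
  intg (fun w => \sum_t (\sum_(s in A t) (mu s w + eps s w)) * (eta t w - kappa * eps t w)) ->
  Ex (fun w => \sum_t (\sum_(s in A t) (mu s w + eps s w)) * (eta t w - kappa * eps t w)) = 0.
Proof.
move=> At A2 iS.
have meps t := intg_measurable (ieps t); have meta t := intg_measurable (ieta t).
pose Lm t w := \sum_(s in A t) mu s w; pose Le t w := \sum_(s in A t) eps s w.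
have mLm t : measurable_fun setT (Lm t).
  rewrite /Lm; under eq_fun do rewrite big_mkcond/=.
  by apply: measurable_sum => s; case: (s \in _).
have sne t s : s \in A t -> s != t by move=> sA; apply: contraNneq (At t) => E; rewrite -{1}E.
have LeE (e : 'I_T -> Omega -> R) t : (forall s, s != t -> intg (fun w => eps s w * e t w) /\
    Ex (fun w => eps s w * e t w) = 0) ->
    intg (fun w => Le t w * e t w) /\ Ex (fun w => Le t w * e t w) = 0.
  move=> H; rewrite (_ : (fun w => _) = fun w => \sum_(s in A t) eps s w * e t w); last first.
    by apply/funext => w; rewrite /Le mulr_suml.
  split; first by apply: intg_sum => s /sne /H[].
  rewrite Ex_sum => [|s /sne /H[]//]; rewrite big1// => s /sne /H[]//.
have [Leeps1 Leeps0] : (forall t, intg (fun w => Le t w * eps t w)) /\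
    forall t, Ex (fun w => Le t w * eps t w) = 0.
  have H t := LeE eps t; split => t; apply H => s st.
    by have [? ->] := Ex_mul_indep (ieps s) (ieps t) (eps_eps st); rewrite eps0 mul0r.
  by have [? ->] := Ex_mul_indep (ieps s) (ieps t) (eps_eps st); rewrite eps0 mul0r.
have [Leeta1 Leeta0] : (forall t, intg (fun w => Le t w * eta t w)) /\
    forall t, Ex (fun w => Le t w * eta t w) = 0.
  have H t := LeE eta t; split => t; apply H => s st.
    by have [? ->] := Ex_mul_indep (ieps s) (ieta t) (eps_eta st); rewrite eps0 mul0r.
  by have [? ->] := Ex_mul_indep (ieps s) (ieta t) (eps_eta st); rewrite eps0 mul0r.
have Lmeps1 t : intg (fun w => Lm t w * eps t w).
  apply: intg_mul_sqr => //; rewrite /Lm; exact: intg_sqr_sum.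
have Lmeps0 t : Ex (fun w => Lm t w * eps t w) = 0.
  apply: (Ex_sum_mean_orthogonal (A2 t) mmu (ieps t) _ (Lmeps1 t)) => s _; exact: mu_eps.
have SE w : \sum_t (\sum_(s in A t) (mu s w + eps s w)) * (eta t w - kappa * eps t w) =
    \sum_t Lm t w * eta t w + \sum_t (Le t w * eta t w - kappa * (Lm t w * eps t w + Le t w * eps t w)).
  rewrite -big_split/=; apply: eq_bigr => t _.
  by rewrite big_split/= -/(Lm t w) -/(Le t w); ring.
have iD t : intg (fun w => Le t w * eta t w - kappa * (Lm t w * eps t w + Le t w * eps t w)).
  by apply: intgB => //; apply: intgZ; exact: intgD.
have iLeta : intg (fun w => \sum_t Lm t w * eta t w).
  have := intgB iS (intg_sum (index_enum 'I_T) (fun t (_ : true) => iD t)).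
  by apply: eq_intg => w; rewrite SE addrK.
have Lmeta1 t : intg (fun w => Lm t w * eta t w).
  pose Y w := `|\sum_s Lm s w * eta s w| +
    \sum_s \sum_(s' | s' != s) (`|Lm s w * Lm s' w| + `|eta s w * eta s' w|).
  have iY : intg Y.
    apply: intgD; first exact: intg_norm.
    apply: intg_sum => s _; apply: intg_sum => s' ss'; apply: intgD; apply: intg_norm.
      by apply: intg_mul_sqr => //; exact: intg_sqr_sum.
    by have [] := Ex_mul_indep (ieta s) (ieta s') (eta_eta _); rewrite // eq_sym.
  apply: (intg_le _ iY) => [|w]; first exact: measurable_funM.
  apply: le_trans (ler_norm_sum_prod (fun t => Lm t w) (fun t => eta t w) t) _.
  exact: ler_norm.
have Lmeta0 t : Ex (fun w => Lm t w * eta t w) = 0.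
  apply: (Ex_sum_mean_orthogonal (A2 t) mmu (ieta t) _ (Lmeta1 t)) => s sA; exact/mu_eta/sne.
under eq_Ex do rewrite SE.
rewrite ExD//; last exact: intg_sum.
rewrite !Ex_sum// !big1 ?addr0// => t _.
rewrite ExB//; last by apply: intgZ; exact: intgD.
by rewrite ExZ ?ExD ?Leeta0 ?Lmeps0 ?Leeps0 ?addr0 ?mulr0 ?subr0//; exact: intgD.
Qed.

End orthogonality.

(** * Moments of the model *)

Section ddot_linear.
Context (R : realType) (T n : nat).
Implicit Types A B : 'M[R]_(T, n).

Lemma ddotD A B : ddot (A + B) = ddot A + ddot B.
Proof.
apply/matrixP => s c; rewrite !mxE; under eq_bigr do rewrite mxE.
by rewrite big_split/=; ring.
Qed.

Lemma ddotZ k A : ddot (k *: A) = k *: ddot A.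
Proof.
apply/matrixP => s e; rewrite !mxE; under eq_bigr do rewrite mxE.
by rewrite -mulr_sumr; ring.
Qed.

Lemma ddotM m A (B : 'M[R]_(n, m)) : ddot (A *m B) = ddot A *m B.
Proof.
apply/matrixP => s e; rewrite !mxE; under [X in _ - _ * X]eq_bigr do rewrite mxE.
rewrite exchange_big/= mulr_sumr -sumrB; apply: eq_bigr => l _.
by rewrite mxE -mulr_suml; ring.
Qed.

End ddot_linear.

(** * The years entering the leave-out matrix *)

Section leave_out_pools.
Context (T : nat) (pool : 'I_T -> 'I_T.-1 -> {set 'I_T}).
Hypothesis hpool : leave_out_listing pool \/ leave_out_lags pool.

Lemma pool_notin t k : t \notin pool t k.
Proof.
case: hpool => [[c /(_ t)[_ /(_ k)[ct ->]]]|->]; rewrite inE; first by rewrite eq_sym.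
by rewrite distnn.
Qed.

(** A lag is attained at most once on each side of [t]. Truncation of [t - k.+1] at 0 does no harm,
    since only an inclusion is claimed. *)
Lemma card_pool t k : (#|pool t k| <= 2)%N.
Proof.
case: hpool => [[c /(_ t)[_ /(_ k)[_ ->]]]|->]; first by rewrite cards1.
have le1 (n : nat) : (#|[set s : 'I_T | (s : nat) == n]%SET| <= 1)%N.
  apply/card_le1_eqP => s s'; rewrite !inE => /eqP sn /eqP s'n.
  by apply: val_inj; rewrite /= sn s'n.
apply: (@leq_trans #|[set s : 'I_T | (s : nat) == (t + k.+1)%N] :|:
                     [set s : 'I_T | (s : nat) == (t - k.+1)%N]|%SET).
  apply: subset_leq_card; apply/fintype.subsetP => s; rewrite !inE => /eqP E.
  have [st|ts] := leqP s t.
    by apply/orP; right; rewrite -E distnEr// subKn.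
  by apply/orP; left; rewrite -E distnEl ?(ltnW ts)// addnC subnK// ltnW.
by apply: leq_trans (leq_card_setU _ _) _; apply: (@leq_add _ _ 1 1).
Qed.

(** Isolates a single residual in an entry of the leave-out matrix. For the listing any other year
    [t] works, by counting; for the lags an extreme year does, since it sees each lag on one side
    only: the last year for [s = 0], year 0 otherwise. *)
Lemma pool_singleton s : (1 < T)%N -> exists t k, pool t k = [set s]%SET.
Proof.
move=> T1; case: hpool => [[c cP]|lags].
  have [t ts] : exists t : 'I_T, t != s.
    have [s0|s0] := eqVneq (s : nat) 0%N.
      by exists (Ordinal T1); apply/eqP => /(congr1 val)/= E; rewrite -E in s0.
    exists (Ordinal (ltnW T1)); apply/eqP => /(congr1 val)/= E.
    by rewrite -E eqxx in s0.
  exists t; have [ci ck] := cP t.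
  have : s \in (c t @: [set: 'I_T.-1]%SET)%SET.
    have -> : (c t @: [set: 'I_T.-1]%SET = [set~ t])%SET.
      apply/eqP; rewrite eqEcard; apply/andP; split.
        by apply/fintype.subsetP => _ /imsetP[k _ ->]; rewrite !inE; have [] := ck k.
      by rewrite card_imset// cardsT cardsC1 !card_ord.
    by rewrite !inE eq_sym.
  by move=> /imsetP[k _ ->]; exists k; have [] := ck k.
have [s0|s0] := posnP s.
  have Tm : (T.-1 < T)%N by rewrite prednK// ltnW.
  have Tk : (T.-2 < T.-1)%N by rewrite prednK// -subn1 subn_gt0.
  exists (Ordinal Tm), (Ordinal Tk); rewrite lags; apply/setP => u; rewrite !inE /=.
  have uT : (u <= T.-1)%N by rewrite -ltnS prednK// ltnW.
  rewrite distnEr// prednK ?ltn_predRL//.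
  apply/eqP/eqP => [E|->]; last by rewrite s0 subn0.
  apply: val_inj => /=; rewrite s0; apply/eqP.
  by rewrite -(eqn_add2l (T.-1 - u)) subnK// addn0 E.
have sk : (s.-1 < T.-1)%N by rewrite -ltnS !prednK// ltnW.
exists (Ordinal (ltnW T1)), (Ordinal sk); rewrite lags; apply/setP => u; rewrite !inE /=.
rewrite addn0 prednK//.
Qed.

End leave_out_pools.

(** * Conditional expectations as orthogonality relations *)

Section conditioning.
Context d (Omega : measurableType d) (R : realType) (P : probability Omega R).
Local Notation Ex := (Ex P).
Local Notation intg := (intg P).

Lemma mx_sigma_coord m n (V : Omega -> 'M[R]_(m, n)) i j (B : set R) : measurable B ->
  mx_sigma V ((fun w => V w i j) @^-1` B).
Proof.
move=> mB; apply: sub_sigma_algebra.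
rewrite (bigD1 (mxvec_index i j))//=; left; exists B => //.
by rewrite setTI; apply/seteqP; split => w /=; rewrite /mx_coord mxvecE.
Qed.

Lemma Ex_mul_indic A Z : measurable A -> intg Z ->
  (\int[P]_(w in A) (Z w)%:E)%E = (Ex (fun w => Z w * \1_A w))%:E.
Proof.
move=> mA iZ; rewrite -integral_Ex; last first.
  apply: (@intg_mul_bounded _ _ _ _ _ _ 1) => // w.
  by rewrite indicE; case: (_ \in _); rewrite ?normr1 ?normr0.
by rewrite integral_mkcond epatch_indic; apply: eq_integral => w _ /=; rewrite EFinM.
Qed.

Lemma condexp0_orthogonal m n (V : Omega -> 'M[R]_(m, n)) Z i j :
  mx_measurable V -> is_condexp P (mx_sigma V) Z (cst 0) ->
  mean_orthogonal P (fun w => V w i j) Z.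
Proof.
move=> mV [iZ _ _ VZ]; apply: Ex_mul_indic_preimage => // B mB.
have mVB : measurable ((fun w => V w i j) @^-1` B) by rewrite -[X in measurable X]setTI; exact: mV.
have := VZ _ (mx_sigma_coord i j mB); rewrite integral0 Ex_mul_indic//.
by move=> [<-].
Qed.

Lemma mean_orthogonal_avg n (V : Omega -> R) (Z : 'I_n -> Omega -> R) k :
  measurable_fun setT V -> (forall i, intg (Z i)) -> (forall i, mean_orthogonal P V (Z i)) ->
  mean_orthogonal P V (fun w => k * \sum_i Z i w).
Proof.
move=> mV iZ oZ h c mh hc.
have iZh i : intg (fun w => Z i w * h (V w)).
  apply: (@intg_mul_bounded _ _ _ _ _ _ c) => //.
  exact: measurableT_comp.
under eq_Ex do rewrite -mulrA mulr_suml.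
rewrite ExZ; last exact: intg_sum.
by rewrite Ex_sum// big1 ?mulr0// => i _; exact: oZ hc.
Qed.

Lemma eq_mean_orthogonal V (Z Z' : Omega -> R) : Z =1 Z' ->
  mean_orthogonal P V Z -> mean_orthogonal P V Z'.
Proof. by move=> /funext ->. Qed.

Lemma variance_le_Ex_sqr X : intg X -> intg (fun w => X w ^+ 2) ->
  ('V_P[X] <= (Ex (fun w => X w ^+ 2))%:E)%E.
Proof.
move=> iX iX2; set c := Ex X.
have E : 'V_P[X] = (Ex (fun w => (X w ^+ 2 - 2 * c * X w) + c ^+ 2))%:E.
  rewrite /variance unlock unlock -integral_Ex; last first.
    by apply: intgD; [apply: intgB => //; exact: intgZ|exact: intg_cst].
  by apply: eq_integral => w _; congr EFin; transitivity ((X w - c) * (X w - c));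
    [rewrite /c Ex_expectation unlock|ring].
rewrite E ExD ?ExB ?ExZ ?Ex_cst//; try exact: intgZ; try exact: intg_cst; last first.
  by apply: intgB => //; exact: intgZ.
by rewrite lee_fin -/c -subr_ge0; have := sqr_ge0 c; lra.
Qed.

End conditioning.

(** * Integrability and mean of the moments for one teacher *)

Section teacher.
Context d (Omega : measurableType d) (R : realType) (P : probability Omega R).
Local Notation Ex := (Ex P).
Local Notation intg := (intg P).
Context (K T : nat) (M : va_model P K T) (pool : 'I_T -> 'I_T.-1 -> {set 'I_T}).
Hypothesis T_gt1 : (1 < T)%N.
Hypothesis hpool : leave_out_listing pool \/ leave_out_lags pool.
Hypothesis hmu : forall j t, (value_added M j t : Omega -> R) \in Lfun P 2%:E.
Context (Theta : set (param R K)) (j : nat).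
Hypothesis h1a : forall (t : 'I_T) (i : 'I_(class_size M j)),
  is_condexp P (mx_sigma (mubar M j)) (score_noise t i) (cst 0).
Hypothesis h1b : forall (s t : 'I_T) (i : 'I_(class_size M j)), s != t ->
  is_condexp P (mx_sigma (fun w => row s (mubar M j w))) (earnings_noise t i) (cst 0).
Hypothesis h1c : forall s t : 'I_T, s != t ->
  independent P (mx_sigma (noise_pair M j t)) (mx_sigma (noise_pair M j s)).
Hypothesis h2c : forall U : Omega -> 'cV[R]_T,
  U = mubar M j \/ U = epsbar M j \/ U = etabar M j ->
  mx_integrable P (fun w => (ddot (Xbar M j w))^T *m ddot (U w)) /\
  mx_mean P (fun w => (ddot (Xbar M j w))^T *m ddot (U w)) = 0.
Hypothesis theta0_in : Theta (theta0 M).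
Hypothesis h3e : (\int[P]_w ereal_sup
  [set (fnorm ((Rlo pool (Zobs M j w) (pbeta th))^T *m Rlo pool (Zobs M j w) (pbeta th)))%:E
  | th in Theta] < +oo)%E.
Hypothesis h3d : forall th : param R K,
  [/\ mx_integrable P (fun w => m1 (Zobs M j w) (pbeta th) *m (m1 (Zobs M j w) (pbeta th))^T),
      mx_integrable P (fun w => m3 (Zobs M j w) (pbetaY th) *m (m3 (Zobs M j w) (pbetaY th))^T) &
      mx_integrable P (fun w => g1_at pool (Zobs M j w) th *m (g1_at pool (Zobs M j w) th)^T)].

Local Notation z := (Zobs M j).

Lemma pbeta_theta0 : pbeta (theta0 M) = beta0 M.
Proof. by rewrite /pbeta /theta0 col_mxKu. Qed.

Lemma pbetaY_theta0 : pbetaY (theta0 M) = betaY0 M.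
Proof. by rewrite /pbetaY /theta0 /stack col_mxKd col_mxKu. Qed.

Lemma pkappa_theta0 : pkappa (theta0 M) = kappa0 M.
Proof. by rewrite /pkappa /theta0 /stack !col_mxKd mxE eqxx. Qed.

Lemma mx_measurable_gtilde_Zobs th : mx_measurable (fun w => gtilde pool (z w) th).
Proof. exact/mx_measurable_gtilde/obs_measurable_Zobs. Qed.

Lemma intg_sqr_gtilde th a : intg (fun w => gtilde pool (z w) th a 0 ^+ 2).
Proof.
have [i1 i3 ig] := h3d th.
have sqrE n (v : Omega -> 'cV[R]_n) i : mx_integrable P (fun w => v w *m (v w)^T) ->
    intg (fun w => v w i 0 ^+ 2).
  move=> /(_ i i); apply: eq_intg => w.
  by rewrite mxE big_ord1 mxE expr2.
rewrite -(splitK a); case: (fintype.split a) => i /=.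
  by under eq_fun do rewrite /gtilde col_mxEu; exact: sqrE i1.
rewrite -(splitK i); case: (fintype.split i) => k /=.
  by under eq_fun do rewrite /gtilde col_mxEd col_mxEu; exact: sqrE i3.
by under eq_fun do rewrite /gtilde !col_mxEd; exact: sqrE ig.
Qed.

Lemma intg_gtilde_mul th a th' b :
  intg (fun w => gtilde pool (z w) th a 0 * gtilde pool (z w) th' b 0).
Proof.
by apply: intg_mul_sqr; [exact: mx_measurable_gtilde_Zobs|exact: mx_measurable_gtilde_Zobs|
  exact: intg_sqr_gtilde|exact: intg_sqr_gtilde].
Qed.

Lemma intg_gtilde th a : intg (fun w => gtilde pool (z w) th a 0).
Proof. by apply: intg_sqr; [exact: mx_measurable_gtilde_Zobs|exact: intg_sqr_gtilde]. Qed.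

(** For a pool equal to [{s}], the squared residual of year [s] is a summand of a diagonal entry of
    [Rlo^T Rlo], and that entry is at most the Frobenius norm under the supremum in [h3e]. *)
Lemma intg_sqr_Rtilde th s : Theta th -> intg (fun w => Rtilde (z w) (pbeta th) s 0 ^+ 2).
Proof.
move=> Tth; have [t [k tk]] := pool_singleton hpool s T_gt1.
have mR := mx_measurable_Rtilde (obs_measurable_Zobs M j) (pbeta th).
apply: (intg_dominated_outer _ _ _ h3e).
- by under eq_fun do rewrite expr2; apply: measurable_funM; exact: mR.
- by move=> w; exact: sqr_ge0.
move=> w; apply: le_trans (ereal_sup_ubound (x := (fnorm ((Rlo pool (z w) (pbeta th))^T *m
    Rlo pool (z w) (pbeta th)))%:E) _); last by exists th.
rewrite lee_fin; set A := _ *m _.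
apply: (@le_trans _ _ (A k k)).
  rewrite [leRHS]mxE (bigD1 t)//= [(_^T) _ _]mxE.
  have -> : Rlo pool (z w) (pbeta th) t k = Rtilde (z w) (pbeta th) s 0.
    by rewrite /Rlo mxE tk big_set1.
  by rewrite -expr2 lerDl; apply: sumr_ge0 => i _; rewrite mxE -expr2 sqr_ge0.
apply: le_trans (ler_norm _) _; rewrite -sqrtr_sqr ler_wsqrtr//.
rewrite (bigD1 k)//= (bigD1 k)//= -addrA lerDl addr_ge0//; first by apply: sumr_ge0 => i _; exact: sqr_ge0.
by apply: sumr_ge0 => i _; apply: sumr_ge0 => l _; exact: sqr_ge0.
Qed.

Let mmu t : measurable_fun setT (fun w => mubar M j w t 0).
Proof. exact: mx_measurable_mubar. Qed.

Let mu2 t : intg (fun w => mubar M j w t 0 ^+ 2).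
Proof.
have := Lfun2_integrable_sqr (hmu j t); apply: eq_integrable => // w _.
by rewrite /= mxE.
Qed.

Let R2 t : intg (fun w => (mubar M j w t 0 + epsbar M j w t 0) ^+ 2).
Proof.
have := intg_sqr_Rtilde t theta0_in; apply: eq_intg => w.
by rewrite pbeta_theta0 Rtilde0 mxE.
Qed.

(** The noise is the difference of the residual at the truth and value added, both square
    integrable. *)
Let eps2 t : intg (fun w => epsbar M j w t 0 ^+ 2).
Proof.
have meps := mx_measurable_epsbar M j t 0.
have := intg_sqrD (measurable_funD (mmu t) meps) (measurable_funM (measurable_cst (-1 : R)) (mmu t))
  (R2 t) (intg_sqrZ (-1) (mu2 t)).
by apply: eq_intg => w; congr (_ ^+ 2); rewrite /=; ring.
Qed.

Let iscore t (i : 'I_(class_size M j)) : intg (score_noise t i).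
Proof. by have [] := h1a t i. Qed.

Let other_year (t : 'I_T) : exists s : 'I_T, s != t.
Proof.
have [t0|t0] := eqVneq (t : nat) 0%N.
  by exists (Ordinal T_gt1); apply/eqP => /(congr1 val)/= E; rewrite -E in t0.
exists (Ordinal (ltnW T_gt1)); apply/eqP => /(congr1 val)/= E.
by rewrite -E eqxx in t0.
Qed.

(** Integrability of the earnings noise is contained in [h1b], which speaks of year [t] only in the
    presence of a second year. *)
Let iearn t (i : 'I_(class_size M j)) : intg (earnings_noise t i).
Proof. by have [s st] := other_year t; have [] := h1b i st. Qed.

Let ieps t : intg (fun w => epsbar M j w t 0).
Proof.
have := intgZ (class_size M j)%:R^-1 (intg_sum (index_enum _) (fun i (_ : true) => iscore t i)).
by apply: eq_intg => w; rewrite mxE.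
Qed.

Let ieta t : intg (fun w => etabar M j w t 0).
Proof.
have := intgZ (class_size M j)%:R^-1 (intg_sum (index_enum _) (fun i (_ : true) => iearn t i)).
by apply: eq_intg => w; rewrite mxE.
Qed.

Let mu_eps s t : mean_orthogonal P (fun w => mubar M j w s 0) (fun w => epsbar M j w t 0).
Proof.
apply: (@eq_mean_orthogonal _ _ _ _ _ (fun w => (class_size M j)%:R^-1 *
    \sum_(i < class_size M j) score_noise t i w)) => [w|]; first by rewrite mxE.
apply: mean_orthogonal_avg => // i.
by apply: condexp0_orthogonal (h1a t i); exact: mx_measurable_mubar.
Qed.

Let mu_eta s t : s != t ->
  mean_orthogonal P (fun w => mubar M j w s 0) (fun w => etabar M j w t 0).
Proof.
move=> st.
apply: (@eq_mean_orthogonal _ _ _ _ _ (fun w => (class_size M j)%:R^-1 *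
    \sum_(i < class_size M j) earnings_noise t i w)) => [w|]; first by rewrite mxE.
apply: mean_orthogonal_avg => // i.
have mr : mx_measurable (fun w => row s (mubar M j w)) by move=> a b; under eq_fun do rewrite mxE; exact: mx_measurable_mubar.
rewrite (_ : (fun w => mubar M j w s 0) = fun w => row s (mubar M j w) 0 0).
  exact: condexp0_orthogonal (h1b i st).
by apply/funext => w; rewrite [RHS]mxE.
Qed.

Let eps0 t : Ex (fun w => epsbar M j w t 0) = 0.
Proof.
rewrite -[RHS](mu_eps t t (h := cst 1) (c := 1))//.
- by apply: eq_Ex => w; rewrite mulr1.
- by move=> x; rewrite normr1.
Qed.

Let noise_indep s t (k l : 'I_(1 + 1)) : s != t ->
  indep_rv P (fun w => noise_pair M j s w 0 k) (fun w => noise_pair M j t w 0 l).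
Proof.
rewrite eq_sym => st A B mA mB; apply: (h1c st); exact: mx_sigma_coord.
Qed.

Let noise_eps s w : noise_pair M j s w 0 (lshift 1 0) = epsbar M j w s 0.
Proof. by rewrite row_mxEl mxE. Qed.

Let noise_eta s w : noise_pair M j s w 0 (rshift 1 0) = etabar M j w s 0.
Proof. by rewrite row_mxEr mxE. Qed.

Lemma Ex_gtilde0 a : Ex (fun w => gtilde pool (z w) (theta0 M) a 0) = 0.
Proof.
have mean0 U k : (U = mubar M j \/ U = epsbar M j \/ U = etabar M j) ->
    intg (fun w => ((ddot (Xbar M j w))^T *m ddot (U w)) k 0) /\
    Ex (fun w => ((ddot (Xbar M j w))^T *m ddot (U w)) k 0) = 0.
  move=> /h2c[iU /matrixP/(_ k 0)]; rewrite !mxE => EU; split; first exact: iU.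
  exact: EU.
have mean_mu k := mean0 _ k (or_introl erefl).
have mean_eps k := mean0 _ k (or_intror (or_introl erefl)).
have mean_eta k := mean0 _ k (or_intror (or_intror erefl)).
rewrite -(splitK a); case: (fintype.split a) => i /=.
  have E w : gtilde pool (z w) (theta0 M) (lshift _ i) 0 =
      ((ddot (Xbar M j w))^T *m ddot (mubar M j w)) i 0 +
      ((ddot (Xbar M j w))^T *m ddot (epsbar M j w)) i 0.
    rewrite /gtilde col_mxEu pbeta_theta0 /m1/= Rbar_obsE !ddotD ddotM.
    by rewrite -[_ + _ + ddot (epsbar _ _ _)]addrA addrAC subrr add0r mulmxDr mxDE.
  under eq_Ex do rewrite E.
  by have [? E1] := mean_mu i; have [? E2] := mean_eps i; rewrite ExD// E1 E2 addr0.
rewrite -(splitK i); case: (fintype.split i) => k /=.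
  have E w : gtilde pool (z w) (theta0 M) (rshift _ (lshift _ k)) 0 =
      kappa0 M * ((ddot (Xbar M j w))^T *m ddot (mubar M j w)) k 0 +
      ((ddot (Xbar M j w))^T *m ddot (etabar M j w)) k 0.
    rewrite /gtilde col_mxEd col_mxEu pbetaY_theta0 /m3/= Ybar_obsE !ddotD ddotM ddotZ.
    rewrite -[_ + _ + ddot (etabar _ _ _)]addrA addrAC subrr add0r mulmxDr mxDE.
    by rewrite -scalemxAr mxZE.
  under eq_Ex do rewrite E.
  have [i1 E1] := mean_mu k; have [i2 E2] := mean_eta k.
  by rewrite ExD ?ExZ// ?E1 ?E2 ?mulr0 ?addr0//; exact: intgZ.
(* Value added cancels from [Ytilde - kappa0 Rtilde] at the truth, leaving [eta - kappa0 eps]. *)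
have E w : gtilde pool (z w) (theta0 M) (rshift _ (rshift _ k)) 0 =
    \sum_t (\sum_(s in pool t k) (mubar M j w s 0 + epsbar M j w s 0)) *
      (etabar M j w t 0 - kappa0 M * epsbar M j w t 0).
  rewrite /gtilde !col_mxEd /g1_at pbeta_theta0 pbetaY_theta0 pkappa_theta0 /g1 mxE.
  apply: eq_bigr => t _; rewrite mxE /Rlo mxE Rtilde0 Ytilde0; congr (_ * _).
    by apply: eq_bigr => s _; rewrite mxE.
  by rewrite !mxE; ring.
have := intg_gtilde (theta0 M) (rshift _ (rshift _ k)).
under eq_fun do rewrite E.
move=> iS; refine (@Ex_leave_out_moment _ _ _ P T (fun t w => mubar M j w t 0)
  (fun t w => epsbar M j w t 0) (fun t w => etabar M j w t 0) (kappa0 M)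
  mmu mu2 ieps eps2 ieta eps0 mu_eps mu_eta _ _ _ (fun t => pool t k)
  (fun t => pool_notin hpool t k) (fun t => card_pool hpool t k) iS).
- move=> s t st; have := noise_indep (lshift 1 0) (lshift 1 0) st.
  by under eq_fun do rewrite noise_eps; under [X in indep_rv _ _ X]eq_fun do rewrite noise_eps.
- move=> s t st; have := noise_indep (lshift 1 0) (rshift 1 0) st.
  by under eq_fun do rewrite noise_eps; under [X in indep_rv _ _ X]eq_fun do rewrite noise_eta.
- move=> s t st; have := noise_indep (rshift 1 0) (rshift 1 0) st.
  by under eq_fun do rewrite noise_eta; under [X in indep_rv _ _ X]eq_fun do rewrite noise_eta.
Qed.

End teacher.

(** * Slopes along lines, with quadratic remainder *)

Section slope.
Context (R : realType).
Implicit Types (f g : R -> R).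

Definition has_slope f x l := exists C, forall t, `|t| <= 1 ->
  `|f (x + t) - f x - t * l| <= C * t ^+ 2.

Lemma has_slope_derive1 f x l : has_slope f x l -> derive1 f x = l.
Proof. by move=> [C fC]; exact: derive1_quadratic_bound fC. Qed.

Lemma has_slopeD f g x l l' : has_slope f x l -> has_slope g x l' ->
  has_slope (fun t => f t + g t) x (l + l').
Proof.
move=> [C fC] [D gD]; exists (C + D) => t t1.
rewrite (_ : _ - _ = (f (x + t) - f x - t * l) + (g (x + t) - g x - t * l')); last by ring.
by apply: le_trans (ler_normD _ _) _; rewrite mulrDl lerD ?fC ?gD.
Qed.

Lemma has_slopeZ k f x l : has_slope f x l -> has_slope (fun t => k * f t) x (k * l).
Proof.
move=> [C fC]; exists (`|k| * C) => t t1.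
rewrite (_ : _ - _ = k * (f (x + t) - f x - t * l)); last by ring.
by rewrite normrM -mulrA ler_wpM2l// fC.
Qed.

Lemma has_slope_quadratic q0 q1 q2 : has_slope (fun t => q0 + q1 * t + q2 * t ^+ 2) 0 q1.
Proof.
exists `|q2| => t _; rewrite (_ : _ - _ = q2 * t ^+ 2); last by ring.
by rewrite normrM [`|t ^+ 2|]ger0_norm ?sqr_ge0.
Qed.

Lemma has_slope_sum (I : Type) (s : seq I) (F : I -> R -> R) x (l : I -> R) :
  (forall i, has_slope (F i) x (l i)) ->
  has_slope (fun t => \sum_(i <- s) F i t) x (\sum_(i <- s) l i).
Proof.
move=> Fl; elim: s => [|i s IH].
  rewrite big_nil; exists 0 => t _.
  by rewrite !big_nil subrr mulr0 subrr normr0 mul0r.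
under eq_fun do rewrite big_cons; rewrite big_cons.
exact: has_slopeD.
Qed.

Definition quadratic f := exists q0 q1 q2, forall t, f t = q0 + q1 * t + q2 * t ^+ 2.

Lemma quadraticD f g : quadratic f -> quadratic g -> quadratic (fun t => f t + g t).
Proof.
move=> [a [b [c fE]]] [a' [b' [c' gE]]]; exists (a + a'), (b + b'), (c + c') => t.
by rewrite fE gE; ring.
Qed.

Lemma quadratic_sum (I : Type) (s : seq I) (F : I -> R -> R) :
  (forall i, quadratic (F i)) -> quadratic (fun t => \sum_(i <- s) F i t).
Proof.
move=> qF; elim: s => [|i s IH].
  by exists 0, 0, 0 => t; rewrite big_nil; ring.
by under eq_fun do rewrite big_cons; exact: quadraticD.
Qed.

Lemma quadratic_slope f : quadratic f -> has_slope f 0 (derive1 f 0).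
Proof.
move=> [a [b [c fE]]]; have H := has_slope_quadratic a b c.
have -> : f = fun t => a + b * t + c * t ^+ 2 by exact/funext.
by rewrite (has_slope_derive1 H).
Qed.

(** Exact in degree 2: the derivative becomes a combination of two values, so its integrability
    follows from that of the function at two nearby points. *)
Lemma quadratic_central_difference f e : e != 0 -> quadratic f ->
  derive1 f 0 = (2 * e)^-1 * f e - (2 * e)^-1 * f (- e).
Proof.
move=> e0 [a [b [c fE]]]; have -> : f = fun t => a + b * t + c * t ^+ 2 by exact/funext.
by rewrite (has_slope_derive1 (has_slope_quadratic a b c)); field.
Qed.

(** [e] has arbitrary norm, whereas the cubic expansion holds on the unit ball. When [|t e| > 1],
    the inequality [1 <= |e|^2 t^2] makes the crude bound on the left side quadratic in [t]. *)
Lemma cubic_slope p (f : 'cV[R]_p -> R) e : cubic f ->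
  has_slope (fun t => f (t *: e)) 0 (derive1 (fun t => f (t *: e)) 0).
Proof.
have [->|e0] := eqVneq e 0.
  move=> _; have H : has_slope (fun t => f (t *: (0 : 'cV[R]_p))) 0 0.
    by exists 0 => t _; rewrite !scaler0 subrr mulr0 subrr normr0 mul0r.
  by rewrite (has_slope_derive1 H).
pose n := `|e|; have n0 : 0 < n by rewrite normr_gt0.
move=> cf; have [D0 [C0 fC]] := cubic_expansion cf.
have [B fB] := cubic_bounded n cf.
pose l := (D0 *m e) 0 0.
suff H : has_slope (fun t => f (t *: e)) 0 l by rewrite (has_slope_derive1 H).
have B0 : 0 <= B by have := fB 0; rewrite normr0 => /(_ (ltW n0)); exact: le_trans.
have n20 : 0 <= n ^+ 2 by exact: sqr_ge0.
have S0 : 0 <= 2 * B + `|l| by rewrite addr_ge0// mulr_ge0.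
have t20 (t : R) : 0 <= t ^+ 2 by exact: sqr_ge0.
exists (`|C0| * n ^+ 2 + (2 * B + `|l|) * (n ^+ 2 + n ^+ 2)) => t t1.
rewrite add0r scale0r.
have [le|lt] := leP `|t *: e| 1.
  rewrite mulrDl; apply: (@le_trans _ _ (`|C0| * n ^+ 2 * t ^+ 2)).
    have := fC _ le; rewrite -scalemxAr mxZE -/l => /le_trans; apply.
    rewrite normrZ exprMn real_normK ?num_real// [t ^+ 2 * _]mulrC -mulrA.
    by rewrite ler_wpM2r ?ler_norm// mulr_ge0// sqr_ge0.
  by rewrite lerDl; apply: mulr_ge0 (t20 t); apply: mulr_ge0 => //; exact: addr_ge0.
have nt : 1 <= n ^+ 2 * t ^+ 2.
  have -> : n ^+ 2 * t ^+ 2 = `|t *: e| ^+ 2.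
    by rewrite normrZ exprMn real_normK ?num_real// mulrC.
  by rewrite expr_ge1// ltW.
apply: (@le_trans _ _ (2 * B + `|l|)).
  apply: le_trans (ler_normB _ _) _; apply: lerD.
    apply: le_trans (ler_normB _ _) _; rewrite mulr_natl mulr2n; apply: lerD.
      apply: fB; rewrite normrZ; apply: ler_piMl => //; exact: ltW.
    by apply: fB; rewrite normr0 ltW.
  by rewrite normrM ler_piMl.
apply: (@le_trans _ _ ((2 * B + `|l|) * (n ^+ 2 * t ^+ 2))).
  by rewrite ler_peMr.
rewrite [leRHS]mulrDl -[leLHS]add0r; apply: lerD; first by apply: mulr_ge0 => //; exact: mulr_ge0.
rewrite -[leRHS]mulrA ler_wpM2l// mulrDl lerDl.
exact: mulr_ge0.
Qed.

End slope.

(** * Differentiation of mean moments *)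

Section moment_means.
Context d (Omega : measurableType d) (R : realType) (P : probability Omega R).
Local Notation Ex := (Ex P).
Local Notation intg := (intg P).

Lemma mx_mean_mul m n p q (C : 'M[R]_(m, n)) (A : Omega -> 'M[R]_(n, p)) (D : 'M[R]_(p, q)) i j :
  mx_integrable P A ->
  intg (fun w => (C *m A w *m D) i j) /\
  Ex (fun w => (C *m A w *m D) i j) = (C *m mx_mean P A *m D) i j.
Proof.
move=> iA; have E (B : 'M[R]_(n, p)) :
    (C *m B *m D) i j = \sum_k \sum_l (C i l * D k j) * B l k.
  rewrite mxE; apply: eq_bigr => k _; rewrite !mxE mulr_suml.
  by apply: eq_bigr => l _; ring.
have i1 k : intg (fun w => \sum_l (C i l * D k j) * A w l k).
  by apply: intg_sum => l _; exact/intgZ/iA.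
split; first by under eq_fun do rewrite E; apply: intg_sum => k _; exact: i1.
under eq_Ex do rewrite E; rewrite E Ex_sum => [|k _]; last exact: i1.
apply: eq_bigr => k _; rewrite Ex_sum => [|l _]; last exact/intgZ/iA.
by apply: eq_bigr => l _; rewrite ExZ ?mxE//; exact: iA.
Qed.

Context (p q : nat) (m : nat -> Omega -> 'cV[R]_p -> 'cV[R]_q).
Hypothesis m_cubic : forall j w a, cubic (fun h => m j w h a 0).
Hypothesis m_intg : forall a h, intg (fun w => m 0 w h a 0).

(** Expectation and derivative commute, so the Jacobian depends on the mean function alone. Identity
    in law, which transports means, thus transports Jacobians. *)
Lemma moment_jacobian_derive1 a c : moment_jacobian P m a c =
  derive1 (fun t : R => moment_mean P m (t *: delta_mx c 0) a 0) 0.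
Proof.
apply/esym; have [C hC] := moment_mean_expansion m_cubic m_intg.
apply: (@derive1_quadratic_bound _ _ _ _ (`|C|)) => t t1.
rewrite add0r scale0r; set e := delta_mx c 0.
have e1 : `|e| <= 1.
  by apply: ler_norm_entries => // i k; rewrite mxE; case: (_ && _); rewrite ?normr1 ?normr0.
have te : `|t *: e| <= `|t| by rewrite normrZ ler_piMr.
have -> : moment_mean P m (t *: e) a 0 - moment_mean P m 0 a 0 - t * moment_jacobian P m a c =
    (moment_mean P m (t *: e) - moment_mean P m 0 - moment_jacobian P m *m (t *: e)) a 0.
  rewrite !mxBE; congr (_ - _).
  by rewrite -scalemxAr mxZE -colE [in RHS]mxE.
apply: le_trans (ler_entry_norm _ _ _) _.
apply: le_trans (hC _ (le_trans te t1)) _.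
apply: (@le_trans _ _ (`|C| * `|t *: e| ^+ 2)).
  by rewrite ler_wpM2r ?sqr_ge0// ler_norm.
by rewrite ler_wpM2l// -[leRHS]real_normK ?num_real// lerXn2r ?nnegrE.
Qed.

Lemma moment_jacobian_row a x y :
  (forall t, moment_mean P m (t *: x) a 0 = moment_mean P m 0 a 0 + t * y) ->
  (moment_jacobian P m *m x) a 0 = y.
Proof.
move=> H; have rowP (v : 'cV[R]_q) : ((delta_mx 0 a : 'rV_q) *m v) 0 0 = v a 0.
  by rewrite -rowE mxE.
by rewrite -rowP mulmxA; apply: moment_jacobianE => // t; rewrite !rowP.
Qed.

(** Differentiating the interpolation formula expresses the derivative as a fixed combination of
    node values. *)
Lemma intg_derive1_moment a c :
  intg (fun w => derive1 (fun t : R => m 0 w (t *: delta_mx c 0) a 0) 0).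
Proof.
have [r [x [lam [lamE clam]]]] := @cubic_interpolation R p.
rewrite (_ : (fun w => _) = fun w => \sum_i derive1 (fun t : R => lam (t *: delta_mx c 0) i 0) 0 * m 0 w (x i) a 0).
  by apply: intg_sum => i _; exact: intgZ.
apply/funext => w; apply: has_slope_derive1.
under eq_fun do rewrite (lamE _ (m_cubic 0 w a)).
apply: has_slope_sum => i; under eq_fun do rewrite mulrC; rewrite mulrC.
apply: has_slopeZ; exact: (cubic_slope _ (clam i)).
Qed.

End moment_means.

(** * Transfer of population moments to an arbitrary teacher *)

Section moments_iid.
Context d (Omega : measurableType d) (R : realType) (P : probability Omega R).
Local Notation Ex := (Ex P).
Local Notation intg := (intg P).
Context (p q : nat) (m : nat -> Omega -> 'cV[R]_p -> 'cV[R]_q) (j0 : nat).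
Hypothesis m_cubic : forall j w a, cubic (fun h => m j w h a 0).
Hypothesis m_intg : forall j a h, intg (fun w => m j w h a 0).
Hypothesis m_intg2 : forall j a h b h', intg (fun w => m j w h a 0 * m j w h' b 0).
Hypothesis m_iid1 : forall (c : 'rV_q) h, iid_rv P (fun j w => (c *m m j w h) 0 0).
Hypothesis m_iid2 : forall a h b h', iid_rv P (fun j w => m j w h a 0 * m j w h' b 0).

Let iid_Ex (Z : nat -> Omega -> R) : iid_rv P Z -> intg (Z 0%N) -> Ex (Z 0%N) = Ex (Z j0).
Proof.
by move=> iZ i0; have [_ ->] := iid_rv_Ex (f := idfun) j0 iZ (@measurable_id _ _ setT) i0.
Qed.

Lemma moment_mean_iid : moment_mean P m = moment_mean P (fun=> m j0).
Proof.
apply/funext => h; apply/colP => a; rewrite [LHS]mxE [RHS]mxE.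
have E j w : ((delta_mx 0 a : 'rV_q) *m m j w h) 0 0 = m j w h a 0 by rewrite -rowE mxE.
have i0 : intg (fun w => ((delta_mx 0 a : 'rV_q) *m m 0 w h) 0 0).
  by under eq_fun do rewrite E.
by have := iid_Ex (m_iid1 (delta_mx 0 a) h) i0; under eq_Ex do rewrite E; under [X in _ = X]eq_Ex do rewrite E.
Qed.

Lemma moment_second_iid : moment_second P m = moment_second P (fun=> m j0).
Proof.
apply/matrixP => a b; rewrite [LHS]mxE [RHS]mxE.
exact: (iid_Ex (m_iid2 a 0 b 0) (m_intg2 0 a 0 b 0)).
Qed.

Lemma moment_jacobian_iid : moment_jacobian P m = moment_jacobian P (fun=> m j0).
Proof.
apply/matrixP => a c; rewrite (moment_jacobian_derive1 m_cubic (m_intg 0)) moment_mean_iid.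
by rewrite -(moment_jacobian_derive1 (fun=> m_cubic j0) (m_intg j0)).
Qed.

End moments_iid.

(** * The exactly identified moment and its derivatives *)

Section ols_moment.
Context (R : realType) (K T : nat) (pool : 'I_T -> 'I_T.-1 -> {set 'I_T}).
Implicit Types (z : obs R K T) (b bY : 'cV[R]_K) (phi : 'cV[R]_T.-1) (k : R).

(** Adding and subtracting [k Rtilde] inside the residual separates the moment [g1] from the
    prediction moment [m2]; this relates the multi-step estimator to [gtilde]. *)
Lemma g_decomposition z b phi bY k :
  g pool z b phi bY k = phi^T *m g1 pool z b bY k + k *: (phi^T *m m2 pool z b phi).
Proof.
rewrite /g /g1 /m2; move: (Ytilde z bY) (Rtilde z b) (Rlo pool z b) => Y R0 L.
have -> : Y - k *: (L *m phi) = (Y - k *: R0) + k *: (R0 - L *m phi).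
  by rewrite scalerBr addrA subrK.
by rewrite [LHS]mulmxDr -scalemxAr !mulmxA.
Qed.

Lemma derive1_g_kappa z b phi bY k :
  derive1 (fun k' : R => g pool z b phi bY k' 0 0) k =
  - (phi^T *m ((Rlo pool z b)^T *m Rlo pool z b) *m phi) 0 0.
Proof.
apply: has_slope_derive1; exists 0 => t _; rewrite mul0r le_eqVlt normr_eq0.
apply/orP; left; apply/eqP.
have E k' : g pool z b phi bY k' 0 0 = (phi^T *m (Rlo pool z b)^T *m Ytilde z bY) 0 0 -
    k' * (phi^T *m ((Rlo pool z b)^T *m Rlo pool z b) *m phi) 0 0.
  by rewrite /g mulmxBr mxBE -scalemxAr mxZE !mulmxA.
by rewrite !E; ring.
Qed.

(** The form is chosen so that the first two terms have mean zero at the truth, which leaves the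
    Gram term as the mean derivative. *)
Lemma derive1_g_phi z b phi bY k c :
  derive1 (fun h : R => g pool z b (phi + h *: delta_mx c 0) bY k 0 0) 0 =
  g1 pool z b bY k c 0 + k * m2 pool z b phi c 0 -
  k * (phi^T *m ((Rlo pool z b)^T *m Rlo pool z b)) 0 c.
Proof.
set L := Rlo pool z b; set e : 'cV[R]_T.-1 := delta_mx c 0.
have E h : g pool z b (phi + h *: e) bY k 0 0 = g pool z b phi bY k 0 0 +
    ((e^T *m (L^T *m (Ytilde z bY - k *: (L *m phi)))) 0 0 -
      k * (phi^T *m (L^T *m L) *m e) 0 0) * h +
    (- (k * (e^T *m (L^T *m L) *m e) 0 0)) * h ^+ 2.
  have trE : (phi + h *: e)^T = phi^T + h *: e^T by rewrite linearD/= linearZ.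
  rewrite /g -/L trE; move: (Ytilde z bY) => Y.
  have -> : Y - k *: (L *m (phi + h *: e)) = (Y - k *: (L *m phi)) - (k * h) *: (L *m e).
    by rewrite [L *m (_ + _)]mulmxDr scalerDr opprD addrA -scalemxAr scalerA.
  move: (Y - k *: (L *m phi)) => u.
  rewrite !mulmxDl mulmxBr mulmxBr -!scalemxAl -!scalemxAr !(mxBE, mxDE, mxNE, mxZE) !mulmxA.
  by ring.
under eq_fun do rewrite E.
rewrite (has_slope_derive1 (has_slope_quadratic _ _ _)); congr (_ - _ * _).
  rewrite trmx_delta -rowE [LHS]mxE -mxZE -mxDE; congr (fun_of_matrix _ c 0).
  rewrite /g1 /m2 -/L; move: (Ytilde z bY) (Rtilde z b) => Y R0.
  rewrite [k *: (L^T *m _)]scalemxAr -mulmxDr; congr (_ *m _).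
  by rewrite scalerBr addrA subrK.
by rewrite -colE [LHS]mxE.
Qed.

Lemma quadratic_m2 z b phi l c :
  quadratic (fun h : R => m2 pool z (b + h *: delta_mx c 0) phi l 0).
Proof.
have affR t : exists u v, forall h : R, Rtilde z (b + h *: delta_mx c 0) t 0 = u + v * h.
  exists (Rtilde z b t 0), (- (obsX z *m (delta_mx c 0 : 'cV[R]_K)) t 0) => h.
  by rewrite /Rtilde mulmxDr opprD addrA mxBE -scalemxAr mxZE; ring.
have /choice[u /choice[v uv]] := affR.
have affL t i h : Rlo pool z (b + h *: delta_mx c 0) t i =
    (\sum_(s in pool t i) u s) + (\sum_(s in pool t i) v s) * h.
  rewrite /Rlo mxE mulr_suml -big_split/=; apply: eq_bigr => s _; exact: uv.
rewrite /m2; under eq_fun do rewrite mxE.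
apply: quadratic_sum => t.
pose U i := \sum_(s in pool t i) u s; pose V i := \sum_(s in pool t i) v s.
exists (U l * (u t - \sum_i U i * phi i 0)),
  (U l * (v t - \sum_i V i * phi i 0) + V l * (u t - \sum_i U i * phi i 0)),
  (V l * (v t - \sum_i V i * phi i 0)) => h.
rewrite mxE affL mxBE uv mxE.
have -> : \sum_i Rlo pool z (b + h *: delta_mx c 0) t i * phi i 0 =
    \sum_i U i * phi i 0 + (\sum_i V i * phi i 0) * h.
  rewrite mulr_suml -big_split/=; apply: eq_bigr => i _.
  by rewrite affL -/(U i) -/(V i); ring.
by rewrite -/(U l) -/(V l); ring.
Qed.

End ols_moment.

(** * Almost sure vanishing *)

Section almost_everywhere.
Context d (Omega : measurableType d) (R : realType) (P : probability Omega R).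
Local Notation Ex := (Ex P).
Local Notation intg := (intg P).

Lemma ae_eq0_Ex (F : Omega -> R) : intg F -> {ae P, forall w, F w = 0} -> Ex F = 0.
Proof.
move=> iF F0; have := integral_Ex iF.
rewrite (ae_eq_integral (cst 0%E))//.
- by rewrite integral0 => -[].
- by apply/measurable_EFinP; exact: intg_measurable iF.
- by apply: filterS F0 => w Fw _; rewrite /= Fw.
Qed.

Lemma Ex_sqr_eq0 (X : Omega -> R) : measurable_fun setT X -> intg (fun w => X w ^+ 2) ->
  Ex (fun w => X w ^+ 2) = 0 -> {ae P, forall w, X w = 0}.
Proof.
move=> mX iX E0.
have mX2 : measurable_fun setT (fun w => (X w ^+ 2)%:E) by apply/measurable_EFinP; exact: intg_measurable iX.
have /(ae_eq_integral_abs P measurableT mX2) : (\int[P]_w `|(X w ^+ 2)%:E| = 0)%E.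
  under eq_integral do rewrite /= ger0_norm ?sqr_ge0//.
  by rewrite integral_Ex// E0.
apply: filterS => w /(_ I)/= [] /eqP; by rewrite sqrf_eq0 => /eqP.
Qed.

End almost_everywhere.

(** * Identification and comparison of variances for one teacher *)

Section population.
Context d (Omega : measurableType d) (R : realType) (P : probability Omega R).
Local Notation Ex := (Ex P).
Local Notation intg := (intg P).
Context (K T : nat) (M : va_model P K T) (pool : 'I_T -> 'I_T.-1 -> {set 'I_T}).
Context (j : nat) (phi0 : 'cV[R]_T.-1) (Theta : set (param R K)) (r0 : R).
Local Notation z := (Zobs M j).
Local Notation b0 := (beta0 M).
Local Notation bY0 := (betaY0 M).
Local Notation k0 := (kappa0 M).
Hypothesis r0_gt0 : 0 < r0.
Hypothesis gtilde2 : forall th a, intg (fun w => gtilde pool (z w) th a 0 ^+ 2).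
Hypothesis gtilde0 : forall a, Ex (fun w => gtilde pool (z w) (theta0 M) a 0) = 0.
Hypothesis Rtilde2 : forall b s, `|b - b0| <= r0 -> intg (fun w => Rtilde (z w) b s 0 ^+ 2).
Hypothesis gram_intg : mx_integrable P (fun w => (ddot (Xbar M j w))^T *m ddot (Xbar M j w)).
Hypothesis gram_unit : ddotX_gram M j \in unitmx.
Hypothesis hphi0 : best_linear_predictor M pool j phi0.
Hypothesis predicted_var : exists t, (0 < 'V_P[fun w => (predicted M pool j phi0 w t 0)%R])%E.
Hypothesis hW : gtilde_var M pool j \in unitmx.

(** A family constant in its index, so that results on families of moment functions apply to the
    single teacher [j]. *)
Let m (_ : nat) w h := gtilde pool (z w) (theta0 M + h).

Let mR b : mx_measurable (fun w => Rtilde (z w) b).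
Proof. exact/mx_measurable_Rtilde/obs_measurable_Zobs. Qed.

Let mL b : mx_measurable (fun w => Rlo pool (z w) b).
Proof. exact/mx_measurable_Rlo/obs_measurable_Zobs. Qed.

Let mg th : mx_measurable (fun w => gtilde pool (z w) th).
Proof. exact/mx_measurable_gtilde/obs_measurable_Zobs. Qed.

Let m_cubic i w a : cubic (fun h => m i w h a 0).
Proof. exact: gtilde_cubic. Qed.

Let m_intg a h : intg (fun w => m 0 w h a 0).
Proof. by apply: intg_sqr; [exact: mg|exact: gtilde2]. Qed.

Let m_intg2 a h b h' : intg (fun w => m 0 w h a 0 * m 0 w h' b 0).
Proof. by apply: intg_mul_sqr; [exact: mg|exact: mg|exact: gtilde2|exact: gtilde2]. Qed.

Let near0 : `|b0 - b0| <= r0. Proof. by rewrite subrr normr0 ltW. Qed.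

Let Rlo2 b t k : `|b - b0| <= r0 -> intg (fun w => Rlo pool (z w) b t k ^+ 2).
Proof.
move=> nb; rewrite /Rlo; under eq_fun do rewrite mxE.
by apply: intg_sqr_sum => [s|s _]; [exact: mR|exact: Rtilde2].
Qed.

Lemma mx_integrable_Rlo_Rtilde b : `|b - b0| <= r0 ->
  mx_integrable P (fun w => (Rlo pool (z w) b)^T *m Rtilde (z w) b).
Proof.
move=> nb k l; rewrite ord1.
have : intg (fun w => \sum_t Rlo pool (z w) b t k * Rtilde (z w) b t 0).
  by apply: intg_sum => t _; apply: intg_mul_sqr; [exact: mL|exact: mR|exact: Rlo2|exact: Rtilde2].
by apply: eq_intg => w; rewrite [RHS]mxE; apply: eq_bigr => t _; rewrite [_^T _ _]mxE.
Qed.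

Lemma mx_integrable_Rlo_Rlo b : `|b - b0| <= r0 ->
  mx_integrable P (fun w => (Rlo pool (z w) b)^T *m Rlo pool (z w) b).
Proof.
move=> nb k l.
have : intg (fun w => \sum_t Rlo pool (z w) b t k * Rlo pool (z w) b t l).
  by apply: intg_sum => t _; apply: intg_mul_sqr; [exact: mL|exact: mL|exact: Rlo2|exact: Rlo2].
by apply: eq_intg => w; rewrite [RHS]mxE; apply: eq_bigr => t _; rewrite [_^T _ _]mxE.
Qed.

Let A := ddotX_gram M j.
Let B := mx_mean P (fun w => (Rlo0 M pool j w)^T *m Rlo0 M pool j w).
Let q := mx_mean P (fun w => (Rlo0 M pool j w)^T *m Rtilde (z w) b0).

Lemma moment_mean_m1 h k : moment_mean P m h (lshift _ k) 0 = - (A *m pbeta h) k 0.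
Proof.
rewrite mxE /m.
have E w : gtilde pool (z w) (theta0 M + h) (lshift _ k) 0 =
    gtilde pool (z w) (theta0 M) (lshift _ k) 0 -
    (1%:M *m ((ddot (Xbar M j w))^T *m ddot (Xbar M j w)) *m pbeta h) k 0.
  by rewrite mul1mx; exact: gtilde_m1D.
under eq_Ex do rewrite E.
have [iX EX] := mx_mean_mul 1%:M (pbeta h) k 0 gram_intg.
rewrite ExB// ?EX ?gtilde0 ?mul1mx ?sub0r//.
by have := m_intg (lshift _ k) 0; rewrite /m addr0.
Qed.

Lemma moment_mean_m3 h k : moment_mean P m h (rshift _ (lshift _ k)) 0 = - (A *m pbetaY h) k 0.
Proof.
rewrite mxE /m.
have E w : gtilde pool (z w) (theta0 M + h) (rshift _ (lshift _ k)) 0 =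
    gtilde pool (z w) (theta0 M) (rshift _ (lshift _ k)) 0 -
    (1%:M *m ((ddot (Xbar M j w))^T *m ddot (Xbar M j w)) *m pbetaY h) k 0.
  by rewrite mul1mx; exact: gtilde_m3D.
under eq_Ex do rewrite E.
have [iX EX] := mx_mean_mul 1%:M (pbetaY h) k 0 gram_intg.
rewrite ExB// ?EX ?gtilde0 ?mul1mx ?sub0r//.
by have := m_intg (rshift _ (lshift _ k)) 0; rewrite /m addr0.
Qed.

Lemma moment_mean_g1 h k : pbeta h = 0 -> pbetaY h = 0 ->
  moment_mean P m h (rshift _ (rshift _ k)) 0 = - (pkappa h * q k 0).
Proof.
move=> hb hbY; rewrite mxE /m.
have E w : gtilde pool (z w) (theta0 M + h) (rshift _ (rshift _ k)) 0 =
    gtilde pool (z w) (theta0 M) (rshift _ (rshift _ k)) 0 -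
    pkappa h * ((Rlo0 M pool j w)^T *m Rtilde (z w) b0) k 0.
  by have := gtilde_g1D pool (z w) (theta0 M) k hb hbY; rewrite pbeta_theta0.
under eq_Ex do rewrite E.
have iq := mx_integrable_Rlo_Rtilde near0 k 0.
rewrite ExB; last exact: intgZ.
  by rewrite gtilde0 sub0r ExZ// [q k 0]mxE.
by have := m_intg (rshift _ (rshift _ k)) 0; rewrite /m addr0.
Qed.

Let risk (phi : 'cV[R]_T.-1) : R :=
  \sum_t Ex (fun w => (Rtilde (z w) b0 t 0 - predicted M pool j phi w t 0) ^+ 2).

Let predicted2 phi t : intg (fun w => predicted M pool j phi w t 0 ^+ 2).
Proof.
rewrite /predicted; under eq_fun do rewrite mxE.
apply: intg_sqr_sum => [k|k _].
  by under eq_fun do rewrite mulrC; apply: measurable_funM => //; exact: mL.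
by under eq_fun do rewrite mulrC; apply: intg_sqrZ; exact: Rlo2.
Qed.

Let mpredicted phi t : measurable_fun setT (fun w => predicted M pool j phi w t 0).
Proof. by apply: (mx_measurableM (mL b0)); exact: mx_measurable_cst. Qed.

Let error2 phi t : intg (fun w => (Rtilde (z w) b0 t 0 - predicted M pool j phi w t 0) ^+ 2).
Proof.
have mp := mpredicted phi t.
have := intg_sqrD (mR b0 t 0) (measurable_funM (measurable_cst (-1 : R)) mp)
  (Rtilde2 t near0) (intg_sqrZ (-1) (predicted2 phi t)).
by apply: eq_intg => w; congr (_ ^+ 2); rewrite /=; ring.
Qed.

Let risk_min phi : risk phi0 <= risk phi.
Proof.
have riskE psi : prediction_risk M pool j psi = (risk psi)%:E.
  rewrite /prediction_risk /risk -sumEFin; apply: eq_bigr => t _.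
  rewrite -integral_Ex//; by rewrite unlock.
by have := hphi0 phi; rewrite !riskE lee_fin.
Qed.

Let riskE phi : risk phi = \sum_t Ex (fun w => Rtilde (z w) b0 t 0 ^+ 2)
  - 2 * (phi^T *m q) 0 0 + bilin B phi phi.
Proof.
have iq := mx_integrable_Rlo_Rtilde near0; have iB := mx_integrable_Rlo_Rlo near0.
have iR2 : intg (fun w => \sum_t Rtilde (z w) b0 t 0 ^+ 2).
  by apply: intg_sum => t _; exact: Rtilde2.
have [iq' Eq] := mx_mean_mul phi^T 1%:M 0 0 iq.
have [iB' EB] := mx_mean_mul phi^T phi 0 0 iB.
rewrite /risk -Ex_sum; last by move=> t _; exact: error2.
rewrite -Ex_sum; last by move=> t _; exact: Rtilde2.
rewrite /bilin -EB; rewrite mulmx1 in Eq; rewrite -[(phi^T *m q) 0 0]Eq -ExZ//.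
rewrite -ExB//; last exact: intgZ.
rewrite -ExD//; last by apply: intgB => //; exact: intgZ.
apply: eq_Ex => w; rewrite mulmx1.
have -> : (phi^T *m ((Rlo pool (z w) b0)^T *m Rtilde (z w) b0)) 0 0 =
    \sum_t predicted M pool j phi w t 0 * Rtilde (z w) b0 t 0.
  by rewrite mulmxA -trmx_mul mxE; apply: eq_bigr => t _; rewrite [_^T _ _]mxE.
have -> : (phi^T *m ((Rlo pool (z w) b0)^T *m Rlo pool (z w) b0) *m phi) 0 0 =
    \sum_t predicted M pool j phi w t 0 ^+ 2.
  rewrite mulmxA -trmx_mul -mulmxA mxE; apply: eq_bigr => t _.
  by rewrite [_^T _ _]mxE expr2.
rewrite mulr_sumr -sumrB -big_split/=; apply: eq_bigr => t _; ring.
Qed.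

Lemma gram_sym : B^T = B.
Proof.
apply/matrixP => k l; rewrite !mxE; congr fine; congr expectation.
apply/funext => w; set C := _ *m _; have CT : C^T = C by rewrite trmx_mul trmxK.
by rewrite -{1}CT mxE.
Qed.

Lemma bilin_gram phi : bilin B phi phi =
  \sum_t Ex (fun w => predicted M pool j phi w t 0 ^+ 2).
Proof.
have [iB' EB] := mx_mean_mul phi^T phi 0 0 (mx_integrable_Rlo_Rlo near0).
rewrite /bilin -EB -Ex_sum//; apply: eq_Ex => w.
rewrite mulmxA -trmx_mul -mulmxA mxE; apply: eq_bigr => t _.
by rewrite [_^T _ _]mxE expr2.
Qed.

(** Minimality along every line through [phi0]. [B] is not yet known to be invertible, so directions
    with [bilin B dl dl = 0] are treated apart. *)
Lemma best_linear_predictor_normal : B *m phi0 = q.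
Proof.
suff H (dl : 'cV[R]_T.-1) : (dl^T *m (B *m phi0 - q)) 0 0 = 0.
  apply/eqP; rewrite -subr_eq0; apply/eqP/colP => k; rewrite [RHS]mxE.
  by have := H (delta_mx k 0); rewrite trmx_delta -rowE mxE.
set v := (_ *m _) 0 0.
have quad t : 0 <= 2 * t * v + t ^+ 2 * bilin B dl dl.
  have := risk_min (phi0 + t *: dl); rewrite !riskE.
  rewrite bilinDl !bilinDr !bilinZl !bilinZr [bilin B dl phi0](bilinC _ _ gram_sym).
  have -> : ((phi0 + t *: dl)^T *m q) 0 0 = (phi0^T *m q) 0 0 + t * (dl^T *m q) 0 0.
    by rewrite linearD/= linearZ/= mulmxDl mxDE -scalemxAl mxZE.
  have -> : v = bilin B dl phi0 - (dl^T *m q) 0 0.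
    by rewrite /v mulmxBr mxBE /bilin mulmxA.
  rewrite [bilin B dl phi0](bilinC _ _ gram_sym) -subr_ge0.
  by congr (0 <= _); ring.
have [c0|c0] := eqVneq (bilin B dl dl) 0.
  have := quad (- v); rewrite c0 mulr0 addr0 mulrN mulNr oppr_ge0 -mulrA -expr2.
  rewrite pmulr_rle0// => v0; apply/eqP; rewrite -sqrf_eq0 eq_le v0/=.
  exact: sqr_ge0.
have cgt : 0 < bilin B dl dl.
  rewrite lt_neqAle eq_sym c0/= bilin_gram; apply: sumr_ge0 => t _.
  by apply: Ex_ge0 => w; exact: sqr_ge0.
have := quad (- v / bilin B dl dl); set c := bilin B dl dl in c0 cgt *.
rewrite (_ : _ + _ = - (v ^+ 2 / c)); last by field.
rewrite oppr_ge0 pmulr_lle0 ?invr_gt0// => v0; apply/eqP; rewrite -sqrf_eq0 eq_le v0/=.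
exact: sqr_ge0.
Qed.

(** Relevance of the instruments: with the normal equation it gives [phi0^T q > 0], hence [q] is not
    0 and [kappa] is identified. *)
Lemma bilin_gram_gt0 : 0 < bilin B phi0 phi0.
Proof.
have [t vt] := predicted_var; rewrite bilin_gram (bigD1 t)//=.
have p0 : 0 < Ex (fun w => predicted M pool j phi0 w t 0 ^+ 2).
  rewrite -lte_fin; apply: lt_le_trans vt _; apply: variance_le_Ex_sqr => //.
  by apply: intg_sqr => //; exact: mpredicted.
by apply: ltr_wpDr => //; apply: sumr_ge0 => s _; apply: Ex_ge0 => w; exact: sqr_ge0.
Qed.

Let q_neq0 : q <> 0.
Proof.
move=> q0; have := bilin_gram_gt0.
by rewrite /bilin -mulmxA best_linear_predictor_normal q0 mulmx0 mxE ltxx.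
Qed.

Lemma param_eq0 (h : param R K) : pbeta h = 0 -> pbetaY h = 0 -> pkappa h = 0 -> h = 0.
Proof.
move=> hb hbY hk; rewrite -[h]vsubmxK -[dsubmx h]vsubmxK -/(pbeta h) -/(pbetaY h) hb hbY.
have -> : dsubmx (dsubmx h) = 0 by apply/colP => i; rewrite ord1 -/(pkappa h) hk mxE.
by rewrite !col_mx0.
Qed.

Let gram_inj (x : 'cV[R]_K) : A *m x = 0 -> x = 0.
Proof. by move=> Ax; rewrite -[x]mul1mx -(mulVmx gram_unit) -mulmxA Ax mulmx0. Qed.

(** The system is triangular: the invertible Gram matrix settles [beta] and [betaY], after which the
    last block is [- kappa q]. *)
Lemma population_identified h : moment_mean P m h = 0 -> h = 0.
Proof.
move=> /colP H.
have hb : pbeta h = 0.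
  apply: gram_inj; apply/colP => k; have := H (lshift _ k); rewrite moment_mean_m1 !mxE.
  by move=> /eqP; rewrite oppr_eq0 => /eqP.
have hbY : pbetaY h = 0.
  apply: gram_inj; apply/colP => k; have := H (rshift _ (lshift _ k)); rewrite moment_mean_m3 !mxE.
  by move=> /eqP; rewrite oppr_eq0 => /eqP.
apply: param_eq0 => //; apply: contra_notP q_neq0 => hk.
apply/colP => k; have := H (rshift _ (rshift _ k)); rewrite moment_mean_g1// [in RHS]mxE => /eqP.
by rewrite oppr_eq0 mulf_eq0 => /orP[/eqP //|/eqP ->]; rewrite mxE.
Qed.

Let G := moment_jacobian P m.

Lemma moment_mean0 : moment_mean P m 0 = 0.
Proof. by apply/colP => a; rewrite !mxE /m addr0 gtilde0. Qed.

Let jacobian_row a x y : (forall t, moment_mean P m (t *: x) a 0 = t * y) ->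
  (G *m x) a 0 = y.
Proof.
have z0 : moment_mean P m 0 a 0 = 0 by rewrite moment_mean0 mxE.
move=> H; apply: (moment_jacobian_row m_cubic m_intg) => t.
by transitivity (t * y); [exact: H|rewrite z0 add0r].
Qed.

Lemma jacobian_m1 x k : (G *m x) (lshift _ k) 0 = - (A *m pbeta x) k 0.
Proof.
apply: jacobian_row => t; rewrite moment_mean_m1 pbetaZ -scalemxAr mxZE.
by rewrite mulrN.
Qed.

Lemma jacobian_m3 x k : (G *m x) (rshift _ (lshift _ k)) 0 = - (A *m pbetaY x) k 0.
Proof.
apply: jacobian_row => t; rewrite moment_mean_m3 pbetaYZ -scalemxAr mxZE.
by rewrite mulrN.
Qed.

Lemma jacobian_g1 x k : pbeta x = 0 -> pbetaY x = 0 ->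
  (G *m x) (rshift _ (rshift _ k)) 0 = - (pkappa x * q k 0).
Proof.
move=> xb xbY; apply: jacobian_row => t; rewrite moment_mean_g1.
- by rewrite pkappaZ mulrN mulrA.
- by rewrite pbetaZ xb scaler0.
- by rewrite pbetaYZ xbY scaler0.
Qed.

Lemma population_jacobian_inj (x : param R K) : G *m x = 0 -> x = 0.
Proof.
move=> /colP H.
have hb : pbeta x = 0.
  apply: gram_inj; apply/colP => k; have := H (lshift _ k); rewrite jacobian_m1 !mxE.
  by move=> /eqP; rewrite oppr_eq0 => /eqP.
have hbY : pbetaY x = 0.
  apply: gram_inj; apply/colP => k; have := H (rshift _ (lshift _ k)); rewrite jacobian_m3 !mxE.
  by move=> /eqP; rewrite oppr_eq0 => /eqP.
apply: param_eq0 => //; apply: contra_notP q_neq0 => hk.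
apply/colP => k; have := H (rshift _ (rshift _ k)); rewrite jacobian_g1// [in RHS]mxE => /eqP.
by rewrite oppr_eq0 mulf_eq0 => /orP[/eqP //|/eqP ->]; rewrite mxE.
Qed.

Let g1w w := g1 pool (z w) b0 bY0 k0.
Let m2w w := m2 pool (z w) b0 phi0.

Let gtilde_g1w w l : gtilde pool (z w) (theta0 M) (rshift _ (rshift _ l)) 0 = g1w w l 0.
Proof. by rewrite gtilde_g1 /g1_at pbeta_theta0 pbetaY_theta0 pkappa_theta0. Qed.

Let m_0 w : m 0 w 0 = gtilde pool (z w) (theta0 M). Proof. by rewrite /m addr0. Qed.

Let g1w_mean l : intg (fun w => g1w w l 0) /\ Ex (fun w => g1w w l 0) = 0.
Proof.
split.
  by have := m_intg (rshift _ (rshift _ l)) 0; apply: eq_intg => w; rewrite m_0 gtilde_g1w.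
by have := gtilde0 (rshift _ (rshift _ l)); under eq_Ex do rewrite gtilde_g1w.
Qed.

Lemma m2_intg b l : `|b - b0| <= r0 -> intg (fun w => m2 pool (z w) b phi0 l 0).
Proof.
move=> nb; have i1 := mx_integrable_Rlo_Rtilde nb l 0.
have [i2 _] := mx_mean_mul 1%:M phi0 l 0 (mx_integrable_Rlo_Rlo nb).
have := intgB i1 i2; apply: eq_intg => w.
by rewrite mul1mx /m2 (mulmxBr (Rlo pool (z w) b)^T (Rtilde (z w) b)) mxBE mulmxA.
Qed.

Let m2w_mean l : intg (fun w => m2w w l 0) /\ Ex (fun w => m2w w l 0) = 0.
Proof.
split; first exact: m2_intg.
have [i2 E2] := mx_mean_mul 1%:M phi0 l 0 (mx_integrable_Rlo_Rlo near0).
transitivity (q l 0 - (1%:M *m B *m phi0) l 0); last first.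
  by rewrite mul1mx best_linear_predictor_normal subrr.
rewrite -[X in _ - X]E2 [q l 0]mxE -ExB//; last exact: mx_integrable_Rlo_Rtilde near0 l 0.
by apply: eq_Ex => w; rewrite mul1mx /m2w /m2 (mulmxBr (Rlo pool (z w) b0)^T (Rtilde (z w) b0)) mxBE mulmxA.
Qed.

Lemma gtilde_varE : gtilde_var M pool j = moment_second P m.
Proof.
apply/esym/matrixP => a b; rewrite !mxE; apply: eq_Ex => w.
by rewrite m_0 [RHS]mxE big_ord1 [_^T _ _]mxE.
Qed.

Lemma GtildeE : Gtilde M pool j = moment_jacobian P m.
Proof. by apply/matrixP => a c; rewrite !mxE; apply: eq_Ex => w; rewrite mxE. Qed.

(** If [B x = 0], the leave-out predictor with coefficients [x] vanishes almost surely, and with it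
    [x^T g1]. The second-moment matrix of [gtilde] then annihilates the vector [y] with last block
    [x], so its invertibility forces [x = 0]. *)
Lemma Rlo_gram_unit : B \in unitmx.
Proof.
apply: unitmx_of_inj => x Bx.
pose y : 'cV[R]_(K + (K + T.-1)) := col_mx 0 (col_mx 0 x).
have yg w : (y^T *m gtilde pool (z w) (theta0 M)) 0 0 = (x^T *m g1w w) 0 0.
  rewrite /y /gtilde /g1_at pbeta_theta0 pbetaY_theta0 pkappa_theta0.
  by rewrite !tr_col_mx !mul_row_col !trmx0 !mul0mx !add0r.
have pred0 t : {ae P, forall w, predicted M pool j x w t 0 = 0}.
  apply: (Ex_sqr_eq0 (mpredicted x t) (predicted2 x t)).
  have : \sum_t Ex (fun w => predicted M pool j x w t 0 ^+ 2) = 0.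
    by rewrite -bilin_gram /bilin -mulmxA Bx mulmx0 mxE.
  move/(@psumr_eq0P _ _ predT) => -> // s _; apply: Ex_ge0 => w; exact: sqr_ge0.
have [iV VE] := bilin_moment_second m_intg2 y.
have VyE : bilin (moment_second P m) y y = 0.
  rewrite VE; apply: ae_eq0_Ex => //.
  have ae0 : {ae P, forall w, forall t, predicted M pool j x w t 0 = 0} by exact: filter_forall.
  apply: filterS ae0 => w pw.
  rewrite m_0 yg /g1w /g1 mulmxA -trmx_mul mxE big1 ?expr0n// => t _.
  by rewrite [_^T _ _]mxE; have -> : (Rlo pool (z w) b0 *m x) t 0 = 0 := pw t; rewrite mul0r.
(* Cauchy-Schwarz for the semidefinite form passes from a vanishing square of [y] to [y] in the
   kernel. *)
have VyO v : bilin (moment_second P m) v y = 0.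
  have := bilin_cauchy_schwarz (moment_second_sym P m) (moment_second_ge0 m_intg2) v y.
  rewrite VyE mulr0 => le; apply/eqP; rewrite -sqrf_eq0 eq_le le/=; exact: sqr_ge0.
have Vy : moment_second P m *m y = 0.
  apply/colP => a; have := VyO (delta_mx a 0).
  by rewrite /bilin trmx_delta -mulmxA -rowE !mxE.
have V_unit : moment_second P m \in unitmx by rewrite -gtilde_varE.
have : y = 0 by rewrite -[y]mul1mx -(mulVmx V_unit) -mulmxA Vy mulmx0.
by move=> /(congr1 dsubmx)/(congr1 dsubmx); rewrite /y !col_mxKd !linear0.
Qed.

Let Gg := dsubmx (dsubmx G).

Let GgE l c : Gg l c = Ex (fun w => derive1 (fun t : R =>
  gtilde pool (z w) (theta0 M + t *: delta_mx c 0) (rshift _ (rshift _ l)) 0) 0).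
Proof. by rewrite !mxE. Qed.

Let intg_derive1_g1 l c : intg (fun w => derive1 (fun t : R =>
  gtilde pool (z w) (theta0 M + t *: delta_mx c 0) (rshift _ (rshift _ l)) 0) 0).
Proof. exact: (intg_derive1_moment m_cubic m_intg (rshift _ (rshift _ l)) c). Qed.

Let slope_g1 w l c : has_slope (fun t : R =>
    gtilde pool (z w) (theta0 M + t *: delta_mx c 0) (rshift _ (rshift _ l)) 0) 0
  (derive1 (fun t : R =>
    gtilde pool (z w) (theta0 M + t *: delta_mx c 0) (rshift _ (rshift _ l)) 0) 0).
Proof. exact: (cubic_slope _ (m_cubic 0 w (rshift _ (rshift _ l)))). Qed.

Let pbeta_delta c : pbeta (delta_mx (lshift _ c) 0 : param R K) = delta_mx c 0.
Proof.
by apply/colP => i; rewrite !mxE (inj_eq (@lshift_inj _ _)).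
Qed.

Let gtilde_beta w l c (t : R) :
  gtilde pool (z w) (theta0 M + t *: delta_mx (lshift _ c) 0) (rshift _ (rshift _ l)) 0 =
  g1 pool (z w) (b0 + t *: delta_mx c 0) bY0 k0 l 0.
Proof.
rewrite gtilde_g1 /g1_at pbetaD pbetaYD pkappaD pbetaZ pbetaYZ pkappaZ pbeta_delta.
rewrite pbeta_theta0 pbetaY_theta0 pkappa_theta0.
have -> : pbetaY (delta_mx (lshift _ c) 0 : param R K) = 0.
  by apply/colP => i; rewrite !mxE eq_rlshift.
have -> : pkappa (delta_mx (lshift _ c) 0 : param R K) = 0.
  by rewrite /pkappa !mxE eq_rlshift.
by rewrite scaler0 mulr0 !addr0.
Qed.

Let gtilde_betaY w l c (t : R) :
  gtilde pool (z w) (theta0 M + t *: delta_mx (rshift _ (lshift _ c)) 0) (rshift _ (rshift _ l)) 0 =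
  g1 pool (z w) b0 (bY0 + t *: delta_mx c 0) k0 l 0.
Proof.
rewrite gtilde_g1 /g1_at pbetaD pbetaYD pkappaD pbetaZ pbetaYZ pkappaZ.
rewrite pbeta_theta0 pbetaY_theta0 pkappa_theta0.
have -> : pbeta (delta_mx (rshift _ (lshift _ c)) 0 : param R K) = 0.
  by apply/colP => i; rewrite !mxE eq_lrshift.
have -> : pbetaY (delta_mx (rshift _ (lshift _ c)) 0 : param R K) = delta_mx c 0.
  by apply/colP => i; rewrite !mxE (inj_eq (@rshift_inj _ _)) (inj_eq (@lshift_inj _ _)).
have -> : pkappa (delta_mx (rshift _ (lshift _ c)) 0 : param R K) = 0.
  by rewrite /pkappa !mxE (inj_eq (@rshift_inj _ _)) eq_rlshift.
by rewrite scaler0 mulr0 !addr0.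
Qed.

Let Gb := mx_mean P (fun w => jacobian_mx (fun b' => g pool (z w) b' phi0 bY0 k0) b0).
Let Gphi := mx_mean P (fun w => jacobian_mx (fun phi' => g pool (z w) b0 phi' bY0 k0) phi0).
Let GbY := mx_mean P (fun w => jacobian_mx (fun bY' => g pool (z w) b0 phi0 bY' k0) bY0).
Let M2b := mx_mean P (fun w => jacobian_mx (fun b' => m2 pool (z w) b' phi0) b0).

Lemma ols_jacobian_phi : Gphi = - (k0 *: (phi0^T *m B)).
Proof.
apply/matrixP => r c; rewrite ord1 mxE.
have [iB EB] := mx_mean_mul phi0^T 1%:M 0 c (mx_integrable_Rlo_Rlo near0).
have [i1 E1] := g1w_mean c; have [i2 E2] := m2w_mean c.
transitivity (Ex (fun w => g1w w c 0 + k0 * m2w w c 0 -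
    k0 * (phi0^T *m ((Rlo pool (z w) b0)^T *m Rlo pool (z w) b0) *m 1%:M) 0 c)).
  by apply: eq_Ex => w; rewrite mxE derive1_g_phi mulmx1.
rewrite ExB; [|by apply: intgD => //; exact: intgZ|exact: intgZ].
rewrite ExD//; last exact: intgZ.
by rewrite !ExZ// E1 E2 EB mulr0 addr0 sub0r mulmx1 [RHS]mxE mxZE.
Qed.

Lemma ols_jacobian_betaY : GbY = lsubmx (rsubmx (phi0^T *m Gg)).
Proof.
apply/matrixP => r c; rewrite ord1 mxE.
pose D w l := derive1 (fun t : R => gtilde pool (z w)
  (theta0 M + t *: delta_mx (rshift _ (lshift _ c)) 0) (rshift _ (rshift _ l)) 0) 0.
transitivity (Ex (fun w => \sum_l phi0 l 0 * D w l)).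
  apply: eq_Ex => w; rewrite mxE; apply: has_slope_derive1.
  have gE h : g pool (z w) b0 phi0 (bY0 + h *: delta_mx c 0) k0 0 0 =
      \sum_l phi0 l 0 * gtilde pool (z w)
        (theta0 M + h *: delta_mx (rshift _ (lshift _ c)) 0) (rshift _ (rshift _ l)) 0 +
      (k0 * (phi0^T *m m2w w) 0 0 + 0 * h + 0 * h ^+ 2).
    rewrite g_decomposition mxDE mxZE [X in X + _]mxE !mul0r !addr0; congr (_ + _).
    by apply: eq_bigr => l _; rewrite mxE gtilde_betaY.
  under eq_fun do rewrite gE; rewrite -[X in has_slope _ _ X]addr0.
  apply: has_slopeD; last exact: has_slope_quadratic.
  by apply: has_slope_sum => l; apply: has_slopeZ; exact: slope_g1.
rewrite Ex_sum => [|l _]; last exact/intgZ/intg_derive1_g1.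
rewrite !mxE; apply: eq_bigr => l _.
by rewrite ExZ; [rewrite [phi0^T _ _]mxE GgE|exact: intg_derive1_g1].
Qed.

Lemma ols_jacobian_beta : Gb = lsubmx (phi0^T *m Gg) + k0 *: (phi0^T *m M2b).
Proof.
apply/matrixP => r c; rewrite ord1 mxE.
pose D w l := derive1 (fun t : R => gtilde pool (z w)
  (theta0 M + t *: delta_mx (lshift _ c) 0) (rshift _ (rshift _ l)) 0) 0.
pose D' w l := derive1 (fun t : R => m2 pool (z w) (b0 + t *: delta_mx c 0) phi0 l 0) 0.
(* Residuals are known to be square integrable only within [r0] of [b0]; the central difference with
   step [r0] stays in that ball. *)
have iD' l : intg (fun w => D' w l).
  have e1 : `|delta_mx c 0 : 'cV[R]_K| <= 1.
    by apply: ler_norm_entries => // i k; rewrite mxE; case: (_ && _); rewrite ?normr1 ?normr0.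
  have ne s : `|s| <= r0 -> `|b0 + s *: delta_mx c 0 - b0| <= r0.
    move=> sr; rewrite addrC addKr normrZ; apply: le_trans sr.
    by rewrite ler_piMr.
  have nr : `|r0| <= r0 by rewrite gtr0_norm.
  have nr' : `|- r0| <= r0 by rewrite normrN.
  have := intgB (intgZ (2 * r0)^-1 (m2_intg l (ne _ nr))) (intgZ (2 * r0)^-1 (m2_intg l (ne _ nr'))).
  apply: eq_intg => w; rewrite /D'.
  by rewrite (quadratic_central_difference (lt0r_neq0 r0_gt0) (quadratic_m2 pool (z w) b0 phi0 l c)).
transitivity (Ex (fun w => \sum_l phi0 l 0 * D w l + k0 * \sum_l phi0 l 0 * D' w l)).
  apply: eq_Ex => w; rewrite mxE; apply: has_slope_derive1.
  have gE h : g pool (z w) (b0 + h *: delta_mx c 0) phi0 bY0 k0 0 0 =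
      \sum_l phi0 l 0 * gtilde pool (z w)
        (theta0 M + h *: delta_mx (lshift _ c) 0) (rshift _ (rshift _ l)) 0 +
      k0 * \sum_l phi0 l 0 * m2 pool (z w) (b0 + h *: delta_mx c 0) phi0 l 0.
    rewrite g_decomposition mxDE mxZE [X in X + _]mxE; congr (_ + _ * _).
      by apply: eq_bigr => l _; rewrite mxE gtilde_beta.
    by rewrite mxE; apply: eq_bigr => l _; rewrite mxE.
  under eq_fun do rewrite gE.
  apply: has_slopeD; last apply: has_slopeZ.
    by apply: has_slope_sum => l; apply: has_slopeZ; exact: slope_g1.
  by apply: has_slope_sum => l; apply: has_slopeZ; exact/quadratic_slope/quadratic_m2.
rewrite ExD; first last.
- by apply: intgZ; apply: intg_sum => l _; exact: intgZ.
- by apply: intg_sum => l _; exact/intgZ/intg_derive1_g1.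
rewrite ExZ; last by apply: intg_sum => l _; exact: intgZ.
rewrite [RHS]mxDE mxZE; congr (_ + _ * _).
  rewrite Ex_sum => [|l _]; last exact/intgZ/intg_derive1_g1.
  rewrite !mxE; apply: eq_bigr => l _.
  by rewrite ExZ; [rewrite [phi0^T _ _]mxE GgE|exact: intg_derive1_g1].
rewrite Ex_sum => [|l _]; last exact: intgZ.
rewrite mxE; apply: eq_bigr => l _; rewrite ExZ// [phi0^T _ _]mxE; congr (_ * _).
by rewrite mxE; apply: eq_Ex => w; rewrite mxE.
Qed.

Let rho := phi0^T *m Gg.
(** Coefficients of the influence function before division by the derivative in [kappa]: [phi0] on
    [g1], and on the OLS moments the derivative [rho] of [phi0^T g1] propagated through the inverse
    Gram matrix. *)
Let influence : 'cV[R]_(K + (K + T.-1)) :=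
  col_mx (lsubmx rho *m invmx A)^T (col_mx (lsubmx (rsubmx rho) *m invmx A)^T phi0).

Let influence_mul (u v : 'cV[R]_K) (y : 'cV[R]_T.-1) : influence^T *m col_mx u (col_mx v y) =
  lsubmx rho *m invmx A *m u + (lsubmx (rsubmx rho) *m invmx A *m v + phi0^T *m y).
Proof. by rewrite /influence !tr_col_mx !trmxK !mul_row_col. Qed.

(** The correction for the first steps removes [beta] and [betaY]: their direct contributions in
    [rho] cancel those coming through the inverse Gram matrix. Along [kappa] there remains
    [- phi0^T q], which the normal equation identifies with [- phi0^T B phi0]. *)
Lemma influence_jacobian (x : param R K) :
  (influence^T *m G *m x) 0 0 = - bilin B phi0 phi0 * pkappa x.
Proof.
have -> : influence^T *m G *m x = influence^T *m
    col_mx (- (A *m pbeta x)) (col_mx (- (A *m pbetaY x)) (Gg *m x)).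
  rewrite -mulmxA; congr (_ *m _); apply/colP => a.
  rewrite -(splitK a); case: (fintype.split a) => i /=.
    by rewrite col_mxEu mxNE; exact: jacobian_m1.
  rewrite col_mxEd -(splitK i); case: (fintype.split i) => l /=.
    by rewrite col_mxEu mxNE; exact: jacobian_m3.
  by rewrite col_mxEd /Gg !mul_dsub_mx [RHS]mxE [RHS]mxE.
rewrite influence_mul !mulmxN -!mulmxA [invmx A *m (A *m pbeta x)]mulmxA.
rewrite [invmx A *m (A *m pbetaY x)]mulmxA mulVmx// !mul1mx.
pose x' : param R K := col_mx 0 (col_mx 0 (dsubmx (dsubmx x))).
have xE : x = col_mx (pbeta x) (col_mx (pbetaY x) 0) + x'.
  rewrite /x' add_col_mx add_col_mx !addr0 add0r.
  by rewrite -[LHS]vsubmxK -[dsubmx x in LHS]vsubmxK.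
have rhoE : rho *m x = lsubmx rho *m pbeta x + lsubmx (rsubmx rho) *m pbetaY x + rho *m x'.
  rewrite {1}xE mulmxDr; congr (_ + _).
  rewrite -{1}[rho]hsubmxK mul_row_col; congr (_ + _).
  by rewrite -{1}[rsubmx rho]hsubmxK mul_row_col mulmx0 addr0.
rewrite mulmxA -/rho rhoE.
have -> : - (lsubmx rho *m pbeta x) + (- (lsubmx (rsubmx rho) *m pbetaY x) +
    (lsubmx rho *m pbeta x + lsubmx (rsubmx rho) *m pbetaY x + rho *m x')) = rho *m x'.
  by rewrite addrA -opprD addKr.
have xb : pbeta x' = 0 by rewrite /pbeta /x' col_mxKu.
have xbY : pbetaY x' = 0 by rewrite /pbetaY /x' col_mxKd col_mxKu.
have xk : pkappa x' = pkappa x by rewrite /pkappa /x' !col_mxKd.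
have -> : rho *m x' = - pkappa x *: (phi0^T *m q).
  rewrite /rho -mulmxA scalemxAr; congr (_ *m _); apply/colP => l.
  by rewrite /Gg !mul_dsub_mx [LHS]mxE [LHS]mxE jacobian_g1// xk mxZE mulNr.
by rewrite mxZE /bilin -mulmxA best_linear_predictor_normal; ring.
Qed.

Let M1 := - ddotX_gram M j.
Let M2phi := - mx_mean P (fun w => (Rlo0 M pool j w)^T *m Rlo0 M pool j w).

Let invmxN n (C : 'M[R]_n) : C \in unitmx -> invmx (- C) = - invmx C.
Proof.
move=> uC; have H : (- C) *m (- invmx C) = 1%:M by rewrite mulNmx mulmxN opprK mulmxV.
have [uN _] := mulmx1_unit H.
by rewrite -[LHS]mulmx1 -H mulmxA mulVmx// mul1mx.
Qed.

(** By the formula for the derivative in [phi], the [psi2] term equals [- k0 phi0^T m2] and cancels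
    the prediction part of [g]; the term with [M2b] cancels the prediction part of the derivative in
    [beta]. *)
Lemma ols_influence w :
  (g pool (z w) b0 phi0 bY0 k0 + GbY *m (- invmx M1 *m m3 (z w) bY0)
   + Gphi *m (- invmx M2phi *m m2 pool (z w) b0 phi0) + Gb *m (- invmx M1 *m m1 (z w) b0)
   - Gphi *m invmx M2phi *m M2b *m (- invmx M1 *m m1 (z w) b0)) 0 0 =
  (influence^T *m gtilde pool (z w) (theta0 M)) 0 0.
Proof.
have uB := Rlo_gram_unit.
rewrite /M1 /M2phi !invmxN// !opprK -/A -/B.
have -> : gtilde pool (z w) (theta0 M) = col_mx (m1 (z w) b0) (col_mx (m3 (z w) bY0) (g1w w)).
  by rewrite /gtilde /g1_at pbeta_theta0 pbetaY_theta0 pkappa_theta0.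
rewrite influence_mul ols_jacobian_phi ols_jacobian_betaY ols_jacobian_beta -/rho.
rewrite g_decomposition -/(g1w w) -/(m2w w).
move: (m1 (z w) b0) (m3 (z w) bY0) (g1w w) (m2w w) => u v y x.
have -> : - (k0 *: (phi0^T *m B)) *m (invmx B *m x) = - (k0 *: (phi0^T *m x)).
  by rewrite mulNmx -scalemxAl -mulmxA [B *m _]mulmxA mulmxV// mul1mx.
have -> : - (k0 *: (phi0^T *m B)) *m - invmx B *m M2b *m (invmx A *m u) =
    k0 *: (phi0^T *m M2b) *m (invmx A *m u).
  rewrite mulNmx mulmxN opprK -!scalemxAl; congr (_ *: _).
  by rewrite -[phi0^T *m B *m _]mulmxA mulmxV// mulmx1.
rewrite [(_ + _) *m (invmx A *m u)]mulmxDl !mulmxA !(mxBE, mxDE, mxNE).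
by ring.
Qed.

Lemma sigma2E : sigma2 M pool j phi0 =
  (- bilin B phi0 phi0)^-1 ^+ 2 * bilin (moment_second P m) influence influence.
Proof.
rewrite /sigma2 -/b0 -/bY0 -/k0 (bilin_moment_second m_intg2 influence).2.
have [iB EB] := mx_mean_mul phi0^T phi0 0 0 (mx_integrable_Rlo_Rlo near0).
have -> : fine 'E_P[fun w => derive1 (fun k' : R => g pool (z w) b0 phi0 bY0 k' 0 0) k0] =
    - bilin B phi0 phi0.
  rewrite /bilin -EB -ExN//; apply: eq_Ex => w; exact: derive1_g_kappa.
congr (_ * _); apply: eq_Ex => w; congr (_ ^+ 2).
by rewrite m_0; exact: ols_influence.
Qed.

Lemma sigma2_star_le_sigma2 : sigma2_star M pool j <= sigma2 M pool j phi0.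
Proof.
rewrite sigma2E; set c := - bilin B phi0 phi0.
have c0 : c != 0 by rewrite oppr_eq0 gt_eqF// bilin_gram_gt0.
have -> : c^-1 ^+ 2 * bilin (moment_second P m) influence influence =
    bilin (moment_second P m) (c^-1 *: influence) (c^-1 *: influence).
  by rewrite bilinZl bilinZr mulrA expr2.
have aG : (c^-1 *: influence)^T *m moment_jacobian P m = (delta_mx (kappa_index K) 0 : 'cV_(K + (K + 1)))^T.
  apply/rowP => i.
  have := influence_jacobian (delta_mx i 0); rewrite -colE [(col _ _) 0 0]mxE => E.
  rewrite linearZ/= -scalemxAl mxZE E -/c mulrA mulVf// mul1r /pkappa !mxE.
  by rewrite eq_sym.
rewrite /sigma2_star /Wstar GtildeE gtilde_varE.
apply: (efficient_variance_min m_intg2 _ population_jacobian_inj aG).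
by rewrite -gtilde_varE.
Qed.

End population.

(** * Recentring at the true parameter and conclusion *)

Lemma compact_translate (R : realType) (V : normedModType R) (A : set V) (c : V) :
  compact A -> compact [set h | A (c + h)].
Proof.
move=> cA; rewrite (_ : mkset _ = (fun x => x - c) @` A).
  apply: continuous_compact cA; apply: continuous_subspaceT => x.
  by apply: continuousB; [exact: cvg_id|exact: cst_continuous].
apply/seteqP; split => [h Ah|_ [x Ax <-]]; last by rewrite /= addrC subrK.
by exists (c + h) => //; rewrite addrAC subrr add0r.
Qed.

Theorem theorem2
  (d : measure_display) (Omega : measurableType d) (R : realType)
  (P : probability Omega R) (K T : nat) (T_gt0 : (0 < T)%N)
  (M : va_model P K T)
  (hmu : stationary_value_added M)
  (pool : 'I_T -> 'I_T.-1 -> {set 'I_T})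
  (hpool : leave_out_listing pool \/ leave_out_lags pool)
  (* population moments are those of an arbitrary teacher j0 *)
  (j0 : nat) (phi0 : 'cV[R]_T.-1)
  (hphi0 : best_linear_predictor M pool j0 phi0)
  (Theta : set (param R K))
  (h1a : forall j (t : 'I_T) (i : 'I_(class_size M j)),
     is_condexp P (mx_sigma (mubar M j)) (score_noise t i) (cst 0) /\
     ('E_P[score_noise t i] = 0)%E)
  (h1b : forall j (s t : 'I_T) (i : 'I_(class_size M j)), s != t ->
     is_condexp P (mx_sigma (fun w => row s (mubar M j w))) (earnings_noise t i) (cst 0))
  (h1c : forall j (s t : 'I_T), s != t ->
     independent P (mx_sigma (noise_pair M j t)) (mx_sigma (noise_pair M j s)))
  (h2a : forall j,
     mx_integrable P (fun w => (ddot (Xbar M j w))^T *m ddot (Xbar M j w)) /\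
     ddotX_gram M j \in unitmx)
  (h2b : forall j (t : 'I_T),
     (0 < 'V_P[fun w => (predicted M pool j phi0 w t 0)%R] < +oo)%E)
  (h2c : forall j (U : Omega -> 'cV[R]_T),
     U = mubar M j \/ U = epsbar M j \/ U = etabar M j ->
     mx_integrable P (fun w => (ddot (Xbar M j w))^T *m ddot (U w)) /\
     mx_mean P (fun w => (ddot (Xbar M j w))^T *m ddot (U w)) = 0)
  (h3a : compact Theta /\ interior Theta (theta0 M))
  (h3b : forall j,
     [/\ (\int[P]_w ereal_sup
            [set (fnorm (m1 (Zobs M j w) (pbeta th)) ^+ 2)%:E
              | th in Theta] < +oo)%E,
         (\int[P]_w ereal_sup
            [set (fnorm (m3 (Zobs M j w) (pbetaY th)) ^+ 2)%:E
              | th in Theta] < +oo)%E &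
         (\int[P]_w ereal_sup
            [set (fnorm (g1_at pool (Zobs M j w) th) ^+ 2)%:E
              | th in Theta] < +oo)%E])
  (h3c : iid P (teacher_data M))
  (h3d : forall j (th : param R K),
     [/\ mx_integrable P (fun w => m1 (Zobs M j w) (pbeta th) *m
                                   (m1 (Zobs M j w) (pbeta th))^T),
         mx_integrable P (fun w => m3 (Zobs M j w) (pbetaY th) *m
                                   (m3 (Zobs M j w) (pbetaY th))^T) &
         mx_integrable P (fun w => g1_at pool (Zobs M j w) th *m
                                   (g1_at pool (Zobs M j w) th)^T)])
  (h3e : forall j,
     (\int[P]_w ereal_sup
        [set (fnorm ((Rlo pool (Zobs M j w) (pbeta th))^T *m
                     Rlo pool (Zobs M j w) (pbeta th)))%:E
          | th in Theta] < +oo)%E)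
  (* the inverse defining the efficient weighting matrix W* exists *)
  (hW : gtilde_var M pool j0 \in unitmx)
  (first second : nat -> Omega -> param R K)
  (hgmm : two_step_gmm M pool Theta first second) :
  cvg_in_distribution P
    (fun J w => Num.sqrt J%:R * (pkappa (second J w) - kappa0 M))
    (gaussian 0 (sigma2_star M pool j0)) /\
  sigma2_star M pool j0 <= sigma2 M pool j0 phi0.
Proof.
have [cTheta iTheta] := h3a.
have [r0 r00 ballTheta] : exists2 r0 : R, 0 < r0 & forall h, `|h| <= r0 -> Theta (theta0 M + h).
  move: iTheta; rewrite /interior/= => /nbhs_ballP[r /= r_gt0 br].
  exists (r / 2); first by rewrite divr_gt0.
  move=> h hr; apply: br; rewrite -ball_normE/= opprD addNKr normrN.
  by apply: le_lt_trans hr _; rewrite ltr_pdivrMr// ltr_pMr// ltr1n.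
have theta0_in : Theta (theta0 M).
  by have := ballTheta 0; rewrite addr0 normr0; apply; exact: ltW.
have [hmu2 _ _] := hmu.
(* For [T = 1] the leave-out matrix has no columns, so the predictor is 0 and its variance vanishes,
   against [h2b]. *)
have T_gt1 : (1 < T)%N.
  rewrite ltnNge; apply/negP => T1.
  have := h2b j0 (Ordinal T_gt0).
  rewrite (_ : (fun w => _) = cst 0) ?variance_cst ?ltxx//.
  apply/funext => w; rewrite mxE big1// => k _.
  by exfalso; case: k => k /=; rewrite -subn1 (eqP (_ : T - 1 == 0)%N)// subn_eq0.
have gtilde2 j := intg_sqr_gtilde (h3d j).
have gtilde0 j := Ex_gtilde0 T_gt1 hpool hmu2 (fun t i => (h1a j t i).1) (h1b j)
  (h1c j) (h2c j) theta0_in (h3e j) (h3d j).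
(* [b] is completed by the true values of the other parameters, so that the shift [h] is no larger
   than [r0]. *)
have Rtilde2 j b s : `|b - beta0 M| <= r0 ->
    intg P (fun w => Rtilde (Zobs M j w) b s 0 ^+ 2).
  move=> br; pose h : param R K := col_mx (b - beta0 M) 0.
  have hr : `|h| <= r0.
    apply: ler_norm_entries => [|i k]; first exact: ltW.
    rewrite ord1 -(splitK i); case: (fintype.split i) => l /=.
      by rewrite col_mxEu; apply: le_trans (ler_entry_norm _ _ _) br.
    by rewrite col_mxEd mxE normr0 ltW.
  have := intg_sqr_Rtilde T_gt1 hpool (h3e j) s (ballTheta _ hr).
  by rewrite pbetaD pbeta_theta0 /pbeta /h col_mxKu addrC subrK.
have pvar : exists t, (0 < 'V_P[fun w => (predicted M pool j0 phi0 w t 0)%R])%E.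
  by exists (Ordinal T_gt0); have /andP[] := h2b j0 (Ordinal T_gt0).
have [gram_intg gram_unit] := h2a j0.
split; last exact: (sigma2_star_le_sigma2 r00 (gtilde2 j0) (gtilde0 j0) (Rtilde2 j0)
  gram_intg gram_unit hphi0 pvar hW).
pose m j w h := gtilde pool (Zobs M j w) (theta0 M + h).
have m_cubic j w a : cubic (fun h => m j w h a 0) by exact: gtilde_cubic.
have m_intg2 j a h b h' : intg P (fun w => m j w h a 0 * m j w h' b 0).
  exact: intg_gtilde_mul (h3d j) _ _ _ _.
have m_intg j a h : intg P (fun w => m j w h a 0) by exact: intg_gtilde (h3d j) _ _.
have m_iid1 (c : 'rV_(K + (K + T.-1))) h : iid_rv P (fun j w => (c *m m j w h) 0 0).
  apply: (iid_rv_Zobs h3c (f := fun z => (c *m gtilde pool z (theta0 M + h)) 0 0)) => d' U Z mZ.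
  by apply: mx_measurableM; [exact: mx_measurable_cst|exact: mx_measurable_gtilde].
have m_iid2 a h b h' : iid_rv P (fun j w => m j w h a 0 * m j w h' b 0).
  apply: (iid_rv_Zobs h3c (f := fun z =>
    gtilde pool z (theta0 M + h) a 0 * gtilde pool z (theta0 M + h') b 0)) => d' U Z mZ.
  by apply: measurable_funM; exact: mx_measurable_gtilde.
have meanE := moment_mean_iid j0 m_intg m_iid1.
have secondE := moment_second_iid j0 m_intg2 m_iid2.
have jacE := moment_jacobian_iid j0 m_cubic m_intg m_iid1.
have sE : sigma2_star M pool j0 = invmx ((moment_jacobian P m)^T *m invmx (moment_second P m) *m
    moment_jacobian P m) (kappa_index K) (kappa_index K).
  by rewrite jacE secondE /sigma2_star /Wstar GtildeE gtilde_varE.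
have uV : moment_second P m \in unitmx by rewrite secondE -gtilde_varE.
have Ginj (x : param R K) : moment_jacobian P m *m x = 0 -> x = 0.
  rewrite jacE; exact: (population_jacobian_inj r00 (gtilde2 j0) (gtilde0 j0) (Rtilde2 j0)
    gram_intg gram_unit hphi0 pvar).
(* Selects the normal branch of [gaussian]. *)
have v0 : 0 < sigma2_star M pool j0.
  by rewrite sE; exact: efficient_variance_gt0 (m_intg2 0) uV Ginj _.
rewrite /gaussian (gt_eqF v0) sE.
have [_ msecond fmin smin] := hgmm.
pose Kh := [set h | Theta (theta0 M + h)].
have cK : compact Kh by exact: compact_translate cTheta.
have avgE J w th : moment_avg m J w (th - theta0 M) = gmean M pool J w th.
  exact: (moment_avg_translate (fun j w => gtilde pool (Zobs M j w)) (theta0 M)).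
have avgE' J w h : moment_avg m J w h = gmean M pool J w (theta0 M + h) by [].
have varE J w th : moment_second_avg m J w (th - theta0 M) = gtilde_var_hat M pool J w th.
  exact: (moment_second_avg_translate (fun j w => gtilde pool (Zobs M j w)) (theta0 M)).
have minE J w W th : gmm_minimizer M pool Theta J w W th ->
    Kh (th - theta0 M) /\ forall h, Kh h ->
    bilin W (moment_avg m J w (th - theta0 M)) (moment_avg m J w (th - theta0 M)) <=
    bilin W (moment_avg m J w h) (moment_avg m J w h).
  move=> [Tth H]; split; first by rewrite /Kh/= addrC subrK.
  by move=> h Kh_h; rewrite avgE avgE'; exact: H.
rewrite (_ : (fun J w => _) = fun J w => Num.sqrt J%:R *
    (fun J w => second J w - theta0 M) J w (kappa_index K) 0); last first.
  apply/funext => J; apply/funext => w; congr (_ * _).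
  by rewrite mxBE -[kappa0 M]pkappa_theta0 /pkappa !mxE.
apply: (cubic_gmm_clt m_cubic (m_intg 0) m_iid1 m_iid2 (m_intg2 0) r00 ballTheta cK _ _ uV Ginj
  (first := fun J w => first J w - theta0 M)).
- by rewrite meanE; exact: moment_mean0 (gtilde0 j0).
- move=> h _; rewrite meanE; exact: (population_identified r00 (gtilde2 j0) (gtilde0 j0) (Rtilde2 j0)
    gram_intg gram_unit hphi0 pvar).
- by move=> J; under eq_fun do rewrite mxBE; apply: measurable_funB.
- by move=> J w; exact: minE (fmin J w).
- by move=> J w; rewrite varE => u; exact: minE (smin J w u).
Qed.
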